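(* Let $d\geq1$ be an integer, $a>0$, $(\alpha,\beta,\gamma)\in\mathcal P_d$ (so that $G_d(\cdot;a,\alpha,\beta,\gamma)\in\mathcal G_d$) and $k\in\mathbb{N}$. Let $\mathfrak M_{-k}$ denote the transitive downgrading (descente) of order $k$. Then $\mathfrak M_{-k}(G_d(\cdot;a,\alpha,\beta,\gamma))\in\mathcal G_{d+k}$ and its radial part is proportional to $g_d(\cdot;a,\alpha-\frac k2,\beta-\frac k2,\gamma-\frac k2)$, provided that $(\alpha-\frac k2,\beta-\frac k2,\gamma-\frac k2)\in\mathcal P_{d+k}$.
   Context: For an integer $d\geq1$, $\mathcal P_d$ is the set of triplets $(\alpha,\beta,\gamma)$ of positive reals with $\alpha>\frac d2$, $2(\beta-\alpha)(\gamma-\alpha)\geq\alpha$ and $2(\beta+\gamma)\geq6\alpha+1$ (these imply $\beta>\alpha$, $\gamma>\alpha$). For $a>0$ and $\alpha>\frac d2$, $\beta>\alpha$, $\gamma>\alpha$, let $$g_d(r;a,\alpha,\beta,\gamma)=\frac{\Gamma(\beta-\frac d2)\Gamma(\gamma-\frac d2)}{\Gamma(\beta-\alpha+\gamma-\frac d2)\Gamma(\alpha-\frac d2)}\left(1-\frac{r^2}{a^2}\right)^{\beta-\alpha+\gamma-\frac d2-1}{}_2F_1\left(\beta-\alpha,\gamma-\alpha;\beta-\alpha+\gamma-\tfrac d2;1-\tfrac{r^2}{a^2}\right)$$ for $0\leq r<a$ and $g_d(r;a,\alpha,\beta,\gamma)=0$ for $r\geq a$, where ${}_2F_1$ is the Gauss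 hypergeometric function. The Gauss hypergeometric covariance in $\mathbb{R}^d$ is $G_d(\boldsymbol h;a,\alpha,\beta,\gamma)=g_d(\|\boldsymbol h\|;a,\alpha,\beta,\gamma)$, $\boldsymbol h\in\mathbb{R}^d$. $\mathcal G_d$ is the set of kernels on $\mathbb{R}^d$ of the form $\sigma^2G_d(\cdot;a,\alpha,\beta,\gamma)$ with $\sigma>0$, $a>0$, $(\alpha,\beta,\gamma)\in\mathcal P_d$. The spectral density of a covariance $C$ in $\mathbb{R}^d$ is its Fourier transform $\widetilde C(\boldsymbol u)=\int_{\mathbb{R}^d}C(\boldsymbol h)e^{-2\pi i\langle\boldsymbol u,\boldsymbol h\rangle}d\boldsymbol h$; if $C$ is isotropic, its radial spectral density is the function $\widetilde c$ on $[0,+\infty[$ with $\widetilde C(\boldsymbol u)=\widetilde c(\|\boldsymbol u\|)$. The mont\'ee of order $k<d$ is the operator $\mathfrak M_k$ that transforms an isotropic covariance in $\mathbb{R}^d$ into the isotropic covariance in $\mathbb{R}^{d-k}$ with the same radial spectral density. The reciprocal operator is the descente of order $k$, denoted $\mathfrak M_{-k}$: it transforms an isotropic covariance in $\mathbb{R}^d$ into the isotropic covariance in $\mathbb{R}^{d+k}$ with the same radial spectral density (when such a covariance exists). *)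

(* Defs.v *)
From HB Require Import structures.
From mathcomp Require Import all_boot all_order all_algebra.
From mathcomp Require Import complex.
From mathcomp Require Import all_classical all_reals all_analysis.
Set Implicit Arguments.
Unset Strict Implicit.
Unset Printing Implicit Defensive.
Import Order.TTheory GRing.Theory Num.Theory.
Import numFieldNormedType.Exports.
Local Open Scope classical_set_scope.
Local Open Scope ring_scope.

(* mathcomp-analysis has a Borel sigma-algebra on n-tuples of reals but no
   n-dimensional Lebesgue measure: it is built here by iterating products. *)
Definition cons_pair (R : realType) (n : nat)
    (p : (measurableTypeR R * n.-tuple (measurableTypeR R))%type) :
    n.+1.-tuple (measurableTypeR R) :=
  [the n.+1.-tuple (measurableTypeR R) of p.1 :: p.2].

Lemma measurable_cons_pair (R : realType) (n : nat) :
  measurable_fun setT (@cons_pair R n).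
Proof. exact: measurable_cons. Qed.

Section cons_lebesgue.
Context (R : realType) (n : nat)
  (nu : {sigma_finite_measure set (n.-tuple (measurableTypeR R)) -> \bar R}).

Definition cons_lebesgue : set (n.+1.-tuple (measurableTypeR R)) -> \bar R :=
  pushforward (@lebesgue_measure R \x nu)%E (@cons_pair R n).

Let cons_lebesgue0 : cons_lebesgue set0 = 0%E.
Proof. by rewrite /cons_lebesgue /pushforward preimage_set0 measure0. Qed.

Let cons_lebesgue_ge0 A : (0 <= cons_lebesgue A)%E.
Proof. exact: (measure_ge0 (@lebesgue_measure R \x nu)%E). Qed.

Let cons_lebesgue_sigma_additive : semi_sigma_additive cons_lebesgue.
Proof.
move=> F mF tF mUF; rewrite /cons_lebesgue /pushforward preimage_bigcup.
apply: measure_semi_sigma_additive.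
- by move=> k; rewrite -[X in measurable X]setTI; exact: measurable_cons_pair.
- apply/trivIsetP => /= i j _ _ ij; rewrite -preimage_setI.
  by move/trivIsetP : tF => /(_ _ _ _ _ ij) ->//; rewrite preimage_set0.
- rewrite -preimage_bigcup -[X in measurable X]setTI.
  exact: measurable_cons_pair.
Qed.

HB.instance Definition _ := isMeasure.Build _ _ _ cons_lebesgue
  cons_lebesgue0 cons_lebesgue_ge0 cons_lebesgue_sigma_additive.

Let cons_lebesgue_sigma_finite : sigma_finite setT cons_lebesgue.
Proof.
have /sigma_finiteP[F [FT ndF mF]] := sigma_finiteT (@lebesgue_measure R).
have /sigma_finiteP[G [GT ndG mG]] := sigma_finiteT nu.
pose uncons (t : n.+1.-tuple (measurableTypeR R)) : measurableTypeR R * _ :=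
  (thead t, [tuple of behead t]).
exists (fun k => uncons @^-1` (F k `*` G k)).
  rewrite -preimage_bigcup -(preimage_setT uncons); congr (_ @^-1` _).
  rewrite -setXTT FT GT predeqE => -[x y]; split.
    move=> [/= [i _ Fx] [j _ Gy]]; exists (maxn i j) => //; split.
    - by move: x Fx; exact/subsetPset/ndF/leq_maxl.
    - by move: y Gy; exact/subsetPset/ndG/leq_maxr.
  by move=> [i _ []/= ? ?]; split; exists i.
move=> k; have [? ?] := mF k; have [? ?] := mG k; split.
  rewrite -[X in measurable X]setTI.
  apply: measurable_fun_pair => //; last exact: measurableX.
  - exact: measurable_tnth.
  - exact: measurable_behead.
rewrite /cons_lebesgue /pushforward -comp_preimage.
rewrite (_ : uncons \o _ = id); last first.
  by apply/funext => -[x t]; congr pair; exact/val_inj.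
by rewrite preimage_id product_measure1E// lte_mul_pinfty// ge0_fin_numE.
Qed.

HB.instance Definition _ := Measure_isSigmaFinite.Build _ _ _ cons_lebesgue
  cons_lebesgue_sigma_finite.
End cons_lebesgue.

Fixpoint lebesgue_tuple (R : realType) (n : nat) :
    {sigma_finite_measure set (n.-tuple (measurableTypeR R)) -> \bar R} :=
  match n with
  | 0 => @dirac _ _ [tuple] R
  | m.+1 => @cons_lebesgue R m (lebesgue_tuple R m)
  end.

Lemma lebesgue_tuple_box (R : realType) (n : nat)
    (A : 'I_n -> set (measurableTypeR R)) :
  (forall i, measurable (A i)) ->
  lebesgue_tuple R n [set t | forall i, A i (tnth t i)] =
  (\prod_(i < n) @lebesgue_measure R (A i))%E.
Proof.
elim: n A => [|n IH] A mA.
  rewrite big_ord0 /= diracE mem_set//= => -[].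
  by case.
rewrite big_ord_recl -(IH (fun i => A (lift ord0 i)))// -product_measure1E//.
  congr (product_measure1 _ _ _); apply/seteqP; split => -[x t] /= H.
    by split=> [|i]; [have := H ord0|have := H (lift ord0 i); rewrite tnthS].
  move=> i; case: (unliftP ord0 i) => [j|] ->; rewrite ?tnthS; [exact: H.2|exact: H.1].
rewrite (_ : mkset _ = \bigcap_(i in setT) (fun t => tnth t i) @^-1` A (lift ord0 i)).
  apply: fin_bigcap_measurable => // i _.
  by rewrite -[X in measurable X]setTI; apply: measurable_tnth.
by apply/seteqP; split=> t /= H i; [move=> _|]; exact: H.
Qed.

Definition row_of_tuple (R : realType) (d : nat) (t : d.-tuple R) : 'rV[R]_d :=
  \row_i tnth t i.

Definition dotp (R : realType) (d : nat) (u v : 'rV[R]_d) : R :=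
  \sum_(i < d) u ord0 i * v ord0 i.

(* The library norm `|h| on 'rV[R]_d is the sup norm. *)
Definition enorm (R : realType) (d : nat) (h : 'rV[R]_d) : R :=
  Num.sqrt (dotp h h).

Definition Gamma (R : realType) (x : R) : R :=
  \int[lebesgue_measure]_(t in `]0, +oo[) (t `^ (x - 1) * expR (- t)).

Definition rising (R : realType) (x : R) (n : nat) : R :=
  \prod_(i < n) (x + i%:R).

(* Gauss series; only used for 0 < z <= 1. At z = 1 the series converges if
   a + b < c. *)
Definition hyp2F1 (R : realType) (a b c z : R) : R :=
  limn (series (fun n : nat =>
    rising a n * rising b n / rising c n * z ^+ n / (n`!)%:R)).

Definition Pset (R : realType) (d : nat) (al be ga : R) : Prop :=
  (0 < al /\ 0 < be /\ 0 < ga) /\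
  [/\ d%:R / 2 < al,
      2 * (be - al) * (ga - al) >= al
    & 2 * (be + ga) >= 6 * al + 1].

Definition gauss_radial (R : realType) (d : nat) (a al be ga r : R) : R :=
  let c := be - al + ga - d%:R / 2 in
  if r < a then
    Gamma (be - d%:R / 2) * Gamma (ga - d%:R / 2)
      / (Gamma c * Gamma (al - d%:R / 2))
    * (1 - r ^+ 2 / a ^+ 2) `^ (c - 1)
    * hyp2F1 (be - al) (ga - al) c (1 - r ^+ 2 / a ^+ 2)
  else 0.

Definition gauss_cov (R : realType) (d : nat) (a al be ga : R)
    (h : 'rV[R]_d) : R :=
  gauss_radial d a al be ga (enorm h).

Definition gauss_class (R : realType) (d : nat) : set ('rV[R]_d -> R) :=
  [set C | exists sigma a al be ga : R,
    [/\ 0 < sigma, 0 < a, Pset d al be ga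
      & C = (fun h => sigma ^+ 2 * gauss_cov a al be ga h)]].

(* Only the values of c on [0, +oo[ matter. *)
Definition radial_part (R : realType) (d : nat) (C : 'rV[R]_d -> R)
    (c : R -> R) : Prop :=
  forall h, C h = c (enorm h).

Definition pos_semidef (R : realType) (d : nat) (C : 'rV[R]_d -> R) : Prop :=
  forall (n : nat) (x : 'I_n -> 'rV[R]_d) (l : 'I_n -> R),
    0 <= \sum_(i < n) \sum_(j < n) l i * l j * C (x i - x j).

(* Continuity and absolute integrability make the spectral density well defined
   and make it determine the covariance; symmetry follows from isotropy. *)
Definition isotropic_covariance (R : realType) (d : nat)
    (C : 'rV[R]_d -> R) : Prop :=
  [/\ pos_semidef C,
      exists c, radial_part C c,
      continuous C
    & (lebesgue_tuple R d).-integrable setT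
        (fun t => (C (row_of_tuple t))%:E)].

(* Integral of C(h) e^{-2 pi i <u, h>} dh, by real and imaginary parts. *)
Definition fourier (R : realType) (d : nat) (C : 'rV[R]_d -> R)
    (u : 'rV[R]_d) : R[i] :=
  Complex
    (\int[lebesgue_tuple R d]_t
       (C (row_of_tuple t) * cos (2 * pi * dotp u (row_of_tuple t))))
    (- \int[lebesgue_tuple R d]_t
       (C (row_of_tuple t) * sin (2 * pi * dotp u (row_of_tuple t)))).

Definition radial_spectral_density (R : realType) (d : nat)
    (C : 'rV[R]_d -> R) (c : R -> R[i]) : Prop :=
  forall u, fourier C u = c (enorm u).

(* Graph of the operator (partial on isotropic covariances in R^d) sending C to
   the isotropic covariance C' in R^(d+k) with the same radial spectral
   density. *)
Definition descente (R : realType) (d k : nat) (C : 'rV[R]_d -> R)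
    (C' : 'rV[R]_(d + k) -> R) : Prop :=
  [/\ isotropic_covariance C, isotropic_covariance C'
    & exists c, radial_spectral_density C c /\ radial_spectral_density C' c].

(* Main.v *)
Require Import Defs.
From HB Require Import structures.
From mathcomp Require Import all_boot all_order all_algebra.
From mathcomp Require Import ring lra zify.
From mathcomp Require Import complex.
From mathcomp Require Import all_classical all_reals all_analysis.
From mathcomp Require Import measurable_realfun.
Set Implicit Arguments.
Unset Strict Implicit.
Unset Printing Implicit Defensive.
Import Order.TTheory GRing.Theory Num.Theory.
Import numFieldNormedType.Exports.
Local Open Scope classical_set_scope.
Local Open Scope ring_scope.

(* Shifting all three parameters by -k/2 in dimension d amounts to keeping them and
   replacing d by d + k in the radial part: both kernels have, up to a positive
   constant, the radial part g_(d+k)(.; a, alpha, beta, gamma).  It therefore suffices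
   to see that the spectral density of G_n(.; a, alpha, beta, gamma) is a constant
   times a function of |u| which does not depend on n.  Writing the radial part as
   (a^2 - r^2)_+^(mu-1) sum_m e_m (a^2 - r^2)_+^m / (mu)_m with
   mu = beta - alpha + gamma - n/2, one integrates out the n coordinates one at a time;
   each integration raises mu by 1/2 and multiplies the generating series of e by
   exp(-pi^2 u_i^2 x).  The outcome has mu = beta + gamma - alpha for every n and is a
   multiple of 1F2(alpha; beta, gamma; -(pi a |u|)^2).
   This 1F2 is nonnegative by Gasper's expansion in squares of Bessel functions, all of
   whose coefficients are nonnegative under the conditions defining P_d.  Fourier
   inversion (Abel means, that is, convolution with products of Poisson kernels) turns
   nonnegativity of the spectral density into positive semidefiniteness and gives the
   uniqueness of the covariance with a given spectral density. *)

(** * Rising factorials and terminating hypergeometric sums *)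

Section rising.
Context {R : realType}.
Implicit Types (x y : R) (n m : nat).

(** No Gamma or Beta value is ever computed. Only proportionality is claimed, so Gauss's value of
    2F1 at 1 and the integrals of (1 - t^2)^(mu-1) enter through recurrences in their parameters,
    and the constants that remain need only be positive. The conditions of [Pset] act at separate
    places. alpha > n/2 makes the Gauss series converge at argument 1, that is, at the centre of the
    ball. Together with 2(beta+gamma) >= 6 alpha + 1 it gives mu > (n+1)/2 >= 1, so every profile is
    continuous. The two inequalities on beta and gamma are the coefficient comparison behind the
    sign of Gasper's coefficients. A factor of the spectral series may diverge by itself, so this
    series is handled as a double series with joint denominators (mu)_(i+j), summed by rows and by
    diagonals under a product bound. Abel weights make Fubini legitimate without any decay estimate
    for the 1F2, and their one-variable integrals have elementary primitives. The boundedness that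
    they need in the uniqueness part is free: a positive semidefinite kernel is bounded by its value
    at 0. *)

Lemma rising0 x : rising x 0 = 1.
Proof. by rewrite /rising big_ord0. Qed.

Lemma risingS x n : rising x n.+1 = rising x n * (x + n%:R).
Proof. by rewrite /rising big_ord_recr. Qed.

Lemma risingSl x n : rising x n.+1 = x * rising (x + 1) n.
Proof.
rewrite /rising big_ord_recl /= addr0; congr (_ * _); apply: eq_bigr => i _.
by rewrite /bump /= add1n -natr1; ring.
Qed.

Lemma risingD x m n : rising x (m + n) = rising x m * rising (x + m%:R) n.
Proof.
elim: n => [|n IH]; first by rewrite addn0 rising0 mulr1.
by rewrite addnS !risingS IH natrD; ring.
Qed.

Lemma rising_gt0 x n : 0 < x -> 0 < rising x n.
Proof. by move=> x0; apply: prodr_gt0 => i _; rewrite ltr_wpDr. Qed.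

Lemma rising_ge0 x n : 0 <= x -> 0 <= rising x n.
Proof. by move=> x0; apply: prodr_ge0 => i _; rewrite addr_ge0. Qed.

Lemma rising_neq0 x n : 0 < x -> rising x n != 0.
Proof. by move=> x0; rewrite gt_eqF// rising_gt0. Qed.

Lemma ler_rising x y n : 0 <= x -> x <= y -> rising x n <= rising y n.
Proof.
move=> x0 xy; apply: ler_prod => i _.
by rewrite addr_ge0//= lerD2r.
Qed.

(** Reversing the order of the factors; this trades the negative arguments that occur in the
    summation formulas for signs. *)
Lemma rising_opp x n : rising (- x - n%:R + 1) n = (-1) ^+ n * rising x n.
Proof.
elim: n => [|n IH]; first by rewrite !rising0 expr0 mulr1.
rewrite risingSl risingS.
rewrite (_ : - x - n.+1%:R + 1 + 1 = - x - n%:R + 1) ?IH; last by rewrite -natr1; ring.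
by rewrite exprS -natr1; ring.
Qed.

(** Chu-Vandermonde. In the induction the new factor is split as x + y + n = (x + i) + (y + n - i),
    which yields Pascal's rule. *)
Lemma rising_vandermonde x y n :
  \sum_(i < n.+1) 'C(n, i)%:R * rising x i * rising y (n - i) = rising (x + y) n.
Proof.
elim: n => [|n IH]; first by rewrite big_ord1 !rising0 bin0 !mulr1.
rewrite risingS -IH mulr_suml.
have E (i : 'I_n.+1) : 'C(n, i)%:R * rising x i * rising y (n - i) * (x + y + n%:R) =
    'C(n, i)%:R * rising x i.+1 * rising y (n - i) +
    'C(n, i)%:R * rising x i * rising y (n.+1 - i).
  have iN : (i <= n)%N by rewrite -ltnS.
  by rewrite subSn// !risingS natrB//; ring.
rewrite (eq_bigr _ (fun i _ => E i)) big_split /=.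
rewrite big_ord_recl [X in _ = _ + X]big_ord_recl /= bin0 !mul1r.
rewrite !subn0 /=.
rewrite [RHS]addrCA bin0; congr (_ + _); first by rewrite mul1r.
under eq_bigr => i _ do rewrite /bump /= add1n subSS binS natrD !mulrDl.
rewrite big_split /= addrC; congr (_ + _).
rewrite big_ord_recr /= bin_small// !mul0r addr0.
by apply: eq_bigr => i _; rewrite /bump /= add1n subSS.
Qed.

Lemma binS_natr n k : (k < n)%N ->
  'C(n, k.+1)%:R = (n - k)%:R / k.+1%:R * 'C(n, k)%:R :> R.
Proof.
move=> kn; apply: (@mulfI _ k.+1%:R); first by rewrite pnatr_eq0.
rewrite -natrM mul_bin_left natrM.
by field; rewrite addrC natr1 pnatr_eq0.
Qed.

(** The Pfaff-Saalschutz sum of a balanced terminating 3F2 at 1, cleared of denominators so that it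
    is a polynomial identity valid for all a, b, c. *)
Lemma saalschutz (a b c : R) N :
  \sum_(k < N.+1) 'C(N, k)%:R * rising a k * rising b k *
     rising (c - a - b) (N - k) * rising (c + k%:R) (N - k) =
  rising (c - a) N * rising (c - b) N.
Proof.
elim: N => [|N IH]; first by rewrite big_ord1 /= !rising0 bin0 !mulr1.
pose t n k := 'C(n, k)%:R * rising a k * rising b k *
     rising (c - a - b) (n - k) * rising (c + k%:R) (n - k).
(* Creative telescoping: the terms satisfy the recurrence in N up to a difference in k, and the
   subtracted product is its certificate. At K = N it cancels the extra term k = N + 1. *)
have partial K : (K <= N)%N ->
    \sum_(k < K.+1) t N.+1 k =
    (c - a + N%:R) * (c - b + N%:R) * \sum_(k < K.+1) t N k -
    'C(N, K)%:R * rising a K.+1 * rising b K.+1 * rising (c - a - b) (N - K)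
      * rising (c + K%:R) (N - K).
  elim: K => [|K IHK] KN.
    rewrite !big_ord1 /t !bin0 !subn0 !addr0 !rising0 ![rising _ 1]risingS !rising0.
    by rewrite !risingS; ring.
  rewrite big_ord_recr /= IHK 1?ltnW// [in RHS]big_ord_recr /= /t.
  have [M NE] : exists M, N = (K.+1 + M)%N by exists (N - K.+1)%N; rewrite subnKC.
  rewrite binS natrD binS_natr// subSS (_ : N - K = M.+1)%N; last first.
    by rewrite NE addSnnS addKn.
  rewrite (_ : N - K.+1 = M)%N; last by rewrite NE addKn.
  rewrite (risingSl (c + K%:R)) ![rising (_ - _ - _) _.+1]risingS.
  rewrite (_ : c + K.+1%:R = c + K%:R + 1); last by rewrite -natr1; ring.
  rewrite (_ : rising (c + K%:R + 1) M.+1 = rising (c + K%:R + 1) M * (c + N%:R)); last first.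
    by rewrite risingS NE natrD -natr1; congr (_ * _); ring.
  rewrite ![rising _ K.+2]risingS ![rising _ K.+1]risingS NE natrD -!natr1.
  have K1 : K%:R + 1 != 0 :> R by rewrite natr1 pnatr_eq0.
  by field.
rewrite big_ord_recr /= (partial N)// IH binn subnn !rising0 !risingS /t binn subnn !rising0.
by ring.
Qed.
End rising.

(** * Bailey inversion and the sign of Gasper's coefficients *)

Section finite_identities.
Context {R : realType}.
Implicit Types (x y : R) (n m : nat).

Lemma big_triangle_exchange (F : nat -> nat -> R) M :
  \sum_(n < M) \sum_(j < n.+1) F n j = \sum_(j < M) \sum_(l < M - j) F (j + l)%N j.
Proof.
elim: M => [|M IH]; first by rewrite !big_ord0.
rewrite big_ord_recr /= IH [RHS]big_ord_recr /= subSnn big_ord1 addn0.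
rewrite [X in _ + X = _]big_ord_recr /= addrA; congr (_ + _).
rewrite -big_split /=; apply: eq_bigr => j _.
by rewrite subSn 1?ltnW// big_ord_recr /= subnKC// ltnW.
Qed.

(** The two triangular matrices of Bailey's transform are inverse to each other; this is the entry
    of their product, after a shift of x. *)
Lemma bailey_orthogonality x L : 0 < x ->
  \sum_(l < L.+1) (-1) ^+ l * (2 * l%:R + x) * rising x l /
     (l`!%:R * (L - l)`!%:R * rising x (L + l).+1) = (L == 0)%N%:R.
Proof.
move=> x0.
have rn n : rising x n != 0 by rewrite rising_neq0.
have fn n : n`!%:R != 0 :> R by rewrite pnatr_eq0 -lt0n fact_gt0.
case: L => [|L].
  rewrite big_ord1 /= expr0 risingS rising0 fact0 addr0 mulr0 add0r.
  by field; rewrite gt_eqF.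
(* The truncated sums have a closed form. Writing L = N + M + 1 keeps the truncation strictly below
   L; with M = 0 only the last term is missing, and it cancels the closed form. *)
have partial N M : \sum_(l < N.+1) (-1) ^+ l * (2 * l%:R + x) * rising x l /
     (l`!%:R * ((N + M).+1 - l)`!%:R * rising x ((N + M).+1 + l).+1) =
     (-1) ^+ N * rising x N.+1 / ((N + M).+1%:R * N`!%:R * M`!%:R * rising x ((N + M).+1 + N).+1).
  elim: N M => [M|N IH M].
    rewrite big_ord1 /= subn0 addn0 add0n expr0 fact0 mulr0 !add0r !mul1r rising0 mulr1.
    rewrite factS natrM [rising x 1]risingS rising0 addr0 mul1r mulr1.
    by field; rewrite fn rn/= addrC natr1 pnatr_eq0.
  rewrite big_ord_recr /= addSnnS IH -addSnnS.
  rewrite (_ : (N.+1 + M).+1 - N.+1 = M.+1)%N; last by rewrite subSS addSnnS addKn.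
  rewrite [((N.+1 + M).+1 + N.+1)%N]addnS !factS !natrM.
  rewrite [rising x ((N.+1 + M).+1 + N).+2]risingS [rising x N.+2]risingS.
  have := rn ((N.+1 + M).+1 + N).+1; move: (rising x ((N.+1 + M).+1 + N).+1) => r2 r20.
  have := fn N; have := fn M; move: (M`!%:R) (N`!%:R) => f2 f1 f20 f10.
  move: (rising x N.+1) => r1; rewrite exprS; move: ((-1) ^+ N) => s.
  have -> : ((N.+1 + M).+1 + N).+1%:R = N%:R + 1 + M%:R + 1 + N%:R + 1 :> R.
    by rewrite -natr1 natrD -natr1 natrD -natr1.
  have -> : (N.+1 + M).+1%:R = N%:R + 1 + M%:R + 1 :> R by rewrite -natr1 natrD -natr1.
  rewrite -!natr1.
  have R0 : x + (N%:R + 1 + M%:R + 1 + N%:R + 1) != 0.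
    by rewrite gt_eqF// ltr_wpDr// !addr_ge0.
  have N0 : N%:R + 1 != 0 :> R by rewrite natr1 pnatr_eq0.
  have M0 : M%:R + 1 != 0 :> R by rewrite natr1 pnatr_eq0.
  have L0 : N%:R + 1 + M%:R + 1 != 0 :> R by rewrite gt_eqF// ltr_wpDl// !addr_ge0.
  move: R0 N0 M0 L0; move: (N%:R) (M%:R) => u v R0 N0 M0 L0.
  by field; rewrite R0 r20 f20 f10 N0 L0 M0.
have := partial L 0%N; rewrite addn0 fact0 => pL.
rewrite big_ord_recr /= {}pL subnn fact0 !factS natrM exprS addnS.
rewrite [rising x (L.+1 + L).+2]risingS.
have -> : x + (L.+1 + L).+1%:R = 2 * L.+1%:R + x by rewrite -addnS natrD; ring.
have q0 : 2 * L.+1%:R + x != 0 by rewrite gt_eqF// ltr_wpDl// mulr_ge0.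
have L0 : L.+1%:R != 0 :> R by rewrite pnatr_eq0.
have := rn (L.+1 + L).+1; have := fn L.
move: q0 L0; move: (2 * L.+1%:R + x) (L.+1%:R) (L`!%:R) (rising x L.+1) (rising x (L.+1 + L).+1).
move: ((-1) ^+ L) => s q l f r1 r2 q0 l0 f0 r20.
by field; rewrite q0 l0 f0 r20.
Qed.


(** After exchanging the sums, the coefficient of f j is an orthogonality sum with x + 2j in place
    of x and m - j in place of L. *)
Lemma bailey_inversion x (f : nat -> R) m : 0 < x ->
  \sum_(n < m.+1)
     (\sum_(j < n.+1) (-1) ^+ (n - j) * rising x (n + j) / (n - j)`!%:R * f j)
     * (2 * n%:R + x) / ((m - n)`!%:R * rising x (m + n).+1) = f m.
Proof.
move=> x0.
have rn n : rising x n != 0 by rewrite rising_neq0.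
have fn n : n`!%:R != 0 :> R by rewrite pnatr_eq0 -lt0n fact_gt0.
under eq_bigr => n _ do rewrite !mulr_suml.
pose F n j := (-1) ^+ (n - j) * rising x (n + j) / (n - j)`!%:R * f j *
  (2 * n%:R + x) / ((m - n)`!%:R * rising x (m + n).+1).
rewrite (big_triangle_exchange F).
have E (j : 'I_m.+1) : \sum_(l < m.+1 - j) F (j + l)%N j = (m - j == 0)%N%:R * f j.
  have jm : (j <= m)%N by rewrite -ltnS.
  have xj : 0 < x + (2 * j)%:R by rewrite ltr_wpDr.
  rewrite -(bailey_orthogonality (m - j) xj) subSn// mulr_suml.
  apply: eq_bigr => l _; have lm : (l <= m - j)%N by rewrite -ltnS.
  rewrite /F addKn subnDA.
  rewrite (_ : rising x (j + l + j) = rising x (2 * j) * rising (x + (2 * j)%:R) l); last first.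
    by rewrite -risingD; congr (rising _ _); lia.
  rewrite (_ : rising x (m + (j + l)).+1 = rising x (2 * j) * rising (x + (2 * j)%:R) (m - j + l).+1); last first.
    by rewrite -risingD; congr (rising _ _); lia.
  have := rising_neq0 (m - j + l).+1 xj; have := fn l; have := fn (m - j - l)%N.
  have := rn (2 * j)%N; rewrite natrM !natrD.
  move: (rising _ (2 * j)) (_`!%:R) (_`!%:R) (rising _ (m - j + l).+1) => r1 f1 f2 r2 *.
  by field; apply/and4P; split.
rewrite (eq_bigr _ (fun j _ => E j)) big_ord_recr /= subnn mul1r big1 ?add0r// => j _.
by rewrite subn_eq0 leqNgt ltn_ord mul0r.
Qed.

Lemma mul_bin_trinomial k l n : (k + l <= n)%N ->
  ('C(n, k + l) * 'C(k + l, k) = 'C(n, k) * 'C(n - k, l))%N.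
Proof.
move=> kln; have kn : (k <= n)%N by exact: leq_trans (leq_addr _ _) kln.
have f0 : (0 < k`! * l`! * (n - k - l)`!)%N by rewrite !muln_gt0 !fact_gt0.
apply/eqP; rewrite -(eqn_pmul2r f0); apply/eqP.
transitivity n`!.
  rewrite -(bin_fact kln) -(bin_fact (leq_addr l k)) addKn subnDA.
  by rewrite -!mulnA; congr (_ * _)%N; rewrite !mulnA.
have ln : (l <= n - k)%N by rewrite leq_subRL.
by rewrite -(bin_fact kn) -(bin_fact ln); nia.
Qed.

(* The numerators in Gasper's expansion, brought by two applications of Saalschutz'
   formula to a form where only the term k = 0 is positive. *)
Definition gasper_num (a b c : R) n : R :=
  let h := (b + c - a) / 2 - 4^-1 in
  \sum_(k < n.+1) 'C(n, k)%:R * rising (h + (n - k)%:R) k * rising (- 2^-1) k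
     / rising h k * rising a k * rising (b - a) (n - k) * rising (c - a) (n - k).

(** Since n + 2h - 1 = h - (1 - h - n) and h + 1/2 = h - (-1/2), Saalschutz expands (n + 2h - 1)_j
    (h + 1/2)_j into a sum over k. Once the sums are exchanged, the sum over l = j - k is balanced
    because 2h = b + c - a - 1/2, and Saalschutz sums it; this dictates the choice of h. *)
Lemma whipple (a b c : R) n : 0 < b -> 0 < c -> 0 < b + c - a - 2^-1 ->
  let h := (b + c - a) / 2 - 4^-1 in
  \sum_(j < n.+1) (-1) ^+ j * 'C(n, j)%:R * rising (n%:R + 2 * h - 1) j
     * rising (h + 2^-1) j * rising a j / (rising h j * rising b j * rising c j) =
  gasper_num a b c n / (rising b n * rising c n).
Proof.
move=> b0 c0 hab h; rewrite /gasper_num -/h.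
have h0 : 0 < h by rewrite /h; lra.
have bN k : rising b k != 0 by rewrite rising_neq0.
have cN k : rising c k != 0 by rewrite rising_neq0.
have hN k : rising h k != 0 by rewrite rising_neq0.
pose F j k := (-1) ^+ j * 'C(n, j)%:R * 'C(j, k)%:R * rising (1 - h - n%:R) k
  * rising (- 2^-1) k * rising (n%:R + 2 * h - 2^-1) (j - k) / rising h k
  * rising a j / (rising b j * rising c j).
transitivity (\sum_(j < n.+1) \sum_(k < j.+1) F j k).
  apply: eq_bigr => j _.
  have := saalschutz (1 - h - n%:R) (- 2^-1) h j.
  rewrite (_ : h - (1 - h - n%:R) - - 2^-1 = n%:R + 2 * h - 2^-1); last by field.
  rewrite (_ : h - (1 - h - n%:R) = n%:R + 2 * h - 1); last by ring.
  rewrite opprK => S.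
  rewrite -(mulrA (_ * _) (rising (_ - 1) j)) -S mulr_sumr !mulr_suml.
  apply: eq_bigr => k _; rewrite /F.
  have kj : (k <= j)%N by rewrite -ltnS.
  rewrite (_ : rising h j = rising h k * rising (h + k%:R) (j - k)); last first.
    by rewrite -risingD subnKC.
  have : rising (h + k%:R) (j - k) != 0 by rewrite rising_neq0// ltr_wpDr.
  move: (hN k) (bN j) (cN j); move: (rising h k) (rising b j) (rising c j) (rising (h + _) _).
  by move=> r1 r2 r3 r4 *; field; apply/and4P; split.
rewrite (big_triangle_exchange F) mulr_suml; apply: eq_bigr => -[k /= kn1] _.
have kn : (k <= n)%N by rewrite -ltnS.
have [N [nkN knN]] : exists N, (n - k)%N = N /\ (k + N)%N = n.
  by exists (n - k)%N; rewrite subnKC.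
have nE : n%:R = k%:R + N%:R :> R by rewrite -natrD knN.
have e1 : n%:R + 2 * h - 2^-1 = n%:R + b + c - a - 1 by rewrite /h; field.
have S : \sum_(l < N.+1) (-1) ^+ l * 'C(N, l)%:R * rising (a + k%:R) l *
    rising (n%:R + 2 * h - 2^-1) l * rising (c + (k + l)%:R) (N - l) *
    rising (b + (k + l)%:R) (N - l) = rising (b - a) N * rising (c - a) N.
  have := saalschutz (a + k%:R) (n%:R + 2 * h - 2^-1) (b + k%:R) N.
  rewrite (_ : b + k%:R - (n%:R + 2 * h - 2^-1) = - (c - a) - N%:R + 1); last first.
    by rewrite e1 nE; ring.
  rewrite rising_opp mulrCA (_ : b + k%:R - (a + k%:R) = b - a); last by ring.
  move=> /(congr1 ( *%R ((-1) ^+ N))); rewrite signrMK mulr_sumr => <-.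
  apply: eq_bigr => l _; have lN : (l <= N)%N by rewrite -ltnS.
  rewrite (_ : b - a - _ = - (c + (k + l)%:R) - (N - l)%:R + 1); last first.
    by rewrite e1 nE natrB// !natrD; ring.
  have sN : (-1) ^+ N = (-1) ^+ (N - l) * (-1) ^+ l :> R by rewrite -exprD subnK.
  rewrite rising_opp sN -[in RHS](addrA b) -[in RHS]natrD.
  have := signrMK (N - l) (1 : R); rewrite mulr1 => sg.
  rewrite -[LHS]mul1r -{1}sg.
  by move: ((-1) ^+ (N - l)) ((-1) ^+ l) => s1 s2; ring.
rewrite nkN -[_ * rising (b - a) N * rising (c - a) N]mulrA -S mulr_sumr mulr_suml subSn// nkN.
apply: eq_bigr => -[l /= lN1] _; have lN : (l <= N)%N by rewrite -ltnS.
have kln : (k + l <= n)%N by rewrite -knN leq_add2l.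
rewrite /F addKn.
rewrite (_ : 1 - h - n%:R = - (h + N%:R) - k%:R + 1) ?rising_opp; last by rewrite nE; ring.
have := mul_bin_trinomial kln; rewrite nkN => /(congr1 (fun n => n%:R : R)).
rewrite !natrM => B.
have bE : rising b n = rising b (k + l) * rising (b + (k + l)%:R) (N - l).
  by rewrite -risingD addnBA// -addnA (addnC l) addnA addnK knN.
have cE : rising c n = rising c (k + l) * rising (c + (k + l)%:R) (N - l).
  by rewrite -risingD addnBA// -addnA (addnC l) addnA addnK knN.
have := signrMK k (1 : R); rewrite mulr1 => sg.
have := bN n; have := cN n; rewrite bE cE !mulf_eq0 !negb_or.
move=> /andP[c1 c2] /andP[b1 b2].
transitivity ((-1) ^+ l * ((-1) ^+ k * ((-1) ^+ k)) * ('C(n, k + l)%:R * 'C(k + l, k)%:R) * rising (h + N%:R) k * rising (- 2^-1) k *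
  rising (n%:R + 2 * h - 2^-1) l / rising h k * rising a (k + l) / (rising b (k + l) * rising c (k + l))).
  by rewrite exprD; congr (_ / _); ring.
rewrite sg B mulr1 risingD.
move: (hN k) b1 b2 c1 c2 ((-1) ^+ l).
move: (rising h k) (rising b (k + l)) (rising c (k + l)) (rising (b + _) _) (rising (c + _) _).
move: (rising (n%:R + _ - _) _) (rising (h + _) _) (rising (- _) _) (rising a k) (rising (a + _) _) => ? ? ? ? ? r1 r2 r3 r4 r5 *.
by field; rewrite ?andbT; do ?[apply/andP; split].
Qed.

Lemma rising_mul x y n : rising x n * rising y n = \prod_(i < n) ((x + i%:R) * (y + i%:R)).
Proof. by rewrite -big_split. Qed.

(* Each negative term [k >= 1] of [gasper_num] is largest in absolute value at
   the corner b = a + 1/2, c = 2 a, where the sum is a Vandermonde sum equal to 0. *)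
Lemma gasper_num_bounds (a b c : R) n : 0 < a -> a < b -> a < c ->
  a / 2 <= (b - a) * (c - a) -> 3 * a + 2^-1 <= b + c ->
  0 <= gasper_num a b c n <= rising b n * rising c n.
Proof.
move=> a0 ab ac hyp lin; rewrite /gasper_num; set h := (b + c - a) / 2 - 4^-1.
have ah : a <= h by rewrite /h; lra.
have h0 : 0 < h by exact: lt_le_trans ah.
clearbody h; have [h00 a00] := (ltW h0, ltW a0).
have p0 : 0 < b - a by rewrite subr_gt0.
have q0 : 0 < c - a by rewrite subr_gt0.
have neg k : rising (- 2^-1 : R) k.+1 <= 0.
  rewrite risingSl -oppr_ge0 -mulNr opprK mulr_ge0// rising_ge0//; lra.
pose X k := rising (h + (n - k)%:R) k / rising h k * rising a k *
  (rising (b - a) (n - k) * rising (c - a) (n - k)).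
rewrite (eq_bigr (fun k : 'I_n.+1 => 'C(n, k)%:R * rising (- 2^-1) k * X k)); last first.
  by move=> k _; rewrite /X; have := rising_neq0 k h0; move: (rising h k) => r *; field.
have X0 k : 0 <= X k.
  have hk : 0 <= h + (n - k)%:R by rewrite addr_ge0// ltW.
  by rewrite /X !mulr_ge0 ?invr_ge0 ?rising_ge0// ltW.
have XE : X 0 = rising (b - a) n * rising (c - a) n.
  by rewrite /X !rising0 subn0 invr1 !mul1r.
apply/andP; split; last first.
  rewrite big_ord_recl bin0 rising0 !mul1r XE -[leRHS]addr0; apply: lerD.
    by rewrite ler_pM ?rising_ge0 ?ler_rising// ?ltW//; lra.
  by apply: sumr_le0 => k _; rewrite lift0 mulr_le0_ge0// mulr_ge0_le0.
case: n @X X0 XE => [|n] X X0 XE; first by rewrite big_ord1 rising0 bin0 !mul1r.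
(* Y k retains the dependence on k that X k has at the corner. It equals X k at k = 0 and majorizes
   it for k >= 1, where the weights (-1/2)_k are nonpositive, so replacing X by Y can only lower the
   sum. *)
pose Y k := rising (b - a) n.+1 * rising (c - a) n.+1 / rising 2^-1 n.+1 * rising 2^-1 (n.+1 - k).
have half0 : 0 < 2^-1 :> R by rewrite invr_gt0.
have half00 := ltW half0.
have XY k : (k <= n.+1)%N -> X k <= Y k.
  move=> kn; set m := (n.+1 - k)%N; rewrite /X /Y -/m.
  have split z : rising z n.+1 = rising z m * rising (z + m%:R) k.
    by rewrite -risingD subnK.
  rewrite !split.
  (* Factor by factor, (a + m + i)(h + i) - (h + m + i)(a + i) = m (h - a), and a <= h by the linear
     condition. *)
  have A : rising (h + m%:R) k / rising h k * rising a k <= rising (a + m%:R) k.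
    rewrite mulrAC ler_pdivrMr ?rising_gt0// !rising_mul.
    apply: ler_prod => i _; rewrite mulr_ge0 ?addr_ge0//=.
    rewrite -subr_ge0 (_ : _ - _ = m%:R * (h - a)); last by ring.
    by rewrite mulr_ge0// subr_ge0.
  (* With u = m + i each factor reads (1/2 + u)(a + u) <= (b - a + u)(c - a + u). The constant terms
     compare by a/2 <= (b - a)(c - a), the coefficients of u by 3a + 1/2 <= b + c: exactly the two
     inequalities of [Pset]. *)
  have B : rising (2^-1 + m%:R) k * rising (a + m%:R) k <=
      rising (b - a + m%:R) k * rising (c - a + m%:R) k.
    rewrite !rising_mul; apply: ler_prod => i _.
    rewrite mulr_ge0 ?addr_ge0//= -!addrA -natrD.
    have mi0 : 0 <= (m + i)%:R :> R by []. 
    by move: ((m + i)%:R) mi0 => u u0; nra.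
  have r0 : 0 < rising (2^-1 + m%:R : R) k by rewrite rising_gt0// ltr_wpDr.
  have s0 : 0 < rising (2^-1 : R) m by rewrite rising_gt0.
  have t0 : 0 <= rising (b - a) m * rising (c - a) m by rewrite mulr_ge0 ?rising_ge0 ?ltW.
  rewrite [leRHS](_ : _ = (rising (b - a + m%:R) k * rising (c - a + m%:R) k / rising (2^-1 + m%:R) k)
    * (rising (b - a) m * rising (c - a) m)); last first.
    by field; rewrite !gt_eqF.
  by rewrite ler_wpM2r// (le_trans A)// ler_pdivlMr// mulrC.
apply: (@le_trans _ _ (\sum_(k < n.+2) 'C(n.+1, k)%:R * rising (- 2^-1) k * Y k)).
  rewrite (eq_bigr (fun k : 'I_n.+2 => rising (b - a) n.+1 * rising (c - a) n.+1 / rising 2^-1 n.+1 *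
     ('C(n.+1, k)%:R * rising (- 2^-1) k * rising 2^-1 (n.+1 - k)))); last first.
    by move=> k _; rewrite /Y; ring.
  by rewrite -mulr_sumr rising_vandermonde addNr (risingSl 0) mul0r mulr0.
apply: ler_sum => -[[|k] kn] _ /=.
  by rewrite XE /Y subn0 divfK// gt_eqF// rising_gt0.
by apply: ler_wnM2l; [rewrite mulr_ge0_le0|exact: XY].
Qed.

End finite_identities.

(** * Expansion of 1F2 in squares of Bessel functions *)

Section gasper.
Context {R : realType}.
Implicit Types (x y M : R) (n m : nat).

Lemma rising_duplication M k :
  rising (2 * M - 1) (2 * k) = 4 ^+ k * rising (M - 2^-1) k * rising M k.
Proof.
elim: k => [|k IH]; first by rewrite muln0 !rising0 expr0 !mulr1.
by rewrite mulnS !risingS IH exprS -natr1 natrM; field.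
Qed.

(** Vandermonde with both parameters equal to 1 - M - k, every factor then being reversed. *)
Lemma rising_square_coef M k :
  \sum_(i < k.+1) 'C(k, i)%:R * rising (M + (k - i)%:R) i * rising (M + i%:R) (k - i) =
  rising (2 * M + k%:R - 1) k.
Proof.
have := rising_vandermonde (1 - M - k%:R) (1 - M - k%:R) k.
rewrite (_ : 1 - M - k%:R + _ = - (2 * M + k%:R - 1) - k%:R + 1); last by ring.
rewrite rising_opp => /(congr1 ( *%R ((-1) ^+ k))); rewrite signrMK => <-.
rewrite mulr_sumr; apply: eq_bigr => i _; have ik : (i <= k)%N by rewrite -ltnS.
rewrite {1}(_ : 1 - M - k%:R = - (M + (k - i)%:R) - i%:R + 1); last by rewrite natrB//; ring.
rewrite {1}(_ : 1 - M - k%:R = - (M + i%:R) - (k - i)%:R + 1); last by rewrite natrB//; ring.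
rewrite !rising_opp.
have sk : (-1) ^+ k = (-1) ^+ (k - i) * (-1) ^+ i :> R by rewrite -exprD subnK.
have := signrMK (k - i) (1 : R); have := signrMK i (1 : R); rewrite !mulr1 sk.
move: ((-1) ^+ i) ((-1) ^+ (k - i)) => s t ss tt.
rewrite -[LHS]mul1r -tt -[LHS]mul1r -ss; ring.
Qed.

(* Coefficients of 0F1(; M; -z/4). *)
Definition bessel_coef M i : R := (- 4^-1) ^+ i / (i`!%:R * rising M i).

(** The square of 0F1(; M; -z/4) is again hypergeometric, namely 1F2(M - 1/2; M, 2M - 1; -z). *)
Lemma bessel_coef_square M k : 0 < M - 2^-1 ->
  \sum_(i < k.+1) bessel_coef M i * bessel_coef M (k - i) =
  (-1) ^+ k * rising (M - 2^-1) k / (k`!%:R * rising M k * rising (2 * M - 1) k).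
Proof.
move=> M0.
have M1 : 0 < M by rewrite -(subrK 2^-1 M) addr_gt0// invr_gt0.
have rM n : rising M n != 0 by rewrite rising_neq0.
have fn n : n`!%:R != 0 :> R by rewrite pnatr_eq0 -lt0n fact_gt0.
have r2 : rising (2 * M - 1) k != 0 by rewrite rising_neq0//; lra.
transitivity ((- 4^-1) ^+ k / (k`!%:R * rising M k ^+ 2) * rising (2 * M + k%:R - 1) k).
  rewrite -rising_square_coef mulr_sumr; apply: eq_bigr => i _.
  have ik : (i <= k)%N by rewrite -ltnS.
  have -> : (- 4^-1) ^+ k = (- 4^-1) ^+ i * (- 4^-1) ^+ (k - i) :> R by rewrite -exprD subnKC.
  have E1 : rising M k = rising M i * rising (M + i%:R) (k - i) by rewrite -risingD subnKC.
  have E2 : rising M k = rising M (k - i) * rising (M + (k - i)%:R) i by rewrite -risingD subnK.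
  have := bin_fact ik => /(congr1 (fun n => n%:R : R)); rewrite !natrM => B.
  rewrite /bessel_coef expr2 {1}E1 E2 -B.
  have := rM k; rewrite {1}E1 mulf_eq0 negb_or => /andP[u1 u2].
  have := rM k; rewrite E2 mulf_eq0 negb_or => /andP[u3 u4].
  have := fn k; rewrite -B mulf_eq0 negb_or => /andP[u5].
  rewrite mulf_eq0 negb_or => /andP[u6 u7].
  move: u1 u2 u3 u4 u5 u6 u7.
  move: (rising M i) (rising (M + i%:R) _) (rising M (k - i)) (rising (M + _) i) => r1 r2' r3 r4.
  move: ('C(k, i)%:R) (i`!%:R) ((k - i)`!%:R) => f1 f2 f3 u1 u2 u3 u4 u5 u6 u7.
  by field; rewrite u1 u2 u3 u4 u5 u6 u7.
have D := rising_duplication M k.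
rewrite mul2n -addnn risingD in D.
have e4 : (4 : R) ^+ k != 0 by rewrite expf_neq0.
have -> : rising (2 * M + k%:R - 1) k = 4 ^+ k * rising (M - 2^-1) k * rising M k / rising (2 * M - 1) k.
  by rewrite -D mulrAC mulfV// mul1r; congr rising; ring.
have -> : (- 4^-1) ^+ k = (-1) ^+ k / 4 ^+ k :> R.
  by rewrite -exprVn -exprMn mulN1r.
move: (rM k) (fn k) e4 r2; move: (rising M k) (_`!%:R) (4 ^+ k) (rising (2 * M - 1) k).
by move=> u v w t *; field; do ?[apply/andP; split].
Qed.

Definition gasper_coef (a b c : R) n : R :=
  let h := (b + c - a) / 2 - 4^-1 in
  rising (2 * h - 1) n * (2 * n%:R + (2 * h - 1)) * rising h n
    * (gasper_num a b c n / (rising b n * rising c n))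
    / (n`!%:R * rising (h + 2^-1) n * rising (2 * h - 1) (2 * n).+1).

(* Gasper's expansion of 1F2(a; b, c; -z) in squares of Bessel functions of
   order b/2 + c/2 - a/2 - 3/4 + n, coefficientwise. *)
Lemma gasper_expansion (a b c : R) m : 2^-1 < a -> a < b -> a < c ->
  3 * a + 2^-1 <= b + c ->
  let M := (b + c - a) / 2 + 4^-1 in
  \sum_(n < m.+1) gasper_coef a b c n *
     \sum_(i < (m - n).+1) bessel_coef (M + n%:R) i * bessel_coef (M + n%:R) (m - n - i) =
  (-1) ^+ m * rising a m / (rising b m * rising c m * m`!%:R).
Proof.
move=> a2 ab ac lin M.
have a0 : 0 < a by apply: lt_trans a2; rewrite invr_gt0.
have b0 := lt_trans a0 ab; have c0 := lt_trans a0 ac.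
pose h := (b + c - a) / 2 - 4^-1.
have ME : M = h + 2^-1 by rewrite /M /h; field.
have ah : a <= h by rewrite /h; lra.
have h2 : 2^-1 < h by exact: lt_le_trans ah.
have x0 : 0 < 2 * h - 1 by lra.
have h0 : 0 < h by lra.
have Mh : 0 < h + 2^-1 by lra.
have fn n : n`!%:R != 0 :> R by rewrite pnatr_eq0 -lt0n fact_gt0.
(* The extra quotient (h + 1/2)_j / (h)_j is there for two reasons: it makes the alternating sum of
   Bailey's inversion summable by [whipple], and multiplying back by (h)_m / (h + 1/2)_m turns the
   Bailey kernel with x = 2h - 1 into the coefficients of the squared 0F1 of parameter M + n. *)
pose f j := rising (h + 2^-1) j * rising a j / (rising h j * rising b j * rising c j * j`!%:R).
have := bailey_inversion f m x0.
move=> /(congr1 ( *%R ((-1) ^+ m * rising h m / rising (h + 2^-1) m))).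
rewrite [RHS](_ : _ = (-1) ^+ m * rising a m / (rising b m * rising c m * m`!%:R)); last first.
  rewrite /f; move: (rising_neq0 m h0) (rising_neq0 m b0) (rising_neq0 m c0) (fn m) (rising_neq0 m Mh).
  move: (rising h m) (rising b m) (rising c m) (_`!%:R) (rising (h + _) m) => r1 r2 r3 r4 r5 *.
  by field; do ?[apply/andP; split].
move=> <-; rewrite mulr_sumr; apply: eq_bigr => -[n /= nm1] _.
have nm : (n <= m)%N by rewrite -ltnS.
have Mn : 0 < M + n%:R - 2^-1 by rewrite ME addrAC addrK ltr_wpDr.
rewrite bessel_coef_square//.
have W := whipple n b0 c0 (_ : 0 < b + c - a - 2^-1).
have -> : \sum_(j < n.+1) (-1) ^+ (n - j) * rising (2 * h - 1) (n + j) / (n - j)`!%:R * f j =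
   (-1) ^+ n * rising (2 * h - 1) n / n`!%:R * (gasper_num a b c n / (rising b n * rising c n)).
  rewrite -W; last by lra.
  rewrite mulr_sumr; apply: eq_bigr => j _; have jn : (j <= n)%N by rewrite -ltnS.
  have := bin_fact jn => /(congr1 (fun n => n%:R : R)); rewrite !natrM => B.
  have := fn n; rewrite -B mulf_eq0 negb_or => /andP[u5].
  rewrite mulf_eq0 negb_or => /andP[u6 u7].
  have sn : (-1) ^+ n = (-1) ^+ (n - j) * (-1) ^+ j :> R by rewrite -exprD subnK.
  have := signrMK j (1 : R); rewrite mulr1 sn risingD -/h /f => sg.
  rewrite (_ : n%:R + 2 * h - 1 = 2 * h - 1 + n%:R); last by ring.
  move: (rising_neq0 j h0) (rising_neq0 j b0) (rising_neq0 j c0) u5 u6 u7 sg.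
  move: (rising h j) (rising b j) (rising c j) (j`!%:R) ('C(n, j)%:R) ((n - j)`!%:R) ((-1) ^+ j) ((-1) ^+ (n - j)).
  move=> r1 r2 r3 f1 f2 f3 s t u1 u2 u3 u4 u5 u6 sg.
  rewrite -[LHS]mul1r -sg.
  by field; do ?[apply/andP; split].
rewrite /gasper_coef -/h.
have := signrMK n (1 : R); rewrite mulr1 => sg.
have sm : (-1) ^+ m = (-1) ^+ (m - n) * (-1) ^+ n :> R by rewrite -exprD subnK.
have E1 : rising h m = rising h n * rising (M + n%:R - 2^-1) (m - n).
  by rewrite -{1}(subnKC nm) risingD; congr (_ * rising _ _); rewrite ME; ring.
have E2 : rising (h + 2^-1) m = rising (h + 2^-1) n * rising (M + n%:R) (m - n).
  by rewrite -{1}(subnKC nm) risingD ME.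
have E3 : rising (2 * h - 1) (m + n).+1 =
    rising (2 * h - 1) (2 * n).+1 * rising (2 * (M + n%:R) - 1) (m - n).
  have mn : ((2 * n).+1 + (m - n) = (m + n).+1)%N by clear -nm; lia.
  have n2 : (2 * n).+1%:R = 2 * n%:R + 1 :> R by rewrite -addn1 natrD natrM.
  by rewrite -mn risingD n2; congr (_ * rising _ _); rewrite ME; field.
have := rising_neq0 m Mh; have := rising_neq0 (m + n).+1 x0.
rewrite E1 E2 E3 sm !mulf_eq0 !negb_or => /andP[u1 u2] /andP[u3 u4].
move: (fn n) (fn (m - n)%N) => v1 v2.
rewrite -[LHS]mul1r -[X in X * _ = _]sg; move: v1 v2 u1 u2 u3 u4.
move: (gasper_num _ _ _ _ / _) (n`!%:R) ((m - n)`!%:R) (rising (2 * h - 1) (2 * n).+1).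
move: (rising (2 * _ - 1) (m - n)) (rising (h + _) n) (rising (M + _) _) ((-1) ^+ n) ((-1) ^+ (m - n)).
move=> ? ? ? ? ? ? ? ? ? *.
by field; do ?[apply/andP; split].
Qed.
End gasper.

(** * Positivity of the spectral series *)

Section double_series.
Context {R : realType}.
Implicit Types (u v : R^nat).

Lemma series_dominated u v : (forall n, `|u n| <= v n) -> cvgn (series v) ->
  cvgn (series u).
Proof.
move=> uv cv; apply: normed_cvg; apply: series_le_cvg cv => // n.
  by rewrite /= normr_ge0.
exact: le_trans (normr_ge0 _) (uv n).
Qed.

Lemma series_le_limn v n : (forall n, 0 <= v n) -> cvgn (series v) ->
  series v n <= limn (series v).
Proof.
move=> v0 cv; apply: nondecreasing_cvgn_le => //.
by apply: nondecreasing_series => i _ _; exact: v0.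
Qed.

Lemma limn_series_ge0 v : (forall n, 0 <= v n) -> cvgn (series v) ->
  0 <= limn (series v).
Proof. by move=> v0 /(series_le_limn 0 v0); rewrite /series /= big_geq. Qed.

Lemma series_tail_le u v l n : (forall n, `|u n| <= v n) -> cvgn (series v) ->
  series u @ \oo --> l -> `|l - series u n| <= limn (series v) - series v n.
Proof.
move=> uv cv ul.
have cl : `|series u m - series u n| @[m --> \oo] --> `|l - series u n|.
  by apply: cvg_norm; apply: cvgB => //; exact: cvg_cst.
have cr : series v m - series v n @[m --> \oo] --> limn (series v) - series v n.
  by apply: cvgB => //; exact: cvg_cst.
rewrite -(cvg_lim _ cl)// -(cvg_lim _ cr)//.
apply: ler_lim; [exact: cvgP cl|exact: cvgP cr|].
exists n => // m /= nm; rewrite !sub_series_geq//.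
apply: le_trans (ler_norm_sum _ _ _) _; exact: ler_sum.
Qed.

(** Rearrangement of a double series from rows to diagonals. The product bound replaces absolute
    summability, and only two simple series have to be known to converge. *)
Lemma diagonal_series (f : nat -> nat -> R) u v (r : R^nat) :
  (forall i j, `|f i j| <= u i * v j) -> (forall i, 0 <= u i) -> (forall i, 0 <= v i) ->
  cvgn (series u) -> cvgn (series v) ->
  (forall i, series (f i) @ \oo --> r i) ->
  cvgn (series r) /\
  series (fun m => \sum_(i < m.+1) f i (m - i)%N) @ \oo --> limn (series r).
Proof.
move=> fuv u0 v0 cu cv fr.
pose U : R := limn (series u); pose V : R := limn (series v).
have U0 : 0 <= U by exact: limn_series_ge0.
have V0 : 0 <= V by exact: limn_series_ge0.
have cuv i : cvgn (series (fun j => u i * v j)).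
  by rewrite (_ : series _ = (fun n => u i * series v n)); [exact: is_cvgMr|apply/funext => n; rewrite /series /= mulr_sumr].
have luv i : limn (series (fun j => u i * v j)) = u i * V.
  apply: cvg_lim => //.
  rewrite (_ : series _ = (fun n => u i * series v n)); last by apply/funext => n; rewrite /series /= mulr_sumr.
  exact: cvgMr.
have tail i n : `|r i - series (f i) n| <= u i * (V - series v n).
  rewrite (le_trans (series_tail_le n (fuv i) (cuv i) (fr i)))// luv mulrBr.
  by rewrite /series /= mulr_sumr.
have cr : cvgn (series r).
  apply: (@series_dominated _ (fun i => u i * V)).
    move=> i; have := tail i 0%N; rewrite /series /= !big_geq// !subr0//.
  rewrite (_ : series _ = (fun n => series u n * V)); first exact: is_cvgMl.
  by apply/funext => n; rewrite /series /= mulr_suml.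
split => //.
pose T n := \sum_(i < n) series (f i) (n - i)%N.
have -> : series (fun m => \sum_(i < m.+1) f i (m - i)%N) = T.
  apply/funext => n; rewrite seriesEord /T /= (big_triangle_exchange (fun m i => f i (m - i)%N)).
  by apply: eq_bigr => i _; rewrite seriesEord; apply: eq_bigr => l _; rewrite addKn.
(* The first n diagonals contain n - i terms of row i. Rows with i < n/2 miss only columns beyond
   n/2, which gives the first summand; the other rows are bounded in full by the tail of u, which
   gives the second. *)
pose B n := U * (V - series v n./2) + (U - series u n./2) * V.
have half : n./2 @[n --> \oo] --> \oo.
  by move=> A [k _ kA]; exists k.*2 => // n /= kn; apply: kA => /=; rewrite -(doubleK k) half_leq.
have B0 : B n @[n --> \oo] --> 0.
  rewrite -[X in _ --> X](_ : U * (V - V) + (U - U) * V = 0); last by rewrite !subrr mulr0 mul0r addr0.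
  apply: cvgD; [apply: cvgMr|apply: cvgMl]; apply: cvgB; try exact: cvg_cst.
    by apply: (cvg_comp _ _ half cv).
  by apply: (cvg_comp _ _ half cu).
have bound n : `|series r n - T n| <= B n.
  have hn : (n./2 <= n)%N by rewrite leq_half_double -addnn ltnW// ltnS leq_addr.
  rewrite seriesEord /T /= -sumrB (le_trans (ler_norm_sum _ _ _))//.
  apply: (@le_trans _ _ (\sum_(0 <= i < n) u i * (V - series v (n - i)%N))).
    by rewrite big_mkord; apply: ler_sum => i _; exact: tail.
  rewrite (big_cat_nat _ hn)//=; apply: lerD.
    apply: (@le_trans _ _ (\sum_(0 <= i < n./2) u i * (V - series v n./2))).
      rewrite !big_mkord; apply: ler_sum => i _.
      apply: ler_wpM2l => //; rewrite lerD2l lerN2.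
      apply: (nondecreasing_series (P := xpredT)) => [k _ _|]; first exact: v0.
      have := ltn_ord i; have := odd_double_half n; clear; lia.
    rewrite -mulr_suml ler_wpM2r// ?subr_ge0 ?series_le_limn//.
  apply: (@le_trans _ _ (\sum_(n./2 <= i < n) u i * V)).
    apply: ler_sum => i _; apply: ler_wpM2l => //.
    rewrite lerBlDr lerDl /series /=; exact: sumr_ge0.
  rewrite -mulr_suml ler_wpM2r// lerBrDl.
  have := series_le_limn n u0 cu; rewrite /series /= (big_cat_nat _ hn)//=.
have -> : T = (fun n => series r n - (series r n - T n)) by apply/funext => n; rewrite subKr.
rewrite -[X in _ --> X]subr0; apply: cvgB => //.
apply/cvgr0Pnorm_le => e e0; near=> n.
apply: (le_trans (bound n)).
near: n.
have /cvgr0Pnorm_le /(_ _ e0) := B0; apply: filterS => n; exact: le_trans (ler_norm _).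
Unshelve. all: by end_near.
Qed.

End double_series.

(** * The Gauss series at argument 1 *)

Section gauss_sum.
Context {R : realType}.
Implicit Types (A B c : R).

Lemma bounded_tail_series (u : R^nat) N M : (forall n, 0 <= u n) ->
  (forall n, (N <= n)%N -> \sum_(N <= k < n) u k <= M) -> cvgn (series u).
Proof.
move=> u0 uM.
have nd : nondecreasing_seq (series u).
  by apply: nondecreasing_series => i _ _; exact: u0.
apply: nondecreasing_is_cvgn => //.
exists (series u N + M) => _ [n _ <-].
have [nN|Nn] := leqP n N.
  rewrite (le_trans (nd _ _ nN))// lerDl.
  by have := uM _ (leqnn N); rewrite big_geq.
by rewrite -lerBlDl sub_series_geq ?uM// ltnW.
Qed.

Definition gauss_term A B c n : R :=
  rising A n * rising B n / (rising c n * n`!%:R).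

Lemma gauss_term_ge0 A B c n : 0 < A -> 0 < B -> 0 < c -> 0 <= gauss_term A B c n.
Proof.
by move=> A0 B0 c0; rewrite /gauss_term divr_ge0 ?mulr_ge0 ?rising_ge0 ?ltW.
Qed.

(** The sequence n t_n serves as a discrete primitive: its differences yield both the convergence of
    the series (Raabe's test) and the contiguous relation. *)
Lemma gauss_term_telescope A B c n : 0 < c ->
  n.+1%:R * gauss_term A B c n.+1 - n%:R * gauss_term A B c n =
  gauss_term A B c n * (A * B - n%:R * (c - A - B)) / (c + n%:R).
Proof.
move=> c0; rewrite /gauss_term !risingS factS natrM.
have f0 : n`!%:R != 0 :> R by rewrite pnatr_eq0 -lt0n fact_gt0.
have n0 : n.+1%:R != 0 :> R by rewrite pnatr_eq0.
have cn : c + n%:R != 0 by rewrite gt_eqF// ltr_wpDr.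
have := rising_neq0 n c0; move: (rising c n) (n`!%:R) (n.+1%:R) f0 n0 => r f m f0 m0 r0.
by field; rewrite cn r0 f0 m0.
Qed.

Lemma gauss_term_shift A B c n : 0 < c ->
  gauss_term A B (c + 1) n = gauss_term A B c n * (c / (c + n%:R)).
Proof.
move=> c0; have := risingSl c n; rewrite risingS /gauss_term => E.
have cn : c + n%:R != 0 by rewrite gt_eqF// ltr_wpDr.
have c1 : rising (c + 1) n != 0 by rewrite rising_neq0// addr_gt0.
have c2 : rising c n != 0 by rewrite rising_neq0.
have f0 : n`!%:R != 0 :> R by rewrite pnatr_eq0 -lt0n fact_gt0.
apply: (@mulfI _ (rising (c + 1) n * rising c n * (c + n%:R))).
  by rewrite !mulf_neq0.
transitivity (rising A n * rising B n * (rising c n * (c + n%:R)) / n`!%:R); first by field; rewrite c1 f0.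
by rewrite E; field; rewrite cn c2 f0.
Qed.

Lemma is_cvg_gauss_term A B c : 0 < A -> 0 < B -> A + B < c ->
  cvgn (series (gauss_term A B c)).
Proof.
move=> A0 B0 ABc; have c0 : 0 < c by apply: lt_trans ABc; rewrite addr_gt0.
set s := c - A - B; have s0 : 0 < s by rewrite /s; lra.
(* From N on, k s/2 exceeds A B + c s/2, so that k t_k drops by at least t_k s/2 at each step and
   telescoping bounds the tail. *)
pose N := (Num.trunc ((A * B + s / 2 * c) / (s / 2))).+1.
pose x n : R := n%:R * gauss_term A B c n.
have x0 n : 0 <= x n by rewrite mulr_ge0// gauss_term_ge0.
apply: (@bounded_tail_series _ N (x N / (s / 2))); first by move=> n; exact: gauss_term_ge0.
have step k : (N <= k)%N -> gauss_term A B c k * (s / 2) <= x k - x k.+1.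
  move=> Nk; rewrite -subr_le0 opprB (gauss_term_telescope A B k c0) -/s.
  have ck : 0 < c + k%:R by rewrite ltr_wpDr.
  rewrite [leLHS](_ : _ = gauss_term A B c k / (c + k%:R) * (A * B + s / 2 * c - k%:R * (s / 2))); last first.
    by field; rewrite gt_eqF.
  apply: mulr_ge0_le0; first by rewrite divr_ge0 ?gauss_term_ge0// ltW.
  rewrite subr_le0 -ler_pdivrMr ?divr_gt0// ltW//.
  rewrite (lt_le_trans (truncnS_gt _))// ler_nat//.
move=> n Nn; rewrite ler_pdivlMr ?divr_gt0// mulr_suml.
apply: (@le_trans _ _ (\sum_(N <= k < n) (x k - x k.+1))).
  by rewrite big_nat [leRHS]big_nat; apply: ler_sum => k /andP[Nk _]; exact: step.
have := telescope_sumr x Nn => /(congr1 -%R); rewrite -sumrN opprB.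
under eq_bigr => k _ do rewrite opprB.
by move=> ->; rewrite lerBlDr lerDl.
Qed.

Definition gauss_sum A B c : R := limn (series (gauss_term A B c)).

(** The difference of the two sides, truncated at n, is c n t_n up to sign; it remains to see that n
    t_n tends to 0. *)
Lemma gauss_sum_contiguous A B c : 0 < A -> 0 < B -> A + B < c ->
  (c - A) * (c - B) * gauss_sum A B (c + 1) = c * (c - A - B) * gauss_sum A B c.
Proof.
move=> A0 B0 ABc; have c0 : 0 < c by apply: lt_trans ABc; rewrite addr_gt0.
have cv := is_cvg_gauss_term A0 B0 ABc.
have cv1 : cvgn (series (gauss_term A B (c + 1))).
  by apply: is_cvg_gauss_term => //; rewrite (lt_trans ABc)// ltrDl.
pose x n : R := n%:R * gauss_term A B c n.
have xE n : x n = ((c - A) * (c - B) * series (gauss_term A B (c + 1)) n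
    - c * (c - A - B) * series (gauss_term A B c) n) / c.
  apply/esym/(@mulIf _ c); first by rewrite gt_eqF.
  rewrite divfK ?gt_eqF//; elim: n => [|n IH].
    by rewrite /series /= !big_geq// /x mul0r !mulr0 subrr mul0r.
  rewrite !seriesSr [in LHS](mulrDr ((c - A) * (c - B))) [in LHS](mulrDr (c * (c - A - B))).
  rewrite opprD addrACA IH gauss_term_shift//.
  have := gauss_term_telescope A B n c0; rewrite -/(x _) -/(x _) => /eqP.
  rewrite subr_eq => /eqP ->.
  by field; rewrite gt_eqF// ltr_wpDr.
set L := ((c - A) * (c - B) * gauss_sum A B (c + 1) - c * (c - A - B) * gauss_sum A B c) / c.
have xL : x n @[n --> \oo] --> L.
  rewrite (_ : (fun n => x n) = (fun n => ((c - A) * (c - B) * series (gauss_term A B (c + 1)) n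
    - c * (c - A - B) * series (gauss_term A B c) n) / c)); last by apply/funext.
  by apply: cvgMl; apply: cvgB; apply: cvgMr.
have x0 n : 0 <= x n by rewrite mulr_ge0// gauss_term_ge0.
suff L0 : L = 0.
  apply/eqP; rewrite -subr_eq0; apply/eqP.
  by move: L0 => /(congr1 ( *%R^~ c)); rewrite /L divfK ?gt_eqF// mul0r.
apply/eqP; rewrite eq_le; apply/andP; split; last first.
  by rewrite -(cvg_lim _ xL)//; apply: limr_ge; [exact: cvgP xL|exact: nearW].
(* A positive limit L of n t_n would give t_n > L/(2n) eventually, against the divergence of the
   harmonic series. As [harmonic k] is 1/(k+1), the comparison is with t at index k + 1. *)
rewrite leNgt; apply/negP => Lgt0; clearbody L.
have L2 : L / 2 < L by rewrite ltr_pdivrMr// ltr_pMr// ltrDl.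
have [N _ xN] : \forall n \near \oo, L / 2 < x n by exact: (cvgr_gt _ xL).
apply: (@dvg_harmonic R).
apply: (@bounded_tail_series _ N (2 / L * gauss_sum A B c)) => [n|n Nn].
  exact: harmonic_ge0.
apply: (@le_trans _ _ (2 / L * \sum_(N <= k < n) gauss_term A B c k.+1)).
  rewrite mulr_sumr big_nat [leRHS]big_nat; apply: ler_sum => k /andP[Nk _].
  have := xN k.+1 (leqW Nk); rewrite /x /harmonic /= => h.
  rewrite -[leLHS]mul1r ler_pdivrMr//.
  rewrite (_ : _ * _ * _ = k.+1%:R * gauss_term A B c k.+1 / (L / 2)); last first.
    by field; rewrite gt_eqF.
  by rewrite ler_pdivlMr ?divr_gt0// mul1r ltW.
apply: ler_wpM2l; first by rewrite divr_ge0 ?ltW.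
apply: le_trans (series_le_limn n.+1 _ cv) => [|m]; last exact: gauss_term_ge0.
rewrite -(big_add1 _ _ N n.+1 xpredT (gauss_term A B c)) -sub_series_geq//.
by rewrite lerBlDr lerDl /series /=; apply: sumr_ge0 => k _; exact: gauss_term_ge0.
Qed.

Lemma gauss_sum_gt0 A B c : 0 < A -> 0 < B -> A + B < c -> 0 < gauss_sum A B c.
Proof.
move=> A0 B0 ABc; have c0 : 0 < c by apply: lt_trans ABc; rewrite addr_gt0.
have := series_le_limn 1 (fun n => gauss_term_ge0 n A0 B0 c0) (is_cvg_gauss_term A0 B0 ABc).
apply: lt_le_trans; rewrite /series /= big_nat1 /gauss_term !rising0 fact0.
by rewrite mulr1 divr_gt0.
Qed.

(** What is needed of Gauss's theorem: ratios of values of 2F1(b - a, c - a; . ; 1) at third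
    parameters differing by an integer, obtained by iterating the contiguous relation. *)
Lemma gauss_sum_rising (a b c : R) k : 0 < a -> a < b -> a < c ->
  gauss_sum (b - a) (c - a) (b + c - a + k%:R) / rising (b + c - a) k =
  gauss_sum (b - a) (c - a) (b + c - a) * (rising a k / (rising b k * rising c k)).
Proof.
move=> a0 ab ac.
have [b0 c0] := (lt_trans a0 ab, lt_trans a0 ac).
have d0 : 0 < b + c - a by rewrite addrAC addr_gt0 ?subr_gt0.
elim: k => [|k IH]; first by rewrite !rising0 addr0 mulr1 !divr1 mulr1.
have k0 : 0 <= k%:R :> R by [].
have := @gauss_sum_contiguous (b - a) (c - a) (b + c - a + k%:R).
rewrite !subr_gt0 => /(_ ab ac) S.
rewrite -natr1 addrA !risingS.
transitivity (gauss_sum (b - a) (c - a) (b + c - a + k%:R) / rising (b + c - a) k *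
    ((a + k%:R) / ((b + k%:R) * (c + k%:R)))); last first.
  rewrite IH; move: (rising_neq0 k b0) (rising_neq0 k c0).
  have bk : b + k%:R != 0 by rewrite gt_eqF// ltr_wpDr.
  have ck : c + k%:R != 0 by rewrite gt_eqF// ltr_wpDr.
  by move=> *; field; do ?[apply/andP; split].
have E : (c + k%:R) * (b + k%:R) * gauss_sum (b - a) (c - a) (b + c - a + k%:R + 1) =
   (b + c - a + k%:R) * (a + k%:R) * gauss_sum (b - a) (c - a) (b + c - a + k%:R).
  have := S; rewrite (_ : b + c - a + k%:R - (b - a) = c + k%:R); last by ring.
  rewrite (_ : b + c - a + k%:R - (c - a) = b + k%:R); last by ring.
  rewrite (_ : c + k%:R - (c - a) = a + k%:R); last by ring.
  by apply; lra.
have k1 : b + k%:R != 0 by rewrite gt_eqF// ltr_wpDr.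
have k2 : c + k%:R != 0 by rewrite gt_eqF// ltr_wpDr.
have k3 : b + c - a + k%:R != 0 by rewrite gt_eqF// ltr_wpDr.
have r0 := rising_neq0 k d0.
apply: (@mulfI _ ((c + k%:R) * (b + k%:R))); first by rewrite mulf_neq0.
rewrite [LHS]mulrA E; move: (rising _ k) r0 (gauss_sum _ _ (_ + k%:R)) => r r0 g.
by field; rewrite r0 k1 k2 k3.
Qed.
End gauss_sum.

(** * Nonnegativity of 1F2 *)

Section gasper_positivity.
Context {R : realType}.
Implicit Types (a b c z M : R).

Lemma rising_ge1 x n : 1 <= x -> 1 <= rising x n :> R.
Proof.
move=> x1; elim: n => [|n IH]; first by rewrite rising0.
by rewrite risingS mulr_ege1// ler_wpDr.
Qed.

(** The lower bound is the sign sought; the upper bound makes Gasper's expansion absolutely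
    summable, with the exponential series as majorant. *)
Lemma gasper_coef_bounds a b c n : 2^-1 < a -> a < b -> a < c ->
  a / 2 <= (b - a) * (c - a) -> 3 * a + 2^-1 <= b + c ->
  0 <= gasper_coef a b c n <= n`!%:R^-1.
Proof.
move=> a2 ab ac hyp lin.
have a0 : 0 < a by apply: lt_trans a2; rewrite invr_gt0.
have b0 := lt_trans a0 ab; have c0 := lt_trans a0 ac.
have /andP[G0 G1] := gasper_num_bounds n a0 ab ac hyp lin.
rewrite /gasper_coef; set h := (b + c - a) / 2 - 4^-1.
have h2 : 2^-1 < h by rewrite /h; lra.
clearbody h; have x0 : 0 < 2 * h - 1 by lra.
have h0 : 0 < h by lra.
have h1 : 0 < h + 2^-1 by lra.
have xn : 0 < 2 * h - 1 + n%:R by rewrite ltr_wpDr.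
have E : rising (2 * h - 1) (2 * n).+1 =
    rising (2 * h - 1) n * rising (2 * h - 1 + n%:R) n * (2 * n%:R + (2 * h - 1)).
  by rewrite risingS mul2n -addnn risingD natrD; congr (_ * _); ring.
have x2 : 0 < 2 * n%:R + (2 * h - 1) by rewrite ltr_wpDl// mulr_ge0.
have r1 := rising_gt0 n x0; have r2 := rising_gt0 n xn.
have r3 := rising_gt0 n h0; have r4 := rising_gt0 n h1.
have r5 := rising_gt0 n b0; have r6 := rising_gt0 n c0.
have f0 : 0 < n`!%:R :> R by rewrite ltr0n fact_gt0.
rewrite E.
rewrite (_ : _ / _ = gasper_num a b c n / (rising b n * rising c n) *
   (rising h n / rising (h + 2^-1) n) / rising (2 * h - 1 + n%:R) n * n`!%:R^-1); last first.
  field; rewrite !gt_eqF//.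
apply/andP; split.
  by rewrite !(mulr_ge0, divr_ge0)// ?invr_ge0 ltW// mulr_gt0.
apply: ler_piMl; first by rewrite invr_ge0 ltW.
rewrite ler_pdivrMr// mul1r.
apply: (@le_trans _ _ 1).
  apply: mulr_ile1; rewrite ?divr_ge0 ?ler_pdivrMr ?mulr_gt0 ?mul1r//.
  - by rewrite ltW// mulr_gt0.
  - exact: ltW.
  - exact: ltW.
  - by apply: ler_rising; [exact: ltW|rewrite lerDl invr_ge0].
(* The base 2h - 1 + n may be below 1 when n = 0, but then the product is empty; for n >= 1 the base
   is at least 2h > 1. *)
case: n {G0 G1 E x2 r1 r2 r3 r4 r5 r6 f0} xn => [|n] xn; first by rewrite rising0.
by apply: rising_ge1; rewrite -natr1; have : 0 <= n%:R :> R by []; lra.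
Qed.

Lemma bessel_coef_square_le M k : 1 <= M ->
  `|\sum_(i < k.+1) bessel_coef M i * bessel_coef M (k - i)| <= k`!%:R^-1.
Proof.
move=> M1; have M2 : 0 < M - 2^-1 by lra.
have M0 : 0 < M by lra. have M3 : 1 <= 2 * M - 1 by lra.
have r1 : 1 <= rising (2 * M - 1) k. by exact: rising_ge1.
have r2 : 0 < rising M k by rewrite rising_gt0.
have r3 : 0 < rising (M - 2^-1) k by rewrite rising_gt0.
have f0 : 0 < k`!%:R :> R by rewrite ltr0n fact_gt0.
have r4 := lt_le_trans ltr01 r1.
rewrite bessel_coef_square// normrM normrM normrX normrN1 expr1n mul1r normfV !gtr0_norm ?mulr_gt0//.
rewrite -mulrA invfM mulrCA; apply: ler_piMr; first by rewrite invr_ge0 ltW.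
rewrite ler_pdivrMr ?mulr_gt0// mul1r -[leLHS]mulr1.
by apply: ler_pM; rewrite ?ler01 ?(ltW r3)//; apply: ler_rising; [exact: ltW|rewrite gerBl invr_ge0].
Qed.

Lemma bessel_coef_le M i : 1 <= M -> `|bessel_coef M i| <= i`!%:R^-1.
Proof.
move=> M1; have r1 : 1 <= rising M i. by exact: rising_ge1.
have r0 := lt_le_trans ltr01 r1.
have f0 : 0 < i`!%:R :> R by rewrite ltr0n fact_gt0.
rewrite /bessel_coef normrM normfV normrX normrN (gtr0_norm (mulr_gt0 f0 r0)) gtr0_norm ?invr_gt0//.
rewrite invfM mulrCA; apply: ler_piMr; first by rewrite invr_ge0 ltW.
rewrite ler_pdivrMr// mul1r (le_trans _ r1)// exprn_ile1//; lra.
Qed.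

(* The Cauchy product of exp(-z) with sum_j (A)_j (B)_j / j!, divided termwise by
   (c)_m; it converges although the second factor need not. *)
Definition spectral_term (A B c z : R) m : R :=
  (\sum_(i < m.+1) (- z) ^+ i / i`!%:R * (rising A (m - i) * rising B (m - i) / (m - i)`!%:R))
    / rising c m.

(** The diagonals of the double series are the spectral terms. In row i, the power z^i is multiplied
    by a Gauss sum with third parameter b + c - a + i divided by (b + c - a)_i, which
    [gauss_sum_rising] turns into a multiple of (a)_i / ((b)_i (c)_i). *)
Lemma spectral_series a b c z : 2^-1 < a -> a < b -> a < c ->
  3 * a + 2^-1 <= b + c -> 0 <= z ->
  series (spectral_term (b - a) (c - a) (b + c - a) z) @ \oo -->
  gauss_sum (b - a) (c - a) (b + c - a) *
    limn (series (fun m => (-1) ^+ m * rising a m / (rising b m * rising c m * m`!%:R) * z ^+ m)).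
Proof.
move=> a2 ab ac lin z0.
have a0 : 0 < a by apply: lt_trans a2; rewrite invr_gt0.
have b0 := lt_trans a0 ab; have c0 := lt_trans a0 ac.
set A := b - a; set B := c - a; set d := b + c - a.
have A0 : 0 < A by rewrite subr_gt0.
have B0 : 0 < B by rewrite subr_gt0.
have d1 : 1 <= d by rewrite /d; lra.
have d0 : 0 < d by lra.
have ABd : A + B < d by rewrite /A /B /d; lra.
have fn n : 0 < n`!%:R :> R by rewrite ltr0n fact_gt0.
pose f i j := (- z) ^+ i / i`!%:R * (rising A j * rising B j / j`!%:R) / rising d (i + j).
pose r i := (- z) ^+ i / i`!%:R * (gauss_sum A B (d + i%:R) / rising d i).
have fE i j : f i j = (- z) ^+ i / i`!%:R / rising d i * gauss_term A B (d + i%:R) j.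
  rewrite /f risingD /gauss_term.
  have r1 := rising_gt0 i d0.
  have r2 : 0 < rising (d + i%:R) j by rewrite rising_gt0// ltr_wpDr.
  by move: (fn i) (fn j) => f1 f2; field; rewrite !gt_eqF.
have := @diagonal_series _ f (exp_coeff z) (gauss_term A B d) r.
case.
- move=> i j; rewrite /f !normrM normrX normrN (ger0_norm z0) !normfV !gtr0_norm ?rising_gt0//.
  rewrite /exp_coeff /= -mulrA; apply: ler_wpM2l; first by rewrite divr_ge0 ?exprn_ge0.
  rewrite /gauss_term -mulrA; apply: ler_wpM2l; first by rewrite mulr_ge0 ?rising_ge0 ?ltW.
  rewrite -invfM lef_pV2 ?posrE ?mulr_gt0 ?rising_gt0// mulrC; apply: ler_wpM2l; first exact: ltW.
  rewrite addnC risingD -[leLHS]mulr1; apply: ler_wpM2l; first by rewrite rising_ge0 ?ltW.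
  by apply: rising_ge1; rewrite ler_wpDr.
- by move=> i; exact: exp_coeff_ge0.
- by move=> i; exact: gauss_term_ge0.
- exact: is_cvg_series_exp_coeff.
- exact: is_cvg_gauss_term.
- move=> i; rewrite (_ : series (f i) = (fun n => (- z) ^+ i / i`!%:R / rising d i * series (gauss_term A B (d + i%:R)) n)); last first.
    by apply/funext => n; rewrite /series /= mulr_sumr; apply: eq_bigr => j _; rewrite fE.
  rewrite (_ : r i = (- z) ^+ i / i`!%:R / rising d i * gauss_sum A B (d + i%:R)); last by rewrite /r; ring.
  by apply: cvgMr; apply: is_cvg_gauss_term => //; rewrite (lt_le_trans ABd)// lerDl.
move=> cr; rewrite (_ : (fun m => _) = spectral_term A B d z); last first.
  apply/funext => m; rewrite /spectral_term mulr_suml; apply: eq_bigr => i _.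
  by rewrite /f subnKC// -ltnS.
have G0 := gauss_sum_gt0 A0 B0 ABd.
have rE : series r = (fun n => gauss_sum A B d * series (fun m => (-1) ^+ m * rising a m / (rising b m * rising c m * m`!%:R) * z ^+ m) n).
  apply/funext => n; rewrite /series /= mulr_sumr; apply: eq_bigr => i _.
  rewrite /r gauss_sum_rising// -/A -/B -/d [(- z) ^+ i]exprNn.
  move: (rising_gt0 i b0) (rising_gt0 i c0) (fn i) => f1 f2 f3; field; rewrite !gt_eqF//.
rewrite rE => S.
suff <- : limn (fun n => gauss_sum A B d * series (fun m => (-1) ^+ m * rising a m / (rising b m * rising c m * m`!%:R) * z ^+ m) n) =
   gauss_sum A B d * limn (series (fun m => (-1) ^+ m * rising a m / (rising b m * rising c m * m`!%:R) * z ^+ m)) by [].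
apply/cvg_lim => //; apply: cvgMr.
suff : cvgn (fun n => (gauss_sum A B d)^-1 * series r n).
  rewrite rE (_ : (fun n => _) = series (fun m => (-1) ^+ m * rising a m / (rising b m * rising c m * m`!%:R) * z ^+ m))//.
  by apply/funext => n; rewrite mulKf// gt_eqF.
by apply: is_cvgMr.
Qed.

(* By [spectral_series] the sum is a positive multiple of 1F2(a; b, c; -z), whose
   nonnegativity is a theorem of Gasper. *)
Lemma spectral_series_ge0 a b c z : 2^-1 < a -> a < b -> a < c ->
  a / 2 <= (b - a) * (c - a) -> 3 * a + 2^-1 <= b + c -> 0 <= z ->
  0 <= limn (series (spectral_term (b - a) (c - a) (b + c - a) z)).
Proof.
move=> a2 ab ac hyp lin z0.
have -> := cvg_lim (@Rhausdorff R) (spectral_series a2 ab ac lin z0).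
have a0 : 0 < a by apply: lt_trans a2; rewrite invr_gt0.
have G0 : 0 < gauss_sum (b - a) (c - a) (b + c - a).
  apply: gauss_sum_gt0; rewrite ?subr_gt0//.
  rewrite -subr_gt0 (_ : _ - _ = a)//; last by ring.
rewrite (pmulr_rge0 _ G0).
pose M (n : nat) : R := (b + c - a) / 2 + 4^-1 + n%:R.
have M1 n : 1 <= M n by rewrite /M ler_wpDr//; lra.
pose J n := limn (series (fun i => bessel_coef (M n) i * z ^+ i)).
have Jdom n i : `|bessel_coef (M n) i * z ^+ i| <= exp_coeff z i.
  rewrite normrM normrX (ger0_norm z0) mulrC; apply: ler_wpM2l; first exact: exprn_ge0.
  exact: bessel_coef_le.
have cJ n : cvgn (series (fun i => bessel_coef (M n) i * z ^+ i)).
  apply: series_dominated (is_cvg_series_exp_coeff z); exact: Jdom.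
have e0 i : 0 <= exp_coeff z i by exact: exp_coeff_ge0.
have ce := is_cvg_series_exp_coeff z.
pose q n k := \sum_(i < k.+1) bessel_coef (M n) i * bessel_coef (M n) (k - i).
have JJ n : series (fun k => q n k * z ^+ k) @ \oo --> J n ^+ 2.
  have := @diagonal_series _ (fun i j => bessel_coef (M n) i * z ^+ i * (bessel_coef (M n) j * z ^+ j))
    (exp_coeff z) (exp_coeff z) (fun i => bessel_coef (M n) i * z ^+ i * J n).
  case=> // [i j|i|_].
  - by rewrite normrM; apply: ler_pM.
  - rewrite (_ : series _ = (fun m => bessel_coef (M n) i * z ^+ i * series (fun j => bessel_coef (M n) j * z ^+ j) m)).
      exact: cvgMr.
    by apply/funext => m; rewrite /series /= mulr_sumr.
  rewrite (_ : (fun m : nat => _) = (fun k => q n k * z ^+ k)); last first.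
    apply/funext => k; rewrite /q mulr_suml; apply: eq_bigr => i _.
    have ik : (i <= k)%N by rewrite -ltnS.
    have -> : z ^+ k = z ^+ i * z ^+ (k - i) by rewrite -exprD subnKC.
    by ring.
  suff -> : limn (series (fun i => bessel_coef (M n) i * z ^+ i * J n)) = J n ^+ 2 by [].
  apply/cvg_lim => //; rewrite expr2.
  rewrite (_ : series _ = (fun m => series (fun j => bessel_coef (M n) j * z ^+ j) m * J n)).
    exact: cvgMl.
  by apply/funext => m; rewrite /series /= mulr_suml.
pose K := gasper_coef a b c.
have Kb n : 0 <= K n <= n`!%:R^-1 := gasper_coef_bounds n a2 ab ac hyp lin.
have KE : K = gasper_coef a b c by [].
clearbody K.
(* Row n sums to K n z^n (J n)^2 >= 0, while the diagonals are the terms of the 1F2 by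
   [gasper_expansion]: the sign is read off the rows. *)
have := @diagonal_series _ (fun n k => K n * z ^+ n * (q n k * z ^+ k))
  (exp_coeff z) (exp_coeff z) (fun n => K n * z ^+ n * J n ^+ 2).
case=> // [n k|n|cr].
- have /andP[K0 K1] := Kb n.
  rewrite !normrM !normrX (ger0_norm z0) (ger0_norm K0).
  apply: ler_pM; rewrite ?mulr_ge0 ?exprn_ge0//.
    by rewrite mulrC; apply: ler_wpM2l; rewrite ?exprn_ge0.
  by rewrite mulrC; apply: ler_wpM2l; rewrite ?exprn_ge0//; exact: bessel_coef_square_le.
- rewrite (_ : series _ = (fun m => K n * z ^+ n * series (fun k => q n k * z ^+ k) m)).
    exact: cvgMr.
  by apply/funext => m; rewrite /series /= mulr_sumr.
rewrite (_ : (fun m : nat => _) = (fun m => (-1) ^+ m * rising a m / (rising b m * rising c m * m`!%:R) * z ^+ m)).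
  move=> /cvg_lim -> //; apply: limn_series_ge0 => // n.
  have /andP[K0 K1] := Kb n.
  by rewrite mulr_ge0 ?sqr_ge0// mulr_ge0 ?exprn_ge0.
apply/funext => m; rewrite -gasper_expansion// mulr_suml; apply: eq_bigr => n _.
have nm : (n <= m)%N by rewrite -ltnS.
have -> : z ^+ m = z ^+ n * z ^+ (m - n) by rewrite -exprD subnKC.
by rewrite /q KE /M; ring.
Qed.
End gasper_positivity.

(** * Fourier transforms of radial power profiles *)

Section integral_of_series.
Context d (T : measurableType d) (R : realType) (m : {measure set T -> \bar R}).

(** Dominated convergence; all partial sums are bounded by the sum of u times G. *)
Lemma Rintegral_series (g : nat -> T -> R) (G : T -> R) (u : R^nat) :
  (forall n, measurable_fun setT (g n)) -> m.-integrable setT (EFin \o G) ->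
  (forall n t, `|g n t| <= u n * G t) -> (forall n, 0 <= u n) -> (forall t, 0 <= G t) ->
  cvgn (series u) ->
  m.-integrable setT (EFin \o (fun t => limn (series (g ^~ t)))) /\
  series (fun n => \int[m]_t g n t) @ \oo --> \int[m]_t limn (series (g ^~ t)).
Proof.
move=> mg iG gG u0 G0 cu.
pose U : R := limn (series u).
have cg t : cvgn (series (g ^~ t)).
  apply: (@series_dominated _ _ (fun n => u n * G t)) => // .
  rewrite (_ : series _ = (fun n => series u n * G t)); first exact: is_cvgMl.
  by apply/funext => n; rewrite /series /= mulr_suml.
have mS n : measurable_fun setT (fun t => series (g ^~ t) n).
  rewrite (_ : (fun t => _) = (fun t => \sum_(i <- index_iota 0 n) g i t))//.
  exact: measurable_sum.
have UG t n : `|series (g ^~ t) n| <= U * G t.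
  rewrite (le_trans (ler_norm_sum _ _ _))//.
  apply: (@le_trans _ _ (series u n * G t)).
    by rewrite /series /= mulr_suml; apply: ler_sum.
  by apply: ler_wpM2r => //; exact: series_le_limn.
have := @dominated_convergence _ T R m setT measurableT
  (fun n t => (series (g ^~ t) n)%:E) (fun t => (limn (series (g ^~ t)))%:E) (fun t => (U * G t)%:E).
case.
- by move=> n; apply/measurable_EFinP.
- apply/measurable_EFinP; apply: (measurable_fun_cvg mS) => t _; exact: cg.
- by apply: aeW => t _; apply: cvg_EFin; [exact: nearW|exact: cg].
- by under eq_fun do rewrite EFinM; exact: integrableZl.
- by apply: aeW => t n _; rewrite abse_EFin lee_fin.
move=> ig _ cvi; split => //.
have ign n : m.-integrable setT (EFin \o g n).
  apply: (@le_integrable _ _ _ _ _ _ _ (fun t => (u n * G t)%:E)) => //.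
  - exact/measurable_EFinP.
  - by move=> t _; rewrite !abse_EFin lee_fin (ger0_norm (mulr_ge0 (u0 n) (G0 t))).
  - by under eq_fun do rewrite EFinM; exact: integrableZl.
have igs n : m.-integrable setT (EFin \o (fun t => series (g ^~ t) n)).
  apply: (@le_integrable _ _ _ _ _ _ _ (fun t => (U * G t)%:E)) => //.
  - exact/measurable_EFinP.
  - move=> t _; rewrite !abse_EFin lee_fin (le_trans (UG t n))// ler_norm//.
  - by under eq_fun do rewrite EFinM; exact: integrableZl.
have -> : series (fun n => \int[m]_t g n t) = (fun n => \int[m]_t series (g ^~ t) n).
  apply/funext; elim=> [|n IH].
    rewrite /series /= big_geq//; under eq_Rintegral do rewrite big_geq//.
    by rewrite Rintegral_cst// mul0r.
  rewrite seriesSr IH; under [RHS]eq_Rintegral do rewrite seriesSr.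
  by rewrite RintegralD.
by apply: fine_cvg; rewrite fineK// integrable_fin_num.
Qed.
End integral_of_series.

(** * Truncated powers *)

Section positive_power.
Context {R : realType}.
Implicit Types (s w x : R).

(* The maximum matters: [x `^ s] is 1, not 0, at negative [x]. *)
Definition ppow s w := (Num.max 0 w) `^ s.

Lemma ppow_ge0 s w : 0 <= ppow s w. Proof. exact: powR_ge0. Qed.

Lemma ppow_le0 s w : 0 < s -> w <= 0 -> ppow s w = 0.
Proof. by move=> s0 w0; rewrite /ppow max_l// powR0// gt_eqF. Qed.

Lemma ppowE s w : 0 <= w -> ppow s w = w `^ s.
Proof. by move=> w0; rewrite /ppow max_r. Qed.

Lemma ppow_le s w x : 0 <= s -> w <= x -> ppow s w <= ppow s x.
Proof.
move=> s0 wx; apply: ge0_ler_powR => //; rewrite ?nnegrE; try by rewrite le_max lexx.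
by rewrite ge_max !le_max lexx wx orbT.
Qed.

Lemma ppowD1 s w : 0 < s -> ppow (s + 1) w = ppow s w * Num.max 0 w.
Proof.
move=> s0; rewrite /ppow -[in LHS](@mulr_powRB1 _ _ (s + 1)) ?addrK 1?mulrC//.
- by rewrite le_max lexx.
- by rewrite addr_gt0.
Qed.

Lemma continuous_ppow s : 0 < s -> continuous (ppow s).
Proof.
move=> s0 w; have [w0|w0|->] := ltgtP w 0.
- have E : \forall x \near w, 0 = ppow s x.
    near=> x; rewrite ppow_le0// ltW//; near: x; exact: lt_nbhsl.
  apply: cvg_trans (near_eq_cvg E) _; rewrite ppow_le0 ?ltW//; exact: cvg_cst.
- have E : \forall x \near w, x `^ s = ppow s x.
    near=> x; rewrite ppowE// ltW//; near: x; exact: lt_nbhsr.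
  apply: cvg_trans (near_eq_cvg E) _; rewrite ppowE ?ltW//.
  have /derivable1_diffP/differentiable_continuous : derivable (fun x : R => x `^ s) (w : R) 1.
    by apply: derivable_powR; rewrite in_itv/= w0.
  exact.
- rewrite /continuous_at ppow_le0//; apply/cvgrPdist_lt => e e0.
  have /cvgrPdist_lt /(_ _ e0) := powR_cvg0 s0.
  move=> H; near=> x; have [x0|x0] := leP x 0.
    by rewrite ppow_le0// subrr normr0.
  rewrite ppowE ?(ltW x0)//; move: x0; near: x; exact: H.
Unshelve. all: by end_near. Qed.

Lemma is_derive_ppow s x : 0 < x -> is_derive x 1 (ppow s) (s * x `^ (s - 1)).
Proof.
move=> x0; apply: (@near_eq_is_derive _ _ _ (fun x : R => x `^ s)).
  near=> y; rewrite ppowE// ltW//; near: y; exact: lt_nbhsr.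
exact: is_derive1_powR.
Unshelve. all: by end_near. Qed.

End positive_power.

Section real_integrable.
Context d (T : measurableType d) (R : realType) (m : {measure set T -> \bar R}).
Implicit Types (f g : T -> R).

Lemma integrable_mull f k : m.-integrable setT (EFin \o f) ->
  m.-integrable setT (EFin \o (fun t => k * f t)).
Proof.
move=> fi; rewrite (_ : _ \o _ = (fun t => k%:E * (EFin \o f) t)%E)//.
exact: integrableZl.
Qed.

Lemma integrable_bounded_mul f g M : measurable_fun setT f ->
  (forall t, `|f t| <= M) -> m.-integrable setT (EFin \o g) ->
  m.-integrable setT (EFin \o (fun t => f t * g t)).
Proof.
move=> mf fM ig; apply: (@le_integrable _ _ _ _ _ _ _ (EFin \o (fun t => M * `|g t|))) => //.
- apply/measurable_EFinP; apply: measurable_funM => //.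
  by apply/measurable_EFinP; exact: measurable_int ig.
- move=> t _; rewrite !abse_EFin lee_fin !normrM normr_id.
  by apply: ler_wpM2r => //; rewrite (le_trans (fM t))// ler_norm.
- apply: integrable_mull; rewrite (_ : _ \o _ = (fun t => `|(EFin \o g) t|%E))//.
  exact: integrable_norm.
Qed.

Lemma integrable_dominated f g : measurable_fun setT f ->
  (forall t, `|f t| <= g t) -> m.-integrable setT (EFin \o g) ->
  m.-integrable setT (EFin \o f).
Proof.
move=> mf fg; apply: le_integrable => //; first exact/measurable_EFinP.
by move=> t _; rewrite !abse_EFin lee_fin (le_trans (fg t))// ler_norm.
Qed.

End real_integrable.

(** * Even moments of truncated powers *)

Section moments.
Context {R : realType}.
Local Notation leb := (@lebesgue_measure R).
Implicit Types (g : R -> R) (r w x nu : R).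

Lemma supported_integrable g r : continuous g -> (forall t, r < `|t| -> g t = 0) ->
  leb.-integrable setT (EFin \o g) /\
  \int[leb]_t g t = \int[leb]_(t in `[- r, r]) g t.
Proof.
move=> cg g0.
have gE : g = g \_ `[- r, r].
  apply/funext => t; rewrite patchE; case: ifPn => // /negP tr.
  rewrite g0// ltNge ler_norml; apply/negP => h; apply: tr.
  by rewrite inE /= in_itv.
have ig : leb.-integrable `[- r, r] (EFin \o g).
  apply: continuous_compact_integrable; first exact: segment_compact.
  exact: continuous_subspaceT.
split; last by rewrite {1}gE -Rintegral_mkcond.
rewrite gE -restrict_EFin; by rewrite -integrable_mkcond.
Qed.

Definition moment i nu w : R := \int[leb]_t (t ^+ i.*2 * ppow (nu - 1) (w - t ^+ 2)).

Lemma continuous_monomial_ppow i s w : 0 < s ->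
  continuous (fun t : R => t ^+ i * ppow s (w - t ^+ 2)).
Proof.
move=> s0 t; apply: cvgM; first exact: exprn_continuous.
apply: (@continuous_comp _ _ _ (fun t : R => w - t ^+ 2) (ppow s)); last exact: continuous_ppow.
by apply: cvgB; [exact: cvg_cst|exact: exprn_continuous].
Qed.

Lemma monomial_ppow_supp i s w r t : 0 < s -> w <= r ^+ 2 -> 0 <= r -> r < `|t| ->
  t ^+ i * ppow s (w - t ^+ 2) = 0.
Proof.
move=> s0 wr r0 rt; rewrite ppow_le0 ?mulr0// subr_le0 (le_trans wr)//.
by rewrite -(real_normK (num_real t)) ler_sqr ?nnegrE// ltW.
Qed.

Lemma monomial_ppow_integrable i s w : 0 < s ->
  leb.-integrable setT (EFin \o (fun t : R => t ^+ i * ppow s (w - t ^+ 2))).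
Proof.
move=> s0; apply: (supported_integrable (r := Num.sqrt (Num.max 0 w)) _ _).1.
  exact: continuous_monomial_ppow.
move=> t; apply: monomial_ppow_supp; rewrite ?sqrtr_ge0 ?sqr_sqrtr ?le_max ?lexx ?orbT//.
Qed.

(** t^(2i+1) (w - t^2)^nu vanishes at both ends of [- sqrt w, sqrt w], so its derivative integrates
    to 0. Combined with the splitting off of one factor w - t^2, this determines every moment from
    the moment of order 0. *)
Lemma moment_by_parts i nu w : 1 < nu ->
  (i.*2.+1)%:R * moment i (nu + 1) w = 2 * nu * moment i.+1 nu w.
Proof.
move=> nu1; have nu0 : 0 < nu by exact: lt_trans nu1.
have nu2 : 0 < nu - 1 by rewrite subr_gt0.
rewrite /moment addrK doubleS.
have [w0|w0] := leP w 0.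
  have z s (j : nat) : 0 < s -> \int[leb]_t (t ^+ j * ppow s (w - t ^+ 2)) = 0.
    move=> s0; rewrite (@eq_Rintegral _ _ _ _ _ (fun=> 0)) ?Rintegral_cst ?mul0r// => t _.
    by rewrite ppow_le0 ?mulr0// subr_le0 (le_trans w0)// sqr_ge0.
  by rewrite !z// !mulr0.
set r := Num.sqrt w; have r0 : 0 < r by rewrite sqrtr_gt0.
have rr : - r < r by rewrite gtrN.
have r2 : r ^+ 2 = w by rewrite sqr_sqrtr// ltW.
pose F (t : R) := t ^+ i.*2.+1 * ppow nu (w - t ^+ 2).
pose f (t : R) := i.*2.+1%:R * (t ^+ i.*2 * ppow nu (w - t ^+ 2)) -
  2 * nu * (t ^+ i.*2.+2 * ppow (nu - 1) (w - t ^+ 2)).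
have cF : continuous F by exact: continuous_monomial_ppow.
have cf : continuous f.
  by move=> t; apply: cvgB; apply: cvgMr; exact: continuous_monomial_ppow.
have dF t : t \in `]- r, r[ -> is_derive t 1 F (f t).
  rewrite in_itv /= => /andP[t1 t2].
  have wt : 0 < w - t ^+ 2.
    by rewrite subr_gt0 -r2 -(real_normK (num_real t)) ltr_sqr ?nnegrE ?(ltW r0)// ltr_norml t1 t2.
  have d1 : is_derive t 1 (cst w - (id : R -> R) ^+ 2) (0 - (2 * t ^+ 1) *: 1) by exact: is_deriveB.
  have d2 := @is_derive1_comp _ (ppow nu) (cst w - (id : R -> R) ^+ 2) t _ _ (is_derive_ppow nu wt) d1.
  have d3 : is_derive t 1 ((id : R -> R) ^+ i.*2.+1) ((i.*2.+1%:R * t ^+ i.*2) *: 1) by exact: is_deriveX.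
  have -> : F = (id : R -> R) ^+ i.*2.+1 * (ppow nu \o (cst w - (id : R -> R) ^+ 2)).
    by apply/funext => y; rewrite /F mulrfctE exprfctE.
  apply: is_derive_eq (is_deriveM d3 d2) _.
  change ((ppow nu \o _) t) with (ppow nu (w - t ^+ 2)).
  rewrite exprfctE /f (ppowE (nu - 1)) ?(ltW wt)// /GRing.scale /= !exprS expr0.
  by move: (t ^+ i.*2) => ti; ring.
have E : \int[leb]_(t in `[- r, r]) f t = 0.
  rewrite /Rintegral (@continuous_FTC2 _ f F)//.
  - rewrite /F r2 sqrrN r2 subrr ppow_le0// !mulr0 subee//.
  - exact: continuous_subspaceT.
  - split => [t /dF[]//||].
      by apply: cvg_at_right_filter; exact: cF.
    by apply: cvg_at_left_filter; exact: cF.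
  - by move=> t /dF d; rewrite derive1E; apply: derive_val.
have f0 t : r < `|t| -> f t = 0.
  move=> rt; have wr : w <= r ^+ 2 by rewrite r2.
  by rewrite /f !(monomial_ppow_supp _ _ wr (ltW r0) rt)// !mulr0 subrr.
rewrite -(supported_integrable cf f0).2 in E.
apply/eqP; rewrite -subr_eq0; apply/eqP; rewrite -[RHS]E.
rewrite -!RintegralZl ?RintegralB//; try exact: monomial_ppow_integrable.
  by apply: integrable_mull; exact: monomial_ppow_integrable.
by apply: integrable_mull; exact: monomial_ppow_integrable.
Qed.

Lemma moment_split i nu w : 1 < nu ->
  moment i (nu + 1) w = w * moment i nu w - moment i.+1 nu w.
Proof.
move=> nu1; have nu0 : 0 < nu - 1 by rewrite subr_gt0.
have I := monomial_ppow_integrable _ w nu0.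
rewrite /moment -RintegralZl// -RintegralB//; last first.
  exact: integrable_mull.
apply: eq_Rintegral => t _; rewrite addrAC ppowD1//.
have [wt|wt] := leP (w - t ^+ 2) 0.
  by rewrite ppow_le0// !(mul0r, mulr0) subrr.
by rewrite doubleS !exprS; ring.
Qed.

Lemma momentS i nu w : 1 < nu ->
  moment i.+1 nu w = w * (2^-1 + i%:R) / (nu + 2^-1 + i%:R) * moment i nu w.
Proof.
move=> nu1; have := moment_by_parts i w nu1; rewrite moment_split// => E.
have i0 : 0 <= i%:R :> R by [].
have d0 : nu + 2^-1 + i%:R != 0 by rewrite gt_eqF//; lra.
apply: (@mulfI _ (nu + 2^-1 + i%:R)) => //.
have E2 : i.*2.+1%:R = 2 * i%:R + 1 :> R by rewrite -natr1 -muln2 natrM mulrC.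
rewrite E2 in E.
transitivity ((2^-1 + i%:R) * w * moment i nu w); last first.
  by move: d0; move: (nu + 2^-1 + i%:R) => D D0; field.
by move: E; move: (moment i nu w) (moment i.+1 nu w) => x y; lra.
Qed.

Lemma momentE i nu w : 1 < nu ->
  moment i nu w = w ^+ i * rising 2^-1 i / rising (nu + 2^-1) i * moment 0 nu w.
Proof.
move=> nu1; have nu0 : 0 < nu + 2^-1 by lra.
elim: i => [|i IH]; first by rewrite !rising0 expr0 !mul1r invr1 mul1r.
rewrite momentS// IH !risingS exprS.
have i0 : 0 <= i%:R :> R by [].
have d0 : nu + 2^-1 + i%:R != 0 by rewrite gt_eqF//; lra.
have := rising_neq0 i nu0; move: d0; move: (nu + 2^-1 + i%:R) (rising (_ + _) i) => D r D0 r0.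
by field; rewrite ?r0 ?D0.
Qed.

Lemma moment0_shift n nu w : 1 < nu ->
  moment 0 (nu + n%:R) w = w ^+ n * rising nu n / rising (nu + 2^-1) n * moment 0 nu w.
Proof.
move=> nu1; have nu0 : 0 < nu + 2^-1 by lra.
elim: n => [|n IH]; first by rewrite !rising0 addr0 expr0 !mul1r invr1 mul1r.
have n0 : 0 <= n%:R :> R by [].
have nn1 : 1 < nu + n%:R by lra.
have d0 : nu + 2^-1 + n%:R != 0 by rewrite gt_eqF//; lra.
rewrite -natr1 addrA moment_split// (momentS 0)// addr0 IH !risingS exprS.
rewrite (addrAC nu n%:R 2^-1).
have := rising_neq0 n nu0; move: (rising (nu + 2^-1) n) => r r0.
have -> : nu + n%:R = nu + 2^-1 + n%:R - 2^-1 by ring.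
move: d0; move: (nu + 2^-1 + n%:R) => D D0.
by field; rewrite ?r0 ?D0.
Qed.

(** The Beta value B(1/2, nu), left unevaluated: besides its appearance as a constant, only its
    positivity matters. *)
Definition beta_mass nu := moment 0 nu 1.

End moments.

Section beta_mass.
Context {R : realType}.
Local Notation leb := (@lebesgue_measure R).
Implicit Types (g : R -> R) (r w x nu : R).

(** Scaling by t = sqrt w * s: the Jacobian contributes the exponent 1/2 by which each integration
    raises that of the profile. *)
Lemma moment0E nu w : 1 < nu -> moment 0 nu w = beta_mass nu * ppow (nu - 2^-1) w.
Proof.
move=> nu1; have nu0 : 0 < nu - 1 by rewrite subr_gt0.
have nu2 : 0 < nu - 2^-1 by lra.
have [w0|w0] := leP w 0.
  rewrite (ppow_le0 nu2 w0) mulr0 /moment (@eq_Rintegral _ _ _ _ _ (fun=> 0)) ?Rintegral_cst ?mul0r// => t _.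
  by rewrite ppow_le0 ?mulr0// subr_le0 (le_trans w0)// sqr_ge0.
set r := Num.sqrt w; have r0 : 0 < r by rewrite sqrtr_gt0.
have r2 : r ^+ 2 = w by rewrite sqr_sqrtr// ltW.
rewrite /beta_mass /moment.
pose G x (t : R) : R := t ^+ 0.*2 * ppow (nu - 1) (x - t ^+ 2).
have cG x : continuous (G x) by exact: continuous_monomial_ppow.
have G0 x s t : x <= s ^+ 2 -> 0 <= s -> s < `|t| -> G x t = 0.
  by move=> xs s0 st; exact: monomial_ppow_supp st.
have wr : w <= r ^+ 2 by rewrite r2.
rewrite (supported_integrable (cG w) (fun t => G0 w r t wr (ltW r0))).2.
have o1 : (1 : R) <= 1 ^+ 2 by rewrite expr1n.
rewrite (supported_integrable (cG 1) (fun t => G0 1 1 t o1 ler01)).2.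
pose F (s : R) := r * s.
have dF (s : R) : is_derive s 1 F r.
  by apply: is_derive_eq; rewrite [LHS]/GRing.scale /= mulr1.
have F'E : F^`()%classic = cst r by apply/funext => s; rewrite derive1E; apply: derive_val.
have FN1 : F (-1) = - r by rewrite /F mulrN1.
have F1 : F 1 = r by rewrite /F mulr1.
have cF : continuous F.
  by move=> s; apply/differentiable_continuous/derivable1_diffP; have [] := dF s.
rewrite /Rintegral -[in LHS]FN1 -[in LHS]F1 integration_by_substitution_increasing//.
- rewrite -[RHS]/(Rintegral _ _ _ * _) -RintegralZr//; last first.
    apply: continuous_compact_integrable; first exact: segment_compact.
    by apply: continuous_subspaceT => t; exact: cG.
  apply: eq_Rintegral => s _; rewrite F'E /G /F mulrfctE /= !mul1r.
  have -> : w - (r * s) ^+ 2 = w * (1 - s ^+ 2) by rewrite exprMn r2; ring.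
  have w00 := ltW w0.
  rewrite (ppowE (nu - 2^-1))// /ppow -{1}(mulr0 w) -maxr_pMr//.
  rewrite powRM//; last by rewrite le_max lexx.
  rewrite /r -powR12_sqrt//.
  have -> : nu - 2^-1 = 2^-1 + (nu - 1) by field.
  rewrite (@powRD _ w 2^-1); last by rewrite (gt_eqF w0) implybT.
  by ring.
- by move=> s t _ _ st; rewrite /F ltr_pM2l.
- by rewrite F'E => s _; exact: cvg_cst.
- by rewrite F'E; exact: is_cvg_cst.
- by rewrite F'E; exact: is_cvg_cst.
- split => [s _||].
  + by have [] := dF s.
  + by apply: cvg_at_right_filter; exact: cF.
  + by apply: cvg_at_left_filter; exact: cF.
- exact: continuous_subspaceT.
Qed.

Lemma beta_mass_gt0 nu : 1 < nu -> 0 < beta_mass nu :> R.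
Proof.
move=> nu1; have nu0 : 0 < nu - 1 by rewrite subr_gt0.
have I := monomial_ppow_integrable 0.*2 1 nu0.
pose k : R := ppow (nu - 1) (1 - 2^-1 ^+ 2).
have k0 : 0 < k by rewrite /k ppowE; [apply: powR_gt0|]; lra.
apply: (@lt_le_trans _ _ (\int[leb]_(t in `[0, 2^-1]) k)).
  have L : leb `[0%R, 2^-1%R]%classic = (2^-1)%:E.
    by rewrite lebesgue_measure_itv /= lte_fin invr_gt0 ltr0n /= oppr0 adde0.
  rewrite Rintegral_cst//= [X in fine X](_ : _ = (2^-1)%:E)//=.
  by rewrite mulr_gt0// invr_gt0.
rewrite /beta_mass /moment Rintegral_mkcond; apply: le_Rintegral => //.
  rewrite -restrict_EFin -integrable_mkcond//; apply: continuous_compact_integrable.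
    exact: segment_compact.
  by apply: continuous_subspaceT => t; exact: cvg_cst.
move=> t _; rewrite expr0 mul1r patchE; case: ifPn => [|_]; last exact: ppow_ge0.
rewrite inE /= in_itv /= => /andP[t0 t1]; apply: ppow_le; first exact: ltW.
by rewrite lerD2l lerN2 ler_sqr ?nnegrE// invr_ge0.
Qed.

End beta_mass.

(** * Fourier transform of a profile in one variable *)

Section profile.
Context {R : realType}.
Local Notation leb := (@lebesgue_measure R).
Implicit Types (e : R^nat) (w x y V mu nu : R).

Definition profile_series mu e w m : R := e m * w ^+ m / rising mu m.

(* w_+^(mu-1) sum_m e_m w_+^m / (mu)_m: the normalization by (mu)_m makes the
   Fourier transform of t |-> profile mu e (w - t^2) in one variable a profile of
   exponent mu + 1/2, with e replaced by its Cauchy product with an exponential. *)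
Definition profile mu e w : R :=
  ppow (mu - 1) w * limn (series (profile_series mu e (Num.max 0 w))).

Definition profile_summable mu e V :=
  cvgn (series (fun m => `|e m| * V ^+ m / rising mu m)).

Definition expconv y e m : R :=
  \sum_(n < m.+1) e n * ((- y) ^+ (m - n) / (m - n)`!%:R).

Lemma ler_rising2 mu nu n m : 1 <= mu -> mu <= nu -> (n <= m)%N ->
  rising mu n <= rising nu m.
Proof.
move=> mu1 munu nm; have mu0 : 0 <= mu by rewrite (le_trans ler01).
rewrite -(subnKC nm) risingD -[leLHS]mulr1.
apply: ler_pM; rewrite ?ler01 ?rising_ge0// ?ler_rising//.
by apply: rising_ge1; rewrite ler_wpDr// (le_trans mu1).
Qed.

Lemma continuous_ppow_sqr s w : 0 < s -> continuous (fun t : R => ppow s (w - t ^+ 2)).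
Proof.
move=> s0 t; apply: (@continuous_comp _ _ _ (fun t : R => w - t ^+ 2) (ppow s)); last exact: continuous_ppow.
by apply: cvgB; [exact: cvg_cst|exact: exprn_continuous].
Qed.

Lemma ppow_sqr_integrable s w : 0 < s ->
  leb.-integrable setT (EFin \o (fun t : R => ppow s (w - t ^+ 2))).
Proof.
move=> s0; rewrite (_ : (fun t => _) = (fun t => t ^+ 0 * ppow s (w - t ^+ 2))).
  exact: monomial_ppow_integrable.
by apply/funext => t; rewrite mul1r.
Qed.

Lemma profile_series_le mu e V w m : 0 < mu -> 0 <= w <= V ->
  `|profile_series mu e w m| <= `|e m| * V ^+ m / rising mu m.
Proof.
move=> mu0 /andP[w0 wV].
rewrite /profile_series !normrM normfV (gtr0_norm (rising_gt0 _ mu0)) normrX (ger0_norm w0).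
rewrite ler_wpM2r ?invr_ge0 ?rising_ge0 ?(ltW mu0)// ler_wpM2l//.
by rewrite lerXn2r// nnegrE ?(le_trans w0).
Qed.

Lemma profile_series_cvg mu e V w : 0 < mu -> 0 <= w <= V -> profile_summable mu e V ->
  cvgn (series (profile_series mu e w)).
Proof.
move=> mu0 wV; apply: series_dominated => m; exact: profile_series_le.
Qed.

(** As mu >= 1, (mu + 1/2)_m is at least (mu)_n for n <= m, so the new series is dominated by the
    Cauchy product of the old one with the series of exp(y V). *)
Lemma expconv_summable mu e V y : 1 <= mu -> 0 <= V -> 0 <= y ->
  profile_summable mu e V -> profile_summable (mu + 2^-1) (expconv y e) V.
Proof.
move=> mu1 V0 y0 se; have mu0 : 0 < mu by exact: lt_le_trans mu1.
have mu2 : 0 < mu + 2^-1 by rewrite addr_gt0// invr_gt0.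
have yV0 : 0 <= y * V by exact: mulr_ge0.
have t0 n : 0 <= `|e n| * V ^+ n / rising mu n.
  by rewrite divr_ge0 ?mulr_ge0 ?exprn_ge0 ?rising_ge0 ?(ltW mu0).
have := @diagonal_series _ (fun n i => `|e n| * V ^+ n / rising mu n * exp_coeff (y * V) i)
  _ _ (fun n => `|e n| * V ^+ n / rising mu n * limn (series (exp_coeff (y * V))))
  _ t0 (fun i => exp_coeff_ge0 i yV0) se (is_cvg_series_exp_coeff _).
case.
- by move=> n i; rewrite ger0_norm// mulr_ge0// exp_coeff_ge0.
- move=> n; rewrite (_ : series _ = (fun N => `|e n| * V ^+ n / rising mu n * series (exp_coeff (y * V)) N)).
    by apply: cvgMr; exact: is_cvg_series_exp_coeff.
  by apply/funext => N; rewrite /series /= mulr_sumr.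
move=> _ /cvgP; apply: series_dominated => m.
rewrite ger0_norm; last first.
  by rewrite divr_ge0 ?mulr_ge0 ?exprn_ge0 ?rising_ge0 ?(ltW mu2).
rewrite /expconv -mulrA (le_trans (ler_wpM2r _ (ler_norm_sum _ _ _)))//.
  by rewrite divr_ge0 ?exprn_ge0 ?rising_ge0 ?(ltW mu2).
rewrite mulr_suml; apply: ler_sum => n _; have nm : (n <= m)%N by rewrite -ltnS.
have -> : exp_coeff (y * V) (m - n)%N = y ^+ (m - n) * V ^+ (m - n) / (m - n)`!%:R.
  by rewrite -exprMn.
rewrite !normrM normfV normrX normrN (ger0_norm y0) normr_nat.
have -> : V ^+ m = V ^+ n * V ^+ (m - n) by rewrite -exprD subnKC.
rewrite [leLHS](_ : _ = `|e n| * V ^+ n * (y ^+ (m - n) * V ^+ (m - n) / (m - n)`!%:R) / rising (mu + 2^-1) m); last by ring.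
rewrite [leRHS]mulrAC; apply: ler_wpM2l.
  by rewrite !mulr_ge0 ?exprn_ge0 ?invr_ge0.
by rewrite lef_pV2 ?posrE ?rising_gt0// ler_rising2// lerDl invr_ge0.
Qed.

Lemma fact_double i : (i.*2)`!%:R = 4 ^+ i * i`!%:R * rising 2^-1 i :> R.
Proof.
elim: i => [|i IH]; first by rewrite rising0 !fact0 expr0 !mulr1.
rewrite doubleS !factS !natrM IH exprS risingS -!natr1 -muln2 natrM.
by field.
Qed.

Lemma fact_double_ge i : (i`! <= i.*2`!)%N.
Proof.
elim: i => [//|i IH]; rewrite doubleS !factS mulnA; apply: leq_mul => //.
by rewrite -[leqLHS]mul1n leq_mul// ltnS (leq_trans (leq_addr i _))// addnn.
Qed.

(** The cosine series is integrated termwise. In the moment of order 2i the factor (1/2)_i cancels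
    against (2i)! = 4^i i! (1/2)_i, which leaves 0F1(; nu + 1/2; - pi^2 x^2 w), a Bessel
    function. *)
Lemma cos_ppow_series nu w x : 1 < nu ->
  series (fun i => moment 0 nu w * ((- (pi ^+ 2 * x ^+ 2) * w) ^+ i / (i`!%:R * rising (nu + 2^-1) i)))
    @ \oo --> \int[leb]_t (cos (2 * pi * x * t) * ppow (nu - 1) (w - t ^+ 2)).
Proof.
move=> nu1; have nu0 : 0 < nu - 1 by rewrite subr_gt0.
have nu2 : 0 < nu + 2^-1 by rewrite addr_gt0 ?invr_gt0// (lt_trans _ nu1).
pose g i (t : R) := cos_coeff' (2 * pi * x * t) i * ppow (nu - 1) (w - t ^+ 2).
pose k : R := (2 * pi * x) ^+ 2 * Num.max 0 w.
have k0 : 0 <= k by rewrite mulr_ge0 ?sqr_ge0// le_max lexx.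
have fn n : 0 < n`!%:R :> R by rewrite ltr0n fact_gt0.
have mg i : measurable_fun setT (g i).
  apply: measurable_funM; last by apply: continuous_measurable_fun; exact: continuous_ppow_sqr.
  apply: continuous_measurable_fun => t; rewrite /cos_coeff'.
  apply: cvgM; last exact: cvg_cst.
  apply: cvgM; first exact: cvg_cst.
  apply: (@continuous_comp _ _ _ (fun t : R => 2 * pi * x * t) (fun z => z ^+ i.*2)).
    by apply: cvgM; [exact: cvg_cst|exact: cvg_id].
  exact: exprn_continuous.
have gle i t : `|g i t| <= exp_coeff k i * ppow (nu - 1) (w - t ^+ 2).
  rewrite /g normrM (ger0_norm (ppow_ge0 _ _)).
  have [wt|wt] := leP (w - t ^+ 2) 0; first by rewrite ppow_le0// !mulr0.
  apply: ler_wpM2r; first exact: ppow_ge0.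
  rewrite /cos_coeff' !normrM normfV normr_nat normrX normrN1 expr1n mul1r.
  have Z0 : 0 <= (2 * pi * x * t) ^+ 2 by exact: sqr_ge0.
  rewrite /exp_coeff /= -[in X in X / _]mul2n exprM (ger0_norm (exprn_ge0 i Z0)).
  have Zk : (2 * pi * x * t) ^+ 2 <= k.
    rewrite exprMn; apply: ler_wpM2l; first exact: sqr_ge0.
    by rewrite le_max orbC -subr_ge0 ltW.
  apply: ler_pM; [exact: exprn_ge0|by rewrite invr_ge0|by rewrite lerXn2r ?nnegrE|].
  by rewrite lef_pV2 ?posrE// ler_nat fact_double_ge.
have [|igs] := @Rintegral_series _ _ _ leb g _ _ mg (ppow_sqr_integrable w nu0) gle
  (fun i => exp_coeff_ge0 i k0) (fun t => ppow_ge0 _ _).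
  exact: is_cvg_series_exp_coeff.
rewrite (_ : (fun n => \int[leb]_t g n t) = (fun i => moment 0 nu w * ((- (pi ^+ 2 * x ^+ 2) * w) ^+ i / (i`!%:R * rising (nu + 2^-1) i)))).
  rewrite (_ : (fun t => limn (series (g^~ t))) = (fun t => cos (2 * pi * x * t) * ppow (nu - 1) (w - t ^+ 2)))//.
  apply/funext => t; apply/cvg_lim => //.
  rewrite (_ : series _ = (fun n => series (cos_coeff' (2 * pi * x * t)) n * ppow (nu - 1) (w - t ^+ 2))).
    by apply: cvgMl; exact: cvg_cos_coeff'.
  by apply/funext => n; rewrite /series /= mulr_suml.
apply/funext => i.
transitivity ((-1) ^+ i * (2 * pi * x) ^+ i.*2 / i.*2`!%:R * moment i nu w).
  rewrite -RintegralZl//; last exact: monomial_ppow_integrable.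
  by apply: eq_Rintegral => t _; rewrite /g /cos_coeff' exprMn -exprnP; ring.
have -> : (2 * pi * x) ^+ i.*2 = 4 ^+ i * (pi ^+ 2 * x ^+ 2) ^+ i.
  by rewrite -mul2n exprM -exprMn; congr (_ ^+ i); ring.
have -> : (- (pi ^+ 2 * x ^+ 2) * w) ^+ i = (-1) ^+ i * (pi ^+ 2 * x ^+ 2) ^+ i * w ^+ i.
  by rewrite -!exprMn; congr (_ ^+ i); ring.
rewrite momentE// fact_double.
have h0 : rising (2^-1 : R) i != 0 by rewrite rising_neq0// invr_gt0.
have f4 : (4 : R) ^+ i != 0 by rewrite expf_neq0.
move: (fn i) (rising_neq0 i nu2) h0 f4 => f1.
move: (rising (nu + 2^-1) i) (rising _ i) (4 ^+ i) => r1 r2 r3 r10 r20 r30.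
by field; rewrite r10 r20 r30 gt_eqF.
Qed.

Lemma ppowDn s n w : 0 < s -> ppow (s + n%:R) w = ppow s w * Num.max 0 w ^+ n.
Proof.
move=> s0; elim: n => [|n IH]; first by rewrite addr0 expr0 mulr1.
rewrite -natr1 addrA ppowD1 ?IH ?exprSr ?mulrA//.
by rewrite ltr_wpDr.
Qed.

Lemma continuous_cos_lin x : continuous (fun t : R => cos (2 * pi * x * t)).
Proof.
move=> t; apply: (@continuous_comp _ _ _ (fun t : R => 2 * pi * x * t) cos).
  by apply: cvgM; [exact: cvg_cst|exact: cvg_id].
exact: continuous_cos.
Qed.

(** Each power of index n in the profile gives a 0F1 row. [moment0_shift] produces (mu)_n / (mu +
    1/2)_n, which cancels the normalization (mu)_n, and (mu + 1/2)_n (mu + 1/2 + n)_i = (mu +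
    1/2)_(n+i) depends on n + i alone. Summing along diagonals therefore gives a profile again, with
    coefficients [expconv]. *)
Lemma cos_profile mu e V x w : 1 < mu -> profile_summable mu e V -> w <= V ->
  leb.-integrable setT (EFin \o (fun t : R => cos (2 * pi * x * t) * profile mu e (w - t ^+ 2))) /\
  \int[leb]_t (cos (2 * pi * x * t) * profile mu e (w - t ^+ 2)) =
  beta_mass mu * profile (mu + 2^-1) (expconv (pi ^+ 2 * x ^+ 2) e) w.
Proof.
move=> mu1 se wV; have mu0 : 0 < mu - 1 by rewrite subr_gt0.
have mu3 : 0 < mu by lra.
have mu2 : 0 < mu + 2^-1 by lra.
have [w0|w0] := leP w 0.
  have z (t : R) : profile mu e (w - t ^+ 2) = 0.
    by rewrite /profile ppow_le0 ?mul0r// subr_le0 (le_trans w0)// sqr_ge0.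
  rewrite (_ : (fun t => _) = (fun=> 0)); last by apply/funext => t; rewrite z mulr0.
  split; first exact: integrable0.
  by rewrite Rintegral_cst// mul0r /profile ppow_le0 ?mul0r ?mulr0//; lra.
have V0 : 0 <= V by rewrite ltW// (lt_le_trans w0).
have w00 := ltW w0.
pose mx (t : R) := Num.max 0 (w - t ^+ 2).
have mxw t : 0 <= mx t <= w.
  by rewrite /mx le_max lexx /= ge_max w00 gerBl sqr_ge0.
have mxV t : 0 <= mx t <= V by have /andP[-> /le_trans ->] := mxw t.
pose g n (t : R) := cos (2 * pi * x * t) * ppow (mu - 1) (w - t ^+ 2) * profile_series mu e (mx t) n.
have gE n t : g n t = e n / rising mu n * (cos (2 * pi * x * t) * ppow (mu + n%:R - 1) (w - t ^+ 2)).
  by rewrite /g (addrAC mu) ppowDn// /profile_series -/(mx t); ring.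
have mun n : 0 < mu + n%:R - 1 by rewrite addrAC ltr_wpDr.
have ig n : leb.-integrable setT (EFin \o (fun t : R => cos (2 * pi * x * t) * ppow (mu + n%:R - 1) (w - t ^+ 2))).
  apply: (integrable_bounded_mul (M := 1)).
  - by have := continuous_measurable_fun (@continuous_cos_lin x).
  - by move=> t; rewrite ler_norml cos_geN1 cos_le1.
  - exact: ppow_sqr_integrable.
have mg n : measurable_fun [set: measurableTypeR R] (g n).
  rewrite (_ : g n = (fun t => e n / rising mu n * (cos (2 * pi * x * t) * ppow (mu + n%:R - 1) (w - t ^+ 2)))).
    apply/measurable_EFinP; apply: measurable_int; exact: integrable_mull (ig n).
  by apply/funext => t; rewrite gE.
have gle n t : `|g n t| <= `|e n| * V ^+ n / rising mu n * ppow (mu - 1) (w - t ^+ 2).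
  rewrite /g normrM normrM (ger0_norm (ppow_ge0 _ _)) mulrC.
  apply: ler_pM => //; first by rewrite mulr_ge0// ppow_ge0.
    exact: profile_series_le.
  by apply: ler_piMl; [exact: ppow_ge0|rewrite ler_norml cos_geN1 cos_le1].
have un n : 0 <= `|e n| * V ^+ n / rising mu n.
  by rewrite divr_ge0 ?mulr_ge0 ?exprn_ge0 ?rising_ge0 ?(ltW mu3).
have [igs S] := @Rintegral_series _ _ _ leb g _ _ mg (ppow_sqr_integrable w mu0) gle
  un (fun t => ppow_ge0 _ _) se.
have limg t : limn (series (g^~ t)) = cos (2 * pi * x * t) * profile mu e (w - t ^+ 2).
  apply/cvg_lim => //; rewrite /profile -/(mx t) mulrA.
  rewrite (_ : series _ = (fun n => cos (2 * pi * x * t) * ppow (mu - 1) (w - t ^+ 2) * series (profile_series mu e (mx t)) n)).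
    by apply: cvgMr; apply: profile_series_cvg (mxV t) se.
  by apply/funext => n; rewrite /series /= mulr_sumr.
rewrite (_ : (fun t => limn (series (g^~ t))) = (fun t => cos (2 * pi * x * t) * profile mu e (w - t ^+ 2))) in igs S;
  last by apply/funext.
split=> //.
pose y := pi ^+ 2 * x ^+ 2; have y0 : 0 <= y by rewrite mulr_ge0 ?sqr_ge0.
pose M0 := moment 0 mu w.
have M00 : 0 <= M0.
  by apply: Rintegral_ge0 => t _; rewrite expr0 mul1r ppow_ge0.
pose f n i := M0 * (e n * w ^+ n * ((- y * w) ^+ i / i`!%:R) / rising (mu + 2^-1) (n + i)).
have wV' n : 0 <= `|e n| * w ^+ n / rising mu n.
  by rewrite divr_ge0 ?mulr_ge0 ?exprn_ge0 ?rising_ge0 ?(ltW mu3).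
have yw0 : 0 <= y * w by rewrite mulr_ge0.
have := @diagonal_series _ f (fun n => M0 * (`|e n| * w ^+ n / rising mu n)) (exp_coeff (y * w)) (fun n => \int[leb]_t g n t).
case.
- move=> n i; rewrite /f normrM (ger0_norm M00) -[leRHS]mulrA; apply: ler_wpM2l => //.
  rewrite !normrM normfV !normrX normrM normrN (ger0_norm y0) (ger0_norm w00).
  rewrite normfV normr_nat (gtr0_norm (rising_gt0 _ mu2)) /exp_coeff /=.
  rewrite [leRHS]mulrAC; apply: ler_wpM2l.
    by rewrite mulr_ge0 ?divr_ge0 ?exprn_ge0// mulr_ge0 ?exprn_ge0.
  rewrite lef_pV2 ?posrE ?rising_gt0//; apply: ler_rising2; [exact: ltW| |exact: leq_addr].
  by rewrite lerDl invr_ge0.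
- by move=> n; rewrite mulr_ge0.
- by move=> n; exact: exp_coeff_ge0.
- rewrite (_ : series _ = (fun n => M0 * series (fun n => `|e n| * w ^+ n / rising mu n) n)).
    apply: is_cvgMr; apply: series_dominated se => n; rewrite ger0_norm//.
    by rewrite ler_wpM2r ?invr_ge0 ?rising_ge0 ?(ltW mu3)// ler_wpM2l// lerXn2r ?nnegrE.
  by apply/funext => n; rewrite /series /= mulr_sumr.
- exact: is_cvg_series_exp_coeff.
- move=> n.
  have mun1 : 1 < mu + n%:R by rewrite (lt_le_trans mu1)// lerDl.
  have -> : \int[leb]_t g n t = e n / rising mu n * \int[leb]_t (cos (2 * pi * x * t) * ppow (mu + n%:R - 1) (w - t ^+ 2)).
    by rewrite -RintegralZl//; apply: eq_Rintegral => t _; exact: gE.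
  have := @cos_ppow_series _ w x mun1; rewrite -/y.
  set h := (fun i => _) => hS.
  rewrite (_ : series (f n) = (fun N => e n / rising mu n * series h N)); first exact: cvgMr.
  apply/funext => N; rewrite /series /= mulr_sumr.
  apply: eq_bigr => i _; rewrite /h moment0_shift// -/M0 /f risingD.
  have r1 := rising_neq0 n mu3; have r2 := rising_neq0 n mu2.
  have r3 : rising (mu + 2^-1 + n%:R) i != 0 by rewrite rising_neq0// ltr_wpDr.
  have f0 : i`!%:R != 0 :> R by rewrite pnatr_eq0 -lt0n fact_gt0.
  rewrite (addrAC mu n%:R); move: r1 r2 r3 f0.
  move: (rising mu n) (rising (mu + 2^-1) n) (rising (mu + _ + _) i) (i`!%:R) => q1 q2 q3 q4 *.
  by field; do ?[apply/andP; split].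
move=> _ D.
have -> : \int[leb]_t (cos (2 * pi * x * t) * profile mu e (w - t ^+ 2)) = limn (series (fun n => \int[leb]_t g n t)).
  by apply/esym/cvg_lim.
have mu12 : mu + 2^-1 - 1 = mu - 2^-1 by field.
rewrite -(cvg_lim _ D)// /profile (max_r w00) mu12 mulrA -moment0E// -/M0 -/y.
apply/cvg_lim => //.
rewrite (_ : series _ = (fun n => M0 * series (profile_series (mu + 2^-1) (expconv y e) w) n)).
  apply: cvgMr; apply: (@profile_series_cvg _ _ V); rewrite ?w00//.
  by apply: expconv_summable => //; exact: ltW.
apply/funext => n; rewrite /series /= mulr_sumr; apply: eq_bigr => m _.
rewrite /profile_series /expconv !mulr_suml mulr_sumr; apply: eq_bigr => i _.
have im : (i <= m)%N by rewrite -ltnS.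
have -> : w ^+ m = w ^+ i * w ^+ (m - i) by rewrite -exprD subnKC.
by rewrite /f subnKC// exprMn; ring.
Qed.

End profile.

Section profile_continuity.
Context {R : realType}.
Implicit Types (e : R^nat) (w x y V mu nu : R).

(** Summability at V says nothing about larger arguments, where the series may diverge; hence the
    clipping at V. The profiles are only used at V minus a square. Continuity follows from uniform
    convergence on [0, V]. *)
Lemma profile_continuous mu e V : 1 < mu -> 0 <= V -> profile_summable mu e V ->
  continuous (fun w => profile mu e (Num.min w V)).
Proof.
move=> mu1 V0 se; have mu0 : 0 < mu - 1 by rewrite subr_gt0.
have mu3 : 0 < mu by lra.
have cmin : continuous (fun w : R => Num.min w V).
  by move=> w; apply: (@continuous_min _ _ (id : R -> R) (fun=> V)); [exact: cvg_id|exact: cvg_cst].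
have cclip : continuous (fun w : R => Num.max 0 (Num.min w V)).
  by move=> w; apply: (@continuous_max _ _ (fun=> 0) (fun w : R => Num.min w V)); [exact: cvg_cst|exact: cmin].
move=> w0; apply: cvgM.
  by apply: (@continuous_comp _ _ _ (fun w : R => Num.min w V) (ppow (mu - 1))); [exact: cmin|exact: continuous_ppow].
pose c (w : R) := Num.max 0 (Num.min w V).
have cV w : 0 <= c w <= V by rewrite /c le_max lexx /= ge_max V0 ge_min lexx orbT.
pose S w := limn (series (profile_series mu e (c w))).
pose b m := `|e m| * V ^+ m / rising mu m.
have tail w n : `|S w - series (profile_series mu e (c w)) n| <= limn (series b) - series b n.
  apply: series_tail_le => //; first by move=> m; exact: profile_series_le.
  exact: profile_series_cvg se.
have cS n : continuous (fun w => series (profile_series mu e (c w)) n).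
  elim: n => [|n IH] w.
    by rewrite (_ : (fun w => _) = cst 0); [exact: cvg_cst|apply/funext => z; rewrite /series /= big_geq].
  rewrite (_ : (fun w => _) = (fun w => series (profile_series mu e (c w)) n + profile_series mu e (c w) n)).
    apply: cvgD; first exact: IH.
    apply: cvgM; last exact: cvg_cst.
    apply: cvgM; first exact: cvg_cst.
    apply: (@continuous_comp _ _ _ c (fun z => z ^+ n)); first exact: cclip.
    exact: exprn_continuous.
  by apply/funext => z; rewrite seriesSr.
change (S w @[w --> w0] --> S w0).
apply/cvgrPdist_lt => eps eps0.
have eps3 : 0 < eps / 3 by rewrite divr_gt0.
have [N _ HN] : \forall n \near \oo, limn (series b) - series b n < eps / 3.
  have /cvgrPdist_lt /(_ _ eps3) : series b @ \oo --> limn (series b) by exact: se.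
  by apply: filterS => n; apply: le_lt_trans; exact: ler_norm.
have {}HN := HN N (leqnn N).
near=> w.
have H : `|series (profile_series mu e (c w0)) N - series (profile_series mu e (c w)) N| < eps / 3.
  by near: w; have /cvgrPdist_lt /(_ _ eps3) := cS N w0.
have T1 := le_lt_trans (tail w0 N) HN.
have T2 := le_lt_trans (tail w N) HN.
move: H T1 T2; move: (S w0) (S w) (series _ N) (series _ N) => p q r s.
rewrite !ltr_norml => /andP[? ?] /andP[? ?] /andP[? ?]; apply/andP; split; lra.
Unshelve. all: by end_near. Qed.

Lemma profile_bounded mu e V w : 1 < mu -> 0 <= V -> profile_summable mu e V -> w <= V ->
  `|profile mu e w| <= ppow (mu - 1) V * limn (series (fun m => `|e m| * V ^+ m / rising mu m)).
Proof.
move=> mu1 V0 se wV; have mu0 : 0 < mu by lra.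
have cV : 0 <= Num.max 0 w <= V by rewrite le_max lexx /= ge_max V0.
rewrite /profile normrM (ger0_norm (ppow_ge0 _ _)).
apply: ler_pM; rewrite ?ppow_ge0//; first by apply: ppow_le => //; lra.
have := @series_tail_le _ _ _ _ 0 (fun m => profile_series_le e m mu0 cV) se (profile_series_cvg mu0 cV se).
by rewrite /series /= !big_geq// !subr0.
Qed.

Lemma profile_le0 mu e w : 1 < mu -> w <= 0 -> profile mu e w = 0.
Proof. by move=> mu1 w0; rewrite /profile ppow_le0 ?mul0r// subr_gt0. Qed.

Lemma expconvD y z e : expconv y (expconv z e) = expconv (y + z) e.
Proof.
apply/funext => m; rewrite /expconv.
under eq_bigr do rewrite mulr_suml.
rewrite (big_triangle_exchange (fun n k => e k * ((- z) ^+ (n - k) / (n - k)`!%:R) * ((- y) ^+ (m - n) / (m - n)`!%:R))).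
apply: eq_bigr => -[k /= km1] _; have km : (k <= m)%N by rewrite -ltnS.
rewrite subSn// opprD exprDn mulr_suml mulr_sumr.
apply: eq_bigr => -[l /= lm1] _; have lm : (l <= m - k)%N by rewrite -ltnS.
rewrite addKn subnDA -[_ *+ 'C(_, _)]mulr_natr.
have := bin_fact lm => /(congr1 (fun n => n%:R : R)); rewrite !natrM => <-.
have f0 n : n`!%:R != 0 :> R by rewrite pnatr_eq0 -lt0n fact_gt0.
have b0 : 'C(m - k, l)%:R != 0 :> R by rewrite pnatr_eq0 -lt0n bin_gt0.
move: b0 (f0 l) (f0 (m - k - l)%N); move: ('C(_, l)%:R) (l`!%:R) ((m - k - l)`!%:R) => b f1 f2 *.
by field; do ?[apply/andP; split].
Qed.

Lemma expconv0 e : expconv 0 e = e.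
Proof.
apply/funext => m; rewrite /expconv big_ord_recr /= subnn expr0 fact0 divr1 mulr1.
rewrite big1 ?add0r// => k _; rewrite oppr0 expr0n.
by rewrite subn_eq0 leqNgt ltn_ord /= mul0r mulr0.
Qed.

End profile_continuity.

(** * Integration over tuples, one coordinate at a time *)

Section tuple_integral.
Context {R : realType}.
Local Notation leb := (@lebesgue_measure R).
Local Notation mR := (measurableTypeR R).

Lemma integral_tuple0 (f : 0.-tuple mR -> \bar R) :
  (\int[lebesgue_tuple R 0]_t f t = f [tuple])%E.
Proof.
have -> : f = cst (f [tuple]) by apply/funext => t; rewrite (tuple0 t).
rewrite [LHS](integral_dirac ([tuple] : 0.-tuple mR) measurableT (measurable_cst _)).
by rewrite diracT mul1e.
Qed.

Lemma ge0_integral_cons n (f : n.+1.-tuple mR -> \bar R) : measurable_fun setT f ->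
  (forall t, 0 <= f t)%E ->
  (\int[lebesgue_tuple R n.+1]_t f t =
   \int[leb]_x \int[lebesgue_tuple R n]_s f (cons_pair (x, s)))%E.
Proof.
move=> mf f0.
rewrite [LHS](ge0_integral_pushforward (@measurable_cons_pair R n) (leb \x lebesgue_tuple R n)%E measurableT mf (fun y _ => f0 y)).
rewrite preimage_setT.
have mg : measurable_fun setT (f \o @cons_pair R n) by exact: (measurableT_comp mf (@measurable_cons_pair R n)).
exact: (fubini_tonelli1 _ mg (fun p => f0 (cons_pair p))).
Qed.

(** Integrability is asked of every slice, not of almost every one, so that the inner real integral
    agrees everywhere with the extended one and no null set has to be carried along. *)
Lemma Rintegral_cons n (f : n.+1.-tuple mR -> R) :
  (lebesgue_tuple R n.+1).-integrable setT (EFin \o f) ->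
  (forall x, (lebesgue_tuple R n).-integrable setT (fun s => (f (cons_pair (x, s)))%:E)) ->
  \int[lebesgue_tuple R n.+1]_t f t =
  \int[leb]_x \int[lebesgue_tuple R n]_s f (cons_pair (x, s)).
Proof.
move=> ifn ifs.
have mf := measurable_int _ ifn.
have ifp : (leb \x lebesgue_tuple R n)%E.-integrable setT (EFin \o f \o @cons_pair R n).
  apply/integrableP; split; first exact: (measurableT_comp mf (@measurable_cons_pair R n)).
  have /integrableP[_] := ifn.
  rewrite [X in (X < _)%E -> _](ge0_integral_pushforward (@measurable_cons_pair R n) (leb \x lebesgue_tuple R n)%E measurableT)//.
  exact: measurableT_comp.
rewrite /Rintegral.
rewrite [X in fine X = _](@integral_pushforward _ _ _ _ _ _ (@measurable_cons_pair R n) (leb \x lebesgue_tuple R n)%E setT (EFin \o f) mf)//.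
rewrite preimage_setT -(integral12_prod_meas1 ifp).
congr fine; apply: eq_integral => x _; rewrite /fubini_F fineK//.
exact: integrable_fin_num (ifs x).
Qed.

Lemma tnth_cons_pair0 n (x : mR) (s : n.-tuple mR) : tnth (cons_pair (x, s)) ord0 = x.
Proof. by []. Qed.

Lemma tnth_cons_pairS n (x : mR) (s : n.-tuple mR) i :
  tnth (cons_pair (x, s)) (lift ord0 i) = tnth s i.
Proof. by rewrite tnthS; congr (tnth _ i); apply/val_inj. Qed.

Lemma measurable_tuple_sum n (h : 'I_n -> R -> R) : (forall i, measurable_fun setT (h i)) ->
  measurable_fun setT (fun t : n.-tuple mR => \sum_(i < n) h i (tnth t i)).
Proof.
move=> mh; apply: measurable_sum => i.
exact: (measurableT_comp (mh i) (measurable_tnth i)).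
Qed.

Lemma measurable_tuple_prod n (h : 'I_n -> R -> R) : (forall i, measurable_fun setT (h i)) ->
  measurable_fun setT (fun t : n.-tuple mR => \prod_(i < n) h i (tnth t i)).
Proof.
move=> mh; apply: measurable_prod => i _.
exact: (measurableT_comp (mh i) (measurable_tnth i)).
Qed.

Lemma integral_tuple_prod n (h : 'I_n -> R -> R) :
  (forall i x, 0 <= h i x) -> (forall i, leb.-integrable setT (fun x => (h i x)%:E)) ->
  (\int[lebesgue_tuple R n]_t (\prod_(i < n) h i (tnth t i))%:E =
   (\prod_(i < n) \int[leb]_x h i x)%:E)%E.
Proof.
elim: n h => [|n IH] h h0 ih.
  by rewrite integral_tuple0 !big_ord0.
have mh i : measurable_fun setT (h i) by have := measurable_int _ (ih i) => /measurable_EFinP.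
rewrite ge0_integral_cons; last 2 first.
- by apply/measurable_EFinP; exact: measurable_tuple_prod.
- by move=> t; rewrite lee_fin prodr_ge0.
under eq_integral => x _.
  under eq_integral => s _.
    rewrite big_ord_recl tnth_cons_pair0.
    under eq_bigr do rewrite tnth_cons_pairS.
    rewrite EFinM.
    over.
  rewrite ge0_integralZl//; last 3 first.
  - apply/measurable_EFinP; exact: (measurable_tuple_prod (fun i => mh (lift ord0 i))).
  - by move=> t _; rewrite lee_fin prodr_ge0.
  - by rewrite lee_fin.
  rewrite (IH (fun i => h (lift ord0 i)))// muleC.
  over.
rewrite ge0_integralZl//; last 3 first.
- exact: measurable_int (ih ord0).
- by move=> t _; rewrite lee_fin.
- rewrite lee_fin; apply: prodr_ge0 => i _; exact: Rintegral_ge0.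
rewrite [in RHS]big_ord_recl mulrC EFinM; congr (_ * _)%E.
by rewrite /Rintegral fineK//; exact: integrable_fin_num (ih ord0).
Qed.

Lemma tuple_prod_integrable n (h : 'I_n -> R -> R) :
  (forall i x, 0 <= h i x) -> (forall i, leb.-integrable setT (fun x => (h i x)%:E)) ->
  (lebesgue_tuple R n).-integrable setT (fun t => (\prod_(i < n) h i (tnth t i))%:E).
Proof.
move=> h0 ih.
have mh i : measurable_fun setT (h i) by have := measurable_int _ (ih i) => /measurable_EFinP.
apply/integrableP; split; first by apply/measurable_EFinP; exact: measurable_tuple_prod.
under eq_integral do rewrite gee0_abs ?lee_fin ?prodr_ge0//.
by rewrite integral_tuple_prod// ltry.
Qed.

Lemma Rintegral_tuple_prod n (h : 'I_n -> R -> R) :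
  (forall i x, 0 <= h i x) -> (forall i, leb.-integrable setT (fun x => (h i x)%:E)) ->
  \int[lebesgue_tuple R n]_t (\prod_(i < n) h i (tnth t i)) =
   \prod_(i < n) \int[leb]_x h i x.
Proof. by move=> h0 ih; rewrite {1}/Rintegral integral_tuple_prod. Qed.

End tuple_integral.

Section reflection.
Context {R : realType}.
Local Notation leb := (@lebesgue_measure R).
Local Notation mR := (measurableTypeR R).
Implicit Types (c x : R) (f : R -> R).

Lemma measurable_reflection c : measurable_fun setT (fun t : mR => c - t : mR).
Proof. by apply: measurable_funB. Qed.

Lemma lebesgue_measure_reflection c (A : set mR) : measurable A ->
  pushforward leb (fun t : mR => c - t : mR) A = leb A.
Proof.
move=> mA; apply/esym.
have mp := measurable_reflection c.
pose m := pushforward leb (fun t : mR => c - t : mR).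
apply: (@lebesgue_measure_unique _ [the measure _ _ of m]) => //= _ [[a b]] _ <-.
rewrite /pushforward.
have -> : (fun t : mR => c - t : mR) @^-1` `]a, b] = `[(c - b), (c - a)[%classic.
  apply/seteqP; split => t /=; rewrite !in_itv /= => /andP[? ?]; apply/andP; split; lra.
rewrite !lebesgue_measure_itv/= !lte_fin ltrD2l ltrN2.
by case: ifP => // _; rewrite -EFinB; congr EFin; lra.
Qed.

Lemma ge0_integral_reflection c (f : R -> \bar R) : measurable_fun setT f ->
  (forall t, 0 <= f t)%E -> (\int[leb]_t f (c - t)%R = \int[leb]_t f t)%E.
Proof.
move=> mf f0.
have := ge0_integral_pushforward (measurable_reflection c) leb measurableT mf (fun y _ => f0 y).
rewrite preimage_setT => <-.
by apply: (eq_measure_integral leb) => [|? A mA _]; [exact: measurable_reflection|];  exact: (lebesgue_measure_reflection c mA).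
Qed.

Lemma reflection_integrable c f : leb.-integrable setT (EFin \o f) ->
  leb.-integrable setT (fun t => (f (c - t))%:E).
Proof.
move=> /integrableP[mf fi]; apply/integrableP; split.
  exact: (measurableT_comp mf (measurable_reflection c)).
by rewrite (ge0_integral_reflection c (f := fun t => `|(f t)%:E|%E))//; exact: measurableT_comp.
Qed.

Lemma Rintegral_reflection c f : leb.-integrable setT (EFin \o f) ->
  \int[leb]_t f (c - t) = \int[leb]_t f t.
Proof.
move=> fi; have mf := measurable_int _ fi; congr fine.
have := integral_pushforward (measurable_reflection c) mf (reflection_integrable c fi) measurableT.
rewrite preimage_setT => <-.
by apply: (eq_measure_integral leb) => [|? A mA _]; [exact: measurable_reflection|];  exact: (lebesgue_measure_reflection c mA).
Qed.

Lemma Rintegral_odd f : leb.-integrable setT (EFin \o f) -> (forall t, f (- t) = - f t) ->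
  \int[leb]_t f t = 0.
Proof.
move=> fi fo; have := Rintegral_reflection 0 fi.
under eq_Rintegral do rewrite sub0r fo -mulN1r.
by rewrite RintegralZl// mulN1r; lra.
Qed.

End reflection.

(** * Fourier transform of a profile in n variables *)

Section profile_transform.
Context {R : realType}.
Local Notation leb := (@lebesgue_measure R).
Local Notation mR := (measurableTypeR R).
Implicit Types (e : R^nat) (mu V W y : R).

Lemma sin_profile mu e V x w : 1 < mu -> profile_summable mu e V -> w <= V ->
  leb.-integrable setT (fun t => (sin (2 * pi * x * t) * profile mu e (w - t ^+ 2))%:E) /\
  \int[leb]_t (sin (2 * pi * x * t) * profile mu e (w - t ^+ 2)) = 0.
Proof.
move=> mu1 se wV.
have [i0 _] := cos_profile 0 mu1 se wV.
have I : leb.-integrable setT (fun t => (sin (2 * pi * x * t) * profile mu e (w - t ^+ 2))%:E).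
  apply: (@integrable_bounded_mul _ _ _ leb _ _ 1 _ _ _).
  - apply: continuous_measurable_fun => t; apply: continuous_comp; last exact: continuous_sin.
    by apply: cvgM; [exact: cvg_cst|exact: cvg_id].
  - by move=> t; rewrite ler_norml sin_geN1 sin_le1.
  - move: i0; apply: eq_integrable => // t _.
    by rewrite /= mulr0 mul0r cos0 mul1r.
split=> //; apply: Rintegral_odd => // t.
by rewrite mulrN sinN sqrrN mulNr.
Qed.

Definition tuple_sqr n (t : n.-tuple mR) : R := \sum_(i < n) tnth t i ^+ 2.

Definition tuple_dot n (u : 'I_n -> R) (t : n.-tuple mR) : R := \sum_(i < n) u i * tnth t i.

Lemma tuple_sqr_cons n (x : mR) (s : n.-tuple mR) :
  tuple_sqr (cons_pair (x, s)) = x ^+ 2 + tuple_sqr s.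
Proof.
rewrite /tuple_sqr big_ord_recl tnth_cons_pair0; congr (_ + _).
by apply: eq_bigr => i _; rewrite tnth_cons_pairS.
Qed.

Lemma tuple_dot_cons n (u : 'I_n.+1 -> R) (x : mR) (s : n.-tuple mR) :
  tuple_dot u (cons_pair (x, s)) = u ord0 * x + tuple_dot (fun i => u (lift ord0 i)) s.
Proof.
rewrite /tuple_dot big_ord_recl tnth_cons_pair0; congr (_ + _).
by apply: eq_bigr => i _; rewrite tnth_cons_pairS.
Qed.

Lemma measurable_tuple_sqr n : measurable_fun setT (@tuple_sqr n).
Proof.
apply: (measurable_tuple_sum (h := fun _ x => x ^+ 2)) => _.
exact: exprn_measurable.
Qed.

Lemma measurable_tuple_dot n u : measurable_fun setT (@tuple_dot n u).
Proof.
apply: (measurable_tuple_sum (h := fun i x => u i * x)) => i.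
exact: mulrl_measurable.
Qed.

Lemma profile_tuple_measurable n mu e V W : 1 < mu -> 0 <= V -> profile_summable mu e V ->
  W <= V -> measurable_fun setT (fun t : n.-tuple mR => profile mu e (W - tuple_sqr t)).
Proof.
move=> mu1 V0 se WV.
rewrite (_ : (fun t => _) = (fun w => profile mu e (Num.min w V)) \o (fun t => W - @tuple_sqr n t)).
  apply: measurableT_comp.
    by apply: continuous_measurable_fun; exact: profile_continuous.
  by apply: measurable_funB => //; exact: measurable_tuple_sqr.
apply/funext => t /=; congr profile.
by apply/esym/min_idPl; rewrite lerBlDr ler_wpDr//; apply: sumr_ge0 => i _; rewrite sqr_ge0.
Qed.

Lemma profile_tuple_integrable n mu e V W : 1 < mu -> 0 <= V -> profile_summable mu e V ->
  W <= V ->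
  (lebesgue_tuple R n).-integrable setT (fun t => (profile mu e (W - tuple_sqr t))%:E).
Proof.
move=> mu1 V0 se WV.
pose M := ppow (mu - 1) V * limn (series (fun m => `|e m| * V ^+ m / rising mu m)).
(* Any r >= 0 with r^2 >= V would do: outside the cube of half-side r the argument of the profile is
   nonpositive. *)
pose r := V + 1.
pose h (x : R) : R := \1_(`[- r, r]%classic : set R) x.
have h0 x : 0 <= h x by rewrite /h.
have ih : leb.-integrable setT (fun x => (h x)%:E).
  exact: (integrable_indic_itv (- r) r true false).
apply: (@integrable_dominated _ _ _ (lebesgue_tuple R n) (fun t : n.-tuple mR => profile mu e (W - tuple_sqr t))
  (fun t : n.-tuple mR => M * \prod_(i < n) h (tnth t i))).
- exact: profile_tuple_measurable se WV.
- move=> t.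
  have M0 : 0 <= M by apply: le_trans (profile_bounded mu1 V0 se (lexx V)).
  have [tr|/existsNP[i /negP]] := pselect (forall i, - r <= tnth t i <= r).
    rewrite big1 ?mulr1; last first.
      by move=> i _; rewrite /h indicE mem_set//= in_itv /=.
    apply: profile_bounded => //.
    by rewrite lerBlDr ler_wpDr//; apply: sumr_ge0 => i _; rewrite sqr_ge0.
  move=> /negP ti; rewrite profile_le0 ?normr0//; first by apply: mulr_ge0 => //; exact: prodr_ge0.
  rewrite subr_le0 /tuple_sqr (bigD1 i)//= ler_wpDr//.
    by apply: sumr_ge0 => j _; rewrite sqr_ge0.
  apply: (le_trans WV).
  have : r ^+ 2 <= tnth t i ^+ 2.
    rewrite -[leRHS]real_normK ?num_real// ler_sqr ?nnegrE ?normr_ge0//; last by rewrite /r; lra.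
    by move: ti; rewrite -ler_norml => /negP; rewrite -ltNge => /ltW.
  by apply: le_trans; rewrite /r sqrrD; nra.
have := @integrableZl _ _ _ (lebesgue_tuple R n) setT measurableT M _ (tuple_prod_integrable (fun _ => h0) (fun _ => ih)).
by apply: eq_integrable => // t _; rewrite /= EFinM.
Qed.


Lemma cos_sin_integrable n (f : n.-tuple mR -> R) (u : 'I_n -> R) :
  (lebesgue_tuple R n).-integrable setT (EFin \o f) ->
  (lebesgue_tuple R n).-integrable setT (fun t => (cos (2 * pi * tuple_dot u t) * f t)%:E) /\
  (lebesgue_tuple R n).-integrable setT (fun t => (sin (2 * pi * tuple_dot u t) * f t)%:E).
Proof.
move=> fi; have md := measurable_tuple_dot u.
have m2 : measurable_fun setT (fun t => 2 * pi * tuple_dot u t) by apply: measurable_funM.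
split.
  apply: (@integrable_bounded_mul _ _ _ (lebesgue_tuple R n) (fun t => cos (2 * pi * tuple_dot u t)) f 1 _ _ fi).
    apply: (measurableT_comp _ m2); apply: continuous_measurable_fun; exact: continuous_cos.
  by move=> t; rewrite ler_norml cos_geN1 cos_le1.
apply: (@integrable_bounded_mul _ _ _ (lebesgue_tuple R n) (fun t => sin (2 * pi * tuple_dot u t)) f 1 _ _ fi).
  apply: (measurableT_comp _ m2); apply: continuous_measurable_fun; exact: continuous_sin.
by move=> t; rewrite ler_norml sin_geN1 sin_le1.
Qed.

(** Induction on n. The claim ranges over all W <= V because the inner integral is taken at W - x^2,
    and the sine integral is carried along for the addition formulas. *)
Lemma profile_fourier n mu e V (u : 'I_n -> R) : 1 < mu -> 0 <= V -> profile_summable mu e V ->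
  let e' := expconv (pi ^+ 2 * \sum_(i < n) u i ^+ 2) e in
  profile_summable (mu + n%:R / 2) e' V /\
  forall W, W <= V ->
  \int[lebesgue_tuple R n]_t (cos (2 * pi * tuple_dot u t) * profile mu e (W - tuple_sqr t)) =
    (\prod_(i < n) beta_mass (mu + i%:R / 2)) * profile (mu + n%:R / 2) e' W /\
  \int[lebesgue_tuple R n]_t (sin (2 * pi * tuple_dot u t) * profile mu e (W - tuple_sqr t)) = 0.
Proof.
move=> mu1 V0 se; elim: n u => [|n IH] u /=.
  rewrite big_ord0 mulr0 expconv0 mul0r addr0; split=> // W WV.
  rewrite /Rintegral !integral_tuple0 /tuple_dot /tuple_sqr !big_ord0 mulr0 cos0 sin0 subr0 mul0r.
  by rewrite !mul1r.
pose u' i := u (lift ord0 i).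
have [se' H] := IH u'.
have nu1 : 1 < mu + n%:R / 2 by rewrite ltr_wpDr// divr_ge0.
have y0 : 0 <= pi ^+ 2 * u ord0 ^+ 2 :> R by rewrite mulr_ge0 ?sqr_ge0.
have En : mu + n.+1%:R / 2 = mu + n%:R / 2 + 2^-1 by rewrite -natr1 mulrDl mul1r addrA.
have Ey : expconv (pi ^+ 2 * \sum_(i < n.+1) u i ^+ 2) e =
  expconv (pi ^+ 2 * u ord0 ^+ 2) (expconv (pi ^+ 2 * \sum_(i < n) u' i ^+ 2) e).
  by rewrite expconvD big_ord_recl mulrDr.
rewrite Ey En; split; first exact: expconv_summable (ltW nu1) V0 y0 se'.
move=> W WV.
have Wx x : W - x ^+ 2 <= V by rewrite lerBlDr ler_wpDr// sqr_ge0.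
have ic x := cos_sin_integrable u' (profile_tuple_integrable n mu1 V0 se (Wx x)).
have [ic1 is1] := cos_sin_integrable u (profile_tuple_integrable n.+1 mu1 V0 se WV).
have Ec x s : cos (2 * pi * tuple_dot u (cons_pair (x, s))) * profile mu e (W - tuple_sqr (cons_pair (x, s))) =
   cos (2 * pi * u ord0 * x) * (cos (2 * pi * tuple_dot u' s) * profile mu e (W - x ^+ 2 - tuple_sqr s))
 - sin (2 * pi * u ord0 * x) * (sin (2 * pi * tuple_dot u' s) * profile mu e (W - x ^+ 2 - tuple_sqr s)).
  rewrite tuple_dot_cons tuple_sqr_cons mulrDr [2 * pi * (_ * x)]mulrA cosD opprD addrA.
  by rewrite mulrBl !mulrA.
have Es x s : sin (2 * pi * tuple_dot u (cons_pair (x, s))) * profile mu e (W - tuple_sqr (cons_pair (x, s))) =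
   sin (2 * pi * u ord0 * x) * (cos (2 * pi * tuple_dot u' s) * profile mu e (W - x ^+ 2 - tuple_sqr s))
 + cos (2 * pi * u ord0 * x) * (sin (2 * pi * tuple_dot u' s) * profile mu e (W - x ^+ 2 - tuple_sqr s)).
  rewrite tuple_dot_cons tuple_sqr_cons mulrDr [2 * pi * (_ * x)]mulrA sinD opprD addrA.
  by rewrite mulrDl !mulrA.
have Ic x := (ic x).1; have Is x := (ic x).2.
have [c1 c2] := cos_profile (u ord0) nu1 se' WV.
have [s1 s2] := sin_profile (u ord0) nu1 se' WV.
have Zl k (g : n.-tuple mR -> R) : (lebesgue_tuple R n).-integrable setT (EFin \o g) ->
  (lebesgue_tuple R n).-integrable setT (EFin \o (fun s => k * g s)).
  by move=> gi; have := @integrableZl _ _ _ (lebesgue_tuple R n) setT measurableT k _ gi.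
split.
  rewrite Rintegral_cons//; last first.
    move=> x; under eq_fun do rewrite Ec EFinB.
    exact: (integrableB measurableT (Zl _ _ (Ic x)) (Zl _ _ (Is x))).
  under eq_Rintegral => x _.
    under eq_Rintegral do rewrite Ec.
    rewrite (RintegralB measurableT (Zl _ _ (Ic x)) (Zl _ _ (Is x))).
    rewrite (RintegralZl _ measurableT (Ic x)) (RintegralZl _ measurableT (Is x)) (H _ (Wx x)).1 (H _ (Wx x)).2 mulr0 subr0 mulrCA.
    over.
  by rewrite RintegralZl// c2 big_ord_recr /= mulrA.
rewrite Rintegral_cons//; last first.
  move=> x; under eq_fun do rewrite Es EFinD.
  exact: (integrableD measurableT (Zl _ _ (Ic x)) (Zl _ _ (Is x))).
under eq_Rintegral => x _.
  under eq_Rintegral do rewrite Es.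
  rewrite (RintegralD measurableT (Zl _ _ (Ic x)) (Zl _ _ (Is x))).
  rewrite (RintegralZl _ measurableT (Ic x)) (RintegralZl _ measurableT (Is x)) (H _ (Wx x)).1 (H _ (Wx x)).2 mulr0 addr0 mulrCA.
  over.
by rewrite RintegralZl// s2 mulr0.
Qed.

End profile_transform.

(** * Fourier inversion by Abel summation *)

Section poisson_kernel.
Context {R : realType}.
Local Notation leb := (@lebesgue_measure R).
Implicit Types (eps b s x u : R).

Lemma is_derive_scale b x : is_derive x 1 (fun u : R => b * u) b.
Proof.
by apply: is_derive_eq; rewrite [LHS]/GRing.scale /= mulr1.
Qed.

Lemma cvg_expR_scale eps : 0 < eps -> expR (- (eps * u)) @[u --> +oo] --> (0 : R).
Proof.
move=> e0; apply: (@cvg_comp _ _ _ (fun u => eps * u) (fun v => expR (- v))); last exact: cvgr_expR.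
exact: (gt0_cvgMry e0 cvg_id).
Qed.

(** Adding 1 to the cosine keeps the integrand nonnegative, so the fundamental theorem on a
    half-line applies and yields integrability as well; the constant part is subtracted
    afterwards. *)
Lemma integral_expR_1cos eps b : 0 < eps ->
  \int[leb]_(u in `[0, +oo[) (expR (- (eps * u)) * (1 + cos (b * u))) =
  eps^-1 + eps / (eps ^+ 2 + b ^+ 2) /\
  leb.-integrable `[0, +oo[ (fun u => (expR (- (eps * u)) * (1 + cos (b * u)))%:E).
Proof.
move=> e0; pose D := eps ^+ 2 + b ^+ 2.
have D0 : 0 < D by rewrite ltr_wpDr ?sqr_ge0// exprn_gt0.
pose E : R -> R := expR \o (fun u => - eps * u).
pose S : R -> R := sin \o (fun u => b * u).
pose C : R -> R := cos \o (fun u => b * u).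
pose F : R -> R := (- eps^-1) *: E + E * (b / D *: S - eps / D *: C).
pose f u := expR (- (eps * u)) * (1 + cos (b * u)).
have dE u : is_derive u 1 E (E u * - eps).
  by apply: is_derive1_comp; exact: is_derive_scale.
have dS u : is_derive u 1 S (C u * b) by apply: is_derive1_comp; exact: is_derive_scale.
have dC u : is_derive u 1 C (- S u * b) by apply: is_derive1_comp; exact: is_derive_scale.
have dF u : is_derive u 1 F (f u).
  have dSC : is_derive u 1 (b / D *: S - eps / D *: C) (b / D *: (C u * b) - eps / D *: (- S u * b)).
    by apply: is_deriveB.
  apply: is_derive_eq (is_deriveD (is_deriveZ (- eps^-1) (dE u)) (is_deriveM (dE u) dSC)) _.
  have -> : f u = E u * (1 + C u) by rewrite /f /E /C /= mulNr.
  rewrite !/GRing.scale /=.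
  have -> : ((b / D) \*: S - (eps / D) \*: C) u = b / D * S u - eps / D * C u by [].
  move: (E u) (C u) (S u) => x y z; rewrite /D; field.
  by rewrite gt_eqF // gt_eqF.
have cf : continuous f.
  move=> u; apply: cvgM.
    apply: (@continuous_comp _ _ _ (fun u => - (eps * u)) expR); last exact: continuous_expR.
    by apply: cvgN; apply: cvgM; [exact: cvg_cst|exact: cvg_id].
  apply: cvgD; first exact: cvg_cst.
  apply: (@continuous_comp _ _ _ (fun u => b * u) cos); last exact: continuous_cos.
  by apply: cvgM; [exact: cvg_cst|exact: cvg_id].
have f0 u : 0 <= f u by rewrite mulr_ge0 ?expR_ge0// -lerBlDl sub0r cos_geN1.
have EE u : E u = expR (- (eps * u)) by rewrite /E /= mulNr.
have FE u : F u = - eps^-1 * E u + E u * (b / D * S u - eps / D * C u) by [].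
have cF : F u @[u --> +oo] --> 0.
  have cE := cvg_expR_scale e0.
  have -> : F = (fun u => expR (- (eps * u)) * (- eps^-1 + (b / D * sin (b * u) - eps / D * cos (b * u)))).
    apply/funext => u; rewrite FE EE /S /C /=; ring.
  pose K := eps^-1 + (`|b / D| + `|eps / D|).
  have cK : K * expR (- (eps * u)) @[u --> +oo] --> 0.
    by rewrite -(mulr0 K); apply: cvgM => //; exact: cvg_cst.
  apply/norm_cvg0P.
  apply: squeeze_cvgr (cvg_cst 0) cK.
  apply: nearW => u; rewrite normr_ge0 /= normrM (ger0_norm (expR_ge0 _)) mulrC ler_wpM2r ?expR_ge0//.
  apply: (le_trans (ler_normD _ _)); rewrite normrN ger0_norm ?invr_ge0 ?(ltW e0)// lerD2l.
  apply: (le_trans (ler_normB _ _)); rewrite !normrM.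
  apply: lerD; rewrite -normrM normrM ler_piMr// ?normr_ge0// ler_norml.
    by rewrite sin_geN1 sin_le1.
  by rewrite cos_geN1 cos_le1.
have I := @ge0_continuous_FTC2y R f F 0 0 (fun x _ => f0 x) (continuous_subspaceT cf) cF.
have {}I : (\int[leb]_(u in `[0%R, +oo[) (f u)%:E = 0%:E - (F 0)%:E)%E.
  apply: I.
  - by move=> x _; case: (dF x).
  - apply: cvg_at_right_filter; apply: differentiable_continuous; apply/derivable1_diffP.
    by case: (dF 0).
  - by move=> x _; rewrite derive1E; exact: derive_val.
split.
  rewrite /Rintegral I /= FE /E /S /C /= !mulr0 sin0 cos0 expR0; lra.
apply/integrableP; split.
  by apply/measurable_EFinP; apply: measurable_funTS; exact: continuous_measurable_fun.
under eq_integral do rewrite gee0_abs ?lee_fin//.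
by rewrite I -EFinB ltry.
Qed.


Definition abel eps u : R := expR (- (eps * `|u|)).

Lemma abel_gt0 eps u : 0 < abel eps u.
Proof. exact: expR_gt0. Qed.

Lemma continuous_abel eps : continuous (abel eps).
Proof.
move=> u; apply: (@continuous_comp _ _ _ (fun u => - (eps * `|u|)) expR); last exact: continuous_expR.
by apply: cvgN; apply: cvgM; [exact: cvg_cst|exact: norm_continuous].
Qed.

Lemma continuous_scale b : continuous (fun u : R => b * u).
Proof. by move=> u; apply: cvgM; [exact: cvg_cst|exact: cvg_id]. Qed.

Lemma integral_abel_1cos eps b : 0 < eps ->
  (\int[leb]_u (abel eps u * (1 + cos (b * u)))%:E = (2 * (eps^-1 + eps / (eps ^+ 2 + b ^+ 2)))%:E)%E.
Proof.
move=> e0; have [h1 h2] := integral_expR_1cos b e0.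
have cg : continuous (fun u => abel eps u * (1 + cos (b * u))).
  move=> u; apply: cvgM; first exact: continuous_abel.
  apply: cvgD; first exact: cvg_cst.
  by apply: (@continuous_comp _ _ _ (fun u => b * u) cos); [exact: continuous_scale|exact: continuous_cos].
rewrite ge0_symfun_integralT//; last 2 first.
- by move=> u; rewrite mulr_ge0 ?(ltW (abel_gt0 _ _))// -lerBlDl sub0r cos_geN1.
- by move=> u; rewrite /abel /= normrN mulrN cosN.
rewrite EFinM -h1 -set_itvcy /Rintegral fineK; last exact: integrable_fin_num h2.
congr (_ * _)%E; apply: eq_integral => u; rewrite inE /= in_itv /= andbT => u0.
by rewrite /abel ger0_norm.
Qed.

Lemma abel_integrable eps : 0 < eps -> leb.-integrable setT (fun u => (abel eps u)%:E).
Proof.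
move=> e0; apply/integrableP; split.
  by apply/measurable_EFinP; apply: continuous_measurable_fun; exact: continuous_abel.
apply: (@le_lt_trans _ _ (\int[leb]_u (abel eps u * (1 + cos (0 * u)))%:E)%E).
  apply: ge0_le_integral => //.
  - apply: measurableT_comp => //; apply/measurable_EFinP; apply: continuous_measurable_fun; exact: continuous_abel.
  - apply/measurable_EFinP; apply: measurable_funM; first by apply: continuous_measurable_fun; exact: continuous_abel.
    rewrite (_ : (fun x => _) = cst 2); first exact: measurable_cst.
    by apply/funext => u; rewrite mul0r cos0.
  move=> u _; rewrite gee0_abs ?lee_fin ?(ltW (abel_gt0 _ _))// mul0r cos0.
  by have := abel_gt0 eps u; lra.
by rewrite integral_abel_1cos// ltry.
Qed.

Lemma Rintegral_abel eps : 0 < eps -> \int[leb]_u abel eps u = 2 / eps.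
Proof.
move=> e0; have := integral_abel_1cos 0 e0 => /(congr1 fine) /=.
under [X in fine X]eq_integral do rewrite mul0r cos0 mulrC.
rewrite [LHS](RintegralZl (1 + 1) measurableT (abel_integrable e0)).
rewrite expr0n addr0 => E.
have n0 : eps != 0 by rewrite gt_eqF.
have -> : 2 / eps = eps^-1 + eps / eps ^+ 2 by field.
lra.
Qed.

Lemma abel_cos eps b : 0 < eps ->
  leb.-integrable setT (fun u => (cos (b * u) * abel eps u)%:E) /\
  \int[leb]_u (cos (b * u) * abel eps u) = 2 * eps / (eps ^+ 2 + b ^+ 2).
Proof.
move=> e0; have ia := abel_integrable e0.
have ic : leb.-integrable setT (fun u => (cos (b * u) * abel eps u)%:E).
  apply: (@integrable_bounded_mul _ _ _ leb _ _ 1 _ _ ia).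
    apply: continuous_measurable_fun => u.
    by apply: (@continuous_comp _ _ _ (fun u => b * u) cos); [exact: continuous_scale|exact: continuous_cos].
  by move=> u; rewrite ler_norml cos_geN1 cos_le1.
split=> //.
have := integral_abel_1cos b e0 => /(congr1 fine) /=.
under [X in fine X]eq_integral do rewrite mulrDr mulr1 [abel _ _ * cos _]mulrC.
rewrite [LHS](RintegralD measurableT ia ic) Rintegral_abel//.
have -> : 2 * eps / (eps ^+ 2 + b ^+ 2) = 2 * (eps / (eps ^+ 2 + b ^+ 2)) by rewrite mulrA.
by rewrite mulrDr => /addrI.
Qed.

Lemma abel_sin eps b : 0 < eps ->
  leb.-integrable setT (fun u => (sin (b * u) * abel eps u)%:E) /\
  \int[leb]_u (sin (b * u) * abel eps u) = 0.
Proof.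
move=> e0; have ia := abel_integrable e0.
have ic : leb.-integrable setT (fun u => (sin (b * u) * abel eps u)%:E).
  apply: (@integrable_bounded_mul _ _ _ leb _ _ 1 _ _ ia).
    apply: continuous_measurable_fun => u.
    by apply: (@continuous_comp _ _ _ (fun u => b * u) sin); [exact: continuous_scale|exact: continuous_sin].
  by move=> u; rewrite ler_norml sin_geN1 sin_le1.
split=> //; apply: Rintegral_odd => // u.
by rewrite mulrN sinN /abel normrN mulNr.
Qed.

(** The Fourier transform of [abel eps]: the Cauchy density of scale eps / (2 pi). *)
Definition poisson eps s : R := 2 * eps / (eps ^+ 2 + (2 * pi * s) ^+ 2).

Lemma poisson_gt0 eps s : 0 < eps -> 0 < poisson eps s.
Proof. by move=> e0; rewrite divr_gt0 ?mulr_gt0// ltr_wpDr ?sqr_ge0// exprn_gt0. Qed.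

Lemma continuous_poisson eps : 0 < eps -> continuous (poisson eps).
Proof.
move=> e0 s; apply: cvgM; first exact: cvg_cst.
apply: cvgV; first by rewrite gt_eqF// ltr_wpDr ?sqr_ge0// exprn_gt0.
apply: cvgD; first exact: cvg_cst.
apply: (@continuous_comp _ _ _ (fun u => 2 * pi * u) (fun u => u ^+ 2)); [exact: continuous_scale|exact: exprn_continuous].
Qed.

Lemma integral_poisson eps : 0 < eps -> (\int[leb]_s (poisson eps s)%:E = 1)%E.
Proof.
move=> e0; have cp := continuous_poisson e0.
have p0 s : 0 <= poisson eps s by exact: ltW (poisson_gt0 _ e0).
have pi0 : 0 < pi :> R by exact: pi_gt0.
pose F : R -> R := pi^-1 *: (atan \o (fun s => (2 * pi / eps) * s)).
have dF s : is_derive s 1 F (poisson eps s).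
  have d1 : is_derive s 1 (atan \o (fun s => (2 * pi / eps) * s)) ((1 + (2 * pi / eps * s) ^+ 2)^-1 * (2 * pi / eps)).
    by apply: is_derive1_comp; exact: is_derive_scale.
  apply: is_derive_eq (is_deriveZ (pi^-1) d1) _.
  rewrite /GRing.scale /= /poisson.
  have D0 : eps ^+ 2 + (2 * pi * s) ^+ 2 != 0 by rewrite gt_eqF// ltr_wpDr ?sqr_ge0// exprn_gt0.
  have n0 : eps != 0 by rewrite gt_eqF.
  have -> : 1 + (2 * pi / eps * s) ^+ 2 = (eps ^+ 2 + (2 * pi * s) ^+ 2) / eps ^+ 2 by field.
  move: D0 pi0; move: (eps ^+ 2 + _) => D; move: (pi : R) => p D0 pn0; field.
  by rewrite D0 n0 gt_eqF.
rewrite ge0_symfun_integralT//; last by move=> s; rewrite /poisson /= mulrN sqrrN.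
rewrite -set_itvcy (@ge0_continuous_FTC2y R (poisson eps) F 0 (pi^-1 * (pi / 2)))//.
- have -> : F 0 = 0 by rewrite /F -[LHS]/(pi^-1 * atan (2 * pi / eps * 0)) mulr0 atan0 mulr0.
  rewrite sube0 -EFinM.
  by congr EFin; rewrite mulKf ?gt_eqF// divff.
- exact: continuous_subspaceT.
- apply: cvgM; first exact: cvg_cst.
  apply: (@cvg_comp _ _ _ (fun s => (2 * pi / eps) * s) atan); last exact: cvgy_atan.
  by apply: (gt0_cvgMry _ cvg_id); rewrite divr_gt0// mulr_gt0.
- apply: cvg_at_right_filter; apply: differentiable_continuous; apply/derivable1_diffP.
  by case: (dF 0).
- by move=> x _; rewrite derive1E; exact: derive_val.
Qed.

Lemma poisson_integrable eps : 0 < eps -> leb.-integrable setT (fun s => (poisson eps s)%:E).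
Proof.
move=> e0; apply/integrableP; split.
  by apply/measurable_EFinP; apply: continuous_measurable_fun; exact: continuous_poisson.
under eq_integral do rewrite gee0_abs ?lee_fin ?(ltW (poisson_gt0 _ _))//.
by rewrite integral_poisson// ltry.
Qed.

(** Away from 0 the kernel is O(eps) times the fixed integrable kernel [poisson 1]. This is what
    makes the products concentrate as eps tends to 0. *)
Lemma poisson_tail eps r s : 0 < eps -> 0 < r -> r <= `|s| ->
  poisson eps s <= eps * (1 + ((2 * pi * r) ^+ 2)^-1) * poisson 1 s.
Proof.
move=> e0 r0 rs; rewrite /poisson expr1n mulr1.
have q0 : 0 < (2 * pi * r) ^+ 2 by rewrite exprn_gt0// !mulr_gt0// pi_gt0.
have : (2 * pi * r) ^+ 2 <= (2 * pi * s) ^+ 2.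
  rewrite -[leRHS]real_normK ?num_real// ler_sqr ?nnegrE ?normr_ge0//; last by rewrite !mulr_ge0 ?pi_ge0// ltW.
  by rewrite normrM ger0_norm ?mulr_ge0 ?pi_ge0// ler_wpM2l ?mulr_ge0 ?pi_ge0.
move: q0; move: ((2 * pi * r) ^+ 2) ((2 * pi * s) ^+ 2) => q p q0 qp.
have p0 : 0 < p by exact: lt_le_trans qp.
have -> : eps * (1 + q^-1) * (2 / (1 + p)) = (2 * eps) * ((1 + q^-1) / (1 + p)) by ring.
rewrite ler_wpM2l ?mulr_ge0 ?(ltW e0)//.
apply: (@le_trans _ _ p^-1).
  by rewrite lef_pV2 ?posrE ?ltr_wpDl ?sqr_ge0//; rewrite lerDr sqr_ge0.
rewrite ler_pdivlMr; last lra.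
by rewrite mulrDr mulr1 mulVf ?gt_eqF// addrC lerD2l lef_pV2.
Qed.

End poisson_kernel.
Lemma Rintegral_sum d (T : measurableType d) (R : realType) (m : measure T R)
  (I : Type) (s : seq I) (f : I -> T -> R) :
  (forall i, m.-integrable setT (EFin \o f i)) ->
  m.-integrable setT (fun t => (\sum_(i <- s) f i t)%:E) /\
  \int[m]_t \sum_(i <- s) f i t = \sum_(i <- s) \int[m]_t f i t.
Proof.
move=> fi; elim: s => [|i s [IH1 IH2]].
  split; first by under eq_fun do rewrite big_nil; exact: integrable0.
  by under eq_Rintegral do rewrite big_nil; rewrite big_nil Rintegral_cst// mul0r.
have E t : \sum_(j <- i :: s) f j t = f i t + \sum_(j <- s) f j t by rewrite big_cons.
split.
  under eq_fun do rewrite E EFinD.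
  exact: (integrableD measurableT (fi i) IH1).
under eq_Rintegral do rewrite E.
by rewrite (RintegralD measurableT (fi i) IH1) big_cons IH2.
Qed.

(** * Abel means of the Fourier inversion integral *)

Section inversion.
Context {R : realType}.
Local Notation leb := (@lebesgue_measure R).
Local Notation mR := (measurableTypeR R).
Local Notation lebn n := (lebesgue_tuple R n).
Implicit Types (eps : R).

Definition tuple_abel n eps (u : n.-tuple mR) : R := \prod_(i < n) abel eps (tnth u i).

Lemma tuple_abel_gt0 n eps u : 0 < @tuple_abel n eps u.
Proof. by apply: prodr_gt0 => i _; exact: abel_gt0. Qed.

Lemma tuple_abel_integrable n eps : 0 < eps ->
  (lebn n).-integrable setT (fun u => (tuple_abel eps u)%:E).
Proof.
move=> e0; apply: (tuple_prod_integrable (h := fun _ => abel eps)) => [_ u|_].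
  exact: ltW (abel_gt0 _ _).
exact: abel_integrable.
Qed.

Lemma tuple_abel_fourier n eps (s : 'I_n -> R) : 0 < eps ->
  \int[lebn n]_u (cos (2 * pi * tuple_dot s u) * tuple_abel eps u) =
    \prod_(i < n) poisson eps (s i) /\
  \int[lebn n]_u (sin (2 * pi * tuple_dot s u) * tuple_abel eps u) = 0.
Proof.
move=> e0; elim: n s => [|n IH] s /=.
  rewrite /Rintegral !integral_tuple0 /tuple_dot /tuple_abel !big_ord0 mulr0 cos0 sin0 mul0r.
  by rewrite !mul1r.
pose s' i := s (lift ord0 i).
have [Hc Hs] := IH s'.
have Ea x t : tuple_abel eps (cons_pair (x, t) : n.+1.-tuple mR) = abel eps x * tuple_abel eps t.
  rewrite /tuple_abel big_ord_recl tnth_cons_pair0; congr (_ * _).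
  by apply: eq_bigr => i _; rewrite tnth_cons_pairS.
have [Ic Is] := cos_sin_integrable s' (tuple_abel_integrable n e0).
have [ic1 is1] := cos_sin_integrable s (tuple_abel_integrable n.+1 e0).
have Ec x t : cos (2 * pi * tuple_dot s (cons_pair (x, t))) * tuple_abel eps (cons_pair (x, t) : n.+1.-tuple mR) =
   cos (2 * pi * s ord0 * x) * abel eps x * (cos (2 * pi * tuple_dot s' t) * tuple_abel eps t)
 - sin (2 * pi * s ord0 * x) * abel eps x * (sin (2 * pi * tuple_dot s' t) * tuple_abel eps t).
  rewrite tuple_dot_cons Ea mulrDr [2 * pi * (_ * x)]mulrA cosD; ring.
have Es x t : sin (2 * pi * tuple_dot s (cons_pair (x, t))) * tuple_abel eps (cons_pair (x, t) : n.+1.-tuple mR) =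
   sin (2 * pi * s ord0 * x) * abel eps x * (cos (2 * pi * tuple_dot s' t) * tuple_abel eps t)
 + cos (2 * pi * s ord0 * x) * abel eps x * (sin (2 * pi * tuple_dot s' t) * tuple_abel eps t).
  rewrite tuple_dot_cons Ea mulrDr [2 * pi * (_ * x)]mulrA sinD; ring.
have [c1 c2] := abel_cos (2 * pi * s ord0) e0.
have [s1 s2] := abel_sin (2 * pi * s ord0) e0.
have Zl k (g : n.-tuple mR -> R) : (lebn n).-integrable setT (EFin \o g) ->
  (lebn n).-integrable setT (EFin \o (fun t => k * g t)).
  by move=> gi; have := @integrableZl _ _ _ (lebn n) setT measurableT k _ gi.
split.
  rewrite Rintegral_cons//; last first.
    move=> x; under eq_fun do rewrite Ec EFinB.
    exact: (integrableB measurableT (Zl _ _ Ic) (Zl _ _ Is)).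
  under eq_Rintegral => x _.
    under eq_Rintegral do rewrite Ec.
    rewrite (RintegralB measurableT (Zl _ _ Ic) (Zl _ _ Is)).
    rewrite (RintegralZl _ measurableT Ic) (RintegralZl _ measurableT Is) Hc Hs mulr0 subr0 mulrC.
    over.
  by rewrite (RintegralZl _ measurableT c1) c2 big_ord_recl mulrC.
rewrite Rintegral_cons//; last first.
  move=> x; under eq_fun do rewrite Es EFinD.
  exact: (integrableD measurableT (Zl _ _ Ic) (Zl _ _ Is)).
under eq_Rintegral => x _.
  under eq_Rintegral do rewrite Es.
  rewrite (RintegralD measurableT (Zl _ _ Ic) (Zl _ _ Is)).
  rewrite (RintegralZl _ measurableT Ic) (RintegralZl _ measurableT Is) Hc Hs mulr0 addr0 mulrC.
  over.
by rewrite (RintegralZl _ measurableT s1) s2 mulr0.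
Qed.

Definition tuple_cos n (C : n.-tuple mR -> R) (u : 'I_n -> R) : R :=
  \int[lebn n]_h (cos (2 * pi * tuple_dot u h) * C h).

Definition tuple_sin n (C : n.-tuple mR -> R) (u : 'I_n -> R) : R :=
  \int[lebn n]_h (sin (2 * pi * tuple_dot u h) * C h).

(** Abel weight times the real part of the Fourier transform of C at u multiplied by exp(2 pi i <x,
    u>). *)
Definition abel_mean n eps (C : n.-tuple mR -> R) (x : 'I_n -> R) (u : n.-tuple mR) : R :=
  tuple_abel eps u * (cos (2 * pi * tuple_dot x u) * tuple_cos C (tnth u)
                      + sin (2 * pi * tuple_dot x u) * tuple_sin C (tnth u)).

(** Fubini for cos(2 pi <u, x - h>) C(h) weighted by the Abel factor in u; that factor makes the
    double integral absolutely convergent with no integrability of the spectrum. *)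
Lemma abel_mean_poisson n eps (C : n.-tuple mR -> R) (x : 'I_n -> R) : 0 < eps ->
  (lebn n).-integrable setT (EFin \o C) ->
  (lebn n).-integrable setT (EFin \o abel_mean eps C x) /\
  \int[lebn n]_u abel_mean eps C x u =
  \int[lebn n]_h (C h * \prod_(i < n) poisson eps (x i - tnth h i)).
Proof.
move=> e0 iC; have mC : measurable_fun setT C by have := measurable_int _ iC => /measurable_EFinP.
have ia := tuple_abel_integrable n e0.
have ma : measurable_fun setT (@tuple_abel n eps) by have := measurable_int _ ia => /measurable_EFinP.
pose T : Type := (n.-tuple mR * n.-tuple mR)%type.
pose s (p : T) : R := \sum_(i < n) tnth p.1 i * (x i - tnth p.2 i).
pose g (p : T) : R := tuple_abel eps p.1 * C p.2.
pose f (p : T) : R := cos (2 * pi * s p) * g p.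
have mg : measurable_fun setT g.
  apply: measurable_funM; first exact: (measurableT_comp ma measurable_fst).
  exact: (measurableT_comp mC measurable_snd).
have ms : measurable_fun setT s.
  apply: measurable_sum => i; apply: measurable_funM.
    exact: (measurableT_comp (measurable_tnth i) measurable_fst).
  apply: measurable_funB; first exact: measurable_cst.
  exact: (measurableT_comp (measurable_tnth i) measurable_snd).
have ig : (lebn n \x lebn n)%E.-integrable setT (EFin \o g).
  apply/integrable12ltyP; first exact/measurable_EFinP.
  have [_ iC'] := integrableP _ _ _ iC.
  rewrite (eq_integral (fun u => (tuple_abel eps u)%:E * \int[lebn n]_h `|(C h)%:E|)%E); last first.
    move=> u _; rewrite -ge0_integralZl//; last 2 first.
    - by apply: measurableT_comp => //; exact/measurable_EFinP.
    - by rewrite lee_fin ltW// tuple_abel_gt0.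
    by apply: eq_integral => h _; rewrite /g /= normrM EFinM (gtr0_norm (tuple_abel_gt0 _ _)).
  have I0 : (0 <= \int[lebn n]_h `|(C h)%:E|)%E by exact: integral_ge0.
  rewrite ge0_integralZr//; last 2 first.
  - exact/measurable_EFinP.
  - by move=> u _; rewrite lee_fin ltW// tuple_abel_gt0.
  rewrite lte_mul_pinfty//; first by apply: integral_ge0 => u _; rewrite lee_fin ltW// tuple_abel_gt0.
  exact: integrable_fin_num ia.
have ifp : (lebn n \x lebn n)%E.-integrable setT (EFin \o f).
  apply: (@integrable_bounded_mul _ _ _ (lebn n \x lebn n)%E (fun p => cos (2 * pi * s p)) g 1 _ _ ig).
    apply: (@measurableT_comp _ _ _ _ _ _ (cos : R -> R)).
      by apply: continuous_measurable_fun; exact: continuous_cos.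
    exact: measurable_funM.
  by move=> t; rewrite ler_norml cos_geN1 cos_le1.
have F1 u : fubini_F (lebn n) (EFin \o f) u = (abel_mean eps C x u)%:E.
  have [c1 s1] := cos_sin_integrable (tnth u) iC.
  have Ef h : f (u, h) = tuple_abel eps u * cos (2 * pi * tuple_dot x u) * (cos (2 * pi * tuple_dot (tnth u) h) * C h)
    + tuple_abel eps u * sin (2 * pi * tuple_dot x u) * (sin (2 * pi * tuple_dot (tnth u) h) * C h).
    rewrite /f /g /=; have -> : s (u, h) = tuple_dot x u - tuple_dot (tnth u) h.
      by rewrite /s /tuple_dot -sumrB; apply: eq_bigr => i _ /=; rewrite mulrBr [x i * _]mulrC.
    rewrite mulrBr cosB; ring.
  have Zl k (q : n.-tuple mR -> R) : (lebn n).-integrable setT (EFin \o q) ->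
    (lebn n).-integrable setT (EFin \o (fun t => k * q t)).
    by move=> gi; have := @integrableZl _ _ _ (lebn n) setT measurableT k _ gi.
  rewrite /fubini_F; under eq_integral do rewrite /= Ef EFinD.
  have i1 := Zl (tuple_abel eps u * cos (2 * pi * tuple_dot x u)) _ c1.
  have i2 := Zl (tuple_abel eps u * sin (2 * pi * tuple_dot x u)) _ s1.
  rewrite -[LHS]fineK; last by apply: integrable_fin_num => //; exact: (integrableD measurableT i1 i2).
  congr EFin; rewrite [LHS](RintegralD measurableT i1 i2).
  rewrite (RintegralZl _ measurableT c1) (RintegralZl _ measurableT s1) /abel_mean.
  rewrite -/(tuple_cos C (tnth u)) -/(tuple_sin C (tnth u)); ring.
have F2 h : fubini_G (lebn n) (EFin \o f) h = (C h * \prod_(i < n) poisson eps (x i - tnth h i))%:E.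
  have [c1 _] := cos_sin_integrable (fun i => x i - tnth h i) ia.
  have [<- _] := tuple_abel_fourier (fun i => x i - tnth h i) e0.
  have Ef u : f (u, h) = C h * (cos (2 * pi * tuple_dot (fun i => x i - tnth h i) u) * tuple_abel eps u).
    rewrite /f /g /=; have -> : s (u, h) = tuple_dot (fun i => x i - tnth h i) u.
      by apply: eq_bigr => i _; rewrite mulrC.
    ring.
  rewrite /fubini_G; under eq_integral do rewrite /= Ef EFinM.
  rewrite integralZl//= EFinM; congr (_ * _)%E.
  by rewrite /Rintegral fineK//; exact: integrable_fin_num c1.
split.
  by have := integrable_fubini_F ifp; apply: eq_integrable => // u _; rewrite F1.
have := etrans (integral12_prod_meas1 ifp) (esym (integral21_prod_meas1 ifp)).
under eq_integral do rewrite F1.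
by under [X in _ = X -> _]eq_integral do rewrite F2; move=> /(congr1 fine).
Qed.

End inversion.

(** * Products of Poisson kernels as an approximate identity *)

Section approximate_identity.
Context {R : realType}.
Local Notation leb := (@lebesgue_measure R).
Local Notation mR := (measurableTypeR R).
Local Notation lebn n := (lebesgue_tuple R n).
Implicit Types (eps : R).

Lemma poisson_prod_integral n (eps : 'I_n -> R) (x : 'I_n -> R) : (forall i, 0 < eps i) ->
  (lebn n).-integrable setT (fun h => (\prod_(i < n) poisson (eps i) (x i - tnth h i))%:E) /\
  \int[lebn n]_h (\prod_(i < n) poisson (eps i) (x i - tnth h i)) = 1.
Proof.
move=> e0.
have h0 i t : 0 <= poisson (eps i) (x i - t) by exact: ltW (poisson_gt0 _ (e0 i)).
have ih i := reflection_integrable (x i) (poisson_integrable (e0 i)).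
split; first exact: (tuple_prod_integrable (h := fun i t => poisson (eps i) (x i - t))).
rewrite (Rintegral_tuple_prod (h := fun i t => poisson (eps i) (x i - t)))//.
rewrite big1// => i _.
rewrite (Rintegral_reflection (x i) (poisson_integrable (e0 i))).
by rewrite /Rintegral integral_poisson.
Qed.

Lemma poisson_mean_near n (C : n.-tuple mR -> R) (x : 'I_n -> R) (c M r delta eps : R) :
  (lebn n).-integrable setT (EFin \o C) -> (forall h, `|C h - c| <= M) ->
  0 < r -> (forall h, (forall i, `|x i - tnth h i| <= r) -> `|C h - c| <= delta) -> 0 < eps ->
  `|\int[lebn n]_h (C h * \prod_(i < n) poisson eps (x i - tnth h i)) - c|
    <= delta + M * (eps * (1 + ((2 * pi * r) ^+ 2)^-1)) *+ n.
Proof.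
move=> iC CM r0 Cr e0; have mC : measurable_fun setT C by have := measurable_int _ iC => /measurable_EFinP.
set K := eps * _.
have [ip Ip] := poisson_prod_integral x (fun _ : 'I_n => e0).
pose p (h : n.-tuple mR) := \prod_(i < n) poisson eps (x i - tnth h i).
(* If h is farther than r from x in coordinate j, [poisson_tail] in that coordinate bounds the
   kernel by K times q j. Each q j has mass 1, so the far region contributes at most n M K. *)
pose q (j : 'I_n) (h : n.-tuple mR) := \prod_(i < n) poisson (if i == j then 1 else eps) (x i - tnth h i).
have eq0 (j i : 'I_n) : 0 < (if i == j then 1 else eps) by case: ifP.
have iq j := (poisson_prod_integral x (eq0 j)).1.
have Iq j := (poisson_prod_integral x (eq0 j)).2.
have p0 h : 0 <= p h by apply: prodr_ge0 => i _; exact: ltW (poisson_gt0 _ e0).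
have q0 j h : 0 <= q j h by apply: prodr_ge0 => i _; exact: ltW (poisson_gt0 _ (eq0 j i)).
have M0 : 0 <= M by exact: le_trans (CM [tuple of nseq n 0]).
have d0 : 0 <= delta.
  apply: le_trans (Cr (mktuple x) _) => // i.
  by rewrite tnth_mktuple subrr normr0 ltW.
have K0 : 0 <= K by rewrite mulr_ge0 ?(ltW e0)// addr_ge0// invr_ge0 sqr_ge0.
have mp : measurable_fun setT p by have := measurable_int _ ip => /measurable_EFinP.
have Zl k (g : n.-tuple mR -> R) : (lebn n).-integrable setT (EFin \o g) ->
  (lebn n).-integrable setT (EFin \o (fun t => k * g t)).
  by move=> gi; have := @integrableZl _ _ _ (lebn n) setT measurableT k _ gi.
have iD : (lebn n).-integrable setT (EFin \o (fun h => (C h - c) * p h)).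
  apply: (@integrable_bounded_mul _ _ _ (lebn n) (fun h => C h - c) p M) => //.
  exact: measurable_funB.
have icp := Zl c _ ip.
have -> : \int[lebn n]_h (C h * p h) - c = \int[lebn n]_h ((C h - c) * p h).
  have -> : \int[lebn n]_h (C h * p h) = \int[lebn n]_h ((C h - c) * p h + c * p h).
    by apply: eq_Rintegral => h _; rewrite mulrBl subrK.
  by rewrite (RintegralD measurableT iD icp) (RintegralZl _ measurableT ip) Ip mulr1 addrK.
apply: (le_trans (le_normr_Rintegral measurableT iD)).
have [isq Isq] := @Rintegral_sum _ _ _ (lebn n) _ (index_enum 'I_n) q iq.
have iN : (lebn n).-integrable setT (EFin \o (fun h => `|(C h - c) * p h|)).
  by have := integrable_abse iD; apply: eq_integrable.
have i1 := Zl delta _ ip; have i2 := Zl (M * K) _ isq.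
have iR : (lebn n).-integrable setT (EFin \o (fun h => delta * p h + M * K * \sum_(j < n) q j h)).
  by have := integrableD measurableT i1 i2; apply: eq_integrable.
apply: (@le_trans _ _ (\int[lebn n]_h (delta * p h + M * K * \sum_(j < n) q j h))).
  apply: (le_Rintegral measurableT iN iR) => h _.
  rewrite normrM (ger0_norm (p0 h)).
  have [hr|/existsNP[j hj]] := pselect (forall i, `|x i - tnth h i| <= r).
    rewrite -[leLHS]addr0; apply: lerD; first by rewrite ler_wpM2r// Cr.
    by apply: mulr_ge0; [exact: mulr_ge0|exact: sumr_ge0].
  rewrite -[leLHS]add0r; apply: lerD; first exact: mulr_ge0.
  rewrite -mulrA; apply: ler_pM => //.
  have pq : p h <= K * q j h.
    rewrite /p /q (bigD1 j)//= [in leRHS](bigD1 j)//= eqxx mulrA.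
    have -> : \prod_(i < n | i != j) poisson (if i == j then 1 else eps) (x i - tnth h i)
      = \prod_(i < n | i != j) poisson eps (x i - tnth h i).
      by apply: eq_bigr => i /negbTE ->.
    rewrite ler_wpM2r//; first by apply: prodr_ge0 => i _; exact: ltW (poisson_gt0 _ e0).
    apply: poisson_tail => //; rewrite leNgt; apply/negP => hjr; apply: hj.
    exact: ltW.
  apply: (le_trans pq); rewrite ler_wpM2l// (bigD1 j)//= lerDl.
  by apply: sumr_ge0.
rewrite (RintegralD measurableT i1 i2) (RintegralZl _ measurableT ip) (RintegralZl _ measurableT isq).
rewrite Ip mulr1 Isq lerD2l; under eq_bigr do rewrite Iq.
by rewrite sumr_const card_ord mulr_natr.
Qed.

Lemma abel_mean_cvg n (C : n.-tuple mR -> R) (x : 'I_n -> R) (c M : R) :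
  (lebn n).-integrable setT (EFin \o C) -> (forall h, `|C h - c| <= M) ->
  (forall delta, 0 < delta -> exists2 r, 0 < r &
     forall h, (forall i, `|x i - tnth h i| <= r) -> `|C h - c| <= delta) ->
  (fun m => \int[lebn n]_u abel_mean (m.+1%:R^-1) C x u) @ \oo --> c.
Proof.
move=> iC CM Cc; apply/cvgrPdist_le => e e0.
have e2 : 0 < e / 2 by rewrite divr_gt0.
have [r r0 Cr] := Cc _ e2.
pose L := M * (1 + ((2 * pi * r) ^+ 2)^-1) *+ n.
have [N _ HN] : \forall m \near \oo, `|0 - m.+1%:R^-1 * L| <= e / 2.
  have : (fun m => m.+1%:R^-1 * L) @ \oo --> (0 : R).
    by rewrite -(mul0r L); apply: cvgM; [exact: cvg_harmonic|exact: cvg_cst].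
  by move/cvgrPdist_le; apply.
exists N => // m Nm; have m0 : 0 < m.+1%:R^-1 :> R by rewrite invr_gt0.
rewrite distrC (abel_mean_poisson x m0 iC).2.
apply: (le_trans (poisson_mean_near iC CM r0 Cr m0)).
have := HN m Nm; rewrite sub0r normrN => /(le_trans (ler_norm _)).
have -> : m.+1%:R^-1 * L = M * (m.+1%:R^-1 * (1 + ((2 * pi * r) ^+ 2)^-1)) *+ n.
  by rewrite /L mulrnAr mulrCA.
by move: (_ *+ n) => y; lra.
Qed.

End approximate_identity.

(** * Uniqueness and positive semidefiniteness from the spectrum *)

Section row_vectors.
Context {R : realType}.
Local Notation leb := (@lebesgue_measure R).
Local Notation mR := (measurableTypeR R).
Local Notation lebn n := (lebesgue_tuple R n).

Lemma cvg_sum (T : Type) (F : set_system T) (FF : Filter F) (I : Type) (s : seq I)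
  (f : I -> T -> R) (l : I -> R) : (forall i, f i @ F --> l i) ->
  (fun t => \sum_(i <- s) f i t) @ F --> \sum_(i <- s) l i.
Proof.
move=> fl; elim: s => [|i s IH].
  by under eq_fun do rewrite big_nil; rewrite big_nil; exact: cvg_cst.
by under eq_fun do rewrite big_cons; rewrite big_cons; exact: cvgD.
Qed.

Lemma continuous_row n (C : 'rV[R]_n -> R) (v : 'rV[R]_n) : {for v, continuous C} ->
  forall delta, 0 < delta -> exists2 r, 0 < r &
    forall h : n.-tuple R, (forall i, `|v ord0 i - tnth h i| <= r) ->
      `|C (row_of_tuple h) - C v| <= delta.
Proof.
move=> cC delta d0.
have /cvgrPdist_le /(_ _ d0) : C w @[w --> v] --> C v by exact: cC.
rewrite -nbhs_ballE => -[r /= r0 H].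
have r2 : 0 < r / 2 by rewrite divr_gt0.
exists (r / 2) => // h hr; rewrite distrC; apply: H => /=.
split=> // i j; rewrite ord1 mxE -ball_normE /=.
by apply: le_lt_trans (hr j) _; rewrite ltr_pdivrMr// mulr_natr mulr2n ltrDl.
Qed.

Lemma dotp_row_of_tuple n (u : 'rV[R]_n) (t : n.-tuple R) :
  dotp u (row_of_tuple t) = tuple_dot (u ord0) t.
Proof. by apply: eq_bigr => i _; rewrite mxE. Qed.

Lemma fourierE n (C : 'rV[R]_n -> R) (u : 'rV[R]_n) :
  fourier C u = Complex (tuple_cos (C \o @row_of_tuple R n) (u ord0))
                        (- tuple_sin (C \o @row_of_tuple R n) (u ord0)).
Proof.
by congr Complex; [|congr (- _)]; apply: eq_Rintegral => t _; rewrite dotp_row_of_tuple mulrC.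
Qed.

Lemma abel_mean_cvg_row n (C : 'rV[R]_n -> R) (M : R) (v : 'rV[R]_n) :
  (lebn n).-integrable setT (fun t => (C (row_of_tuple t))%:E) ->
  (forall h, `|C h| <= M) -> {for v, continuous C} ->
  (fun m => \int[lebn n]_u abel_mean (m.+1%:R^-1) (C \o @row_of_tuple R n) (v ord0) u) @ \oo --> C v.
Proof.
move=> iC CM cC; apply: (abel_mean_cvg (M := M + M)) => //.
- by move=> h; apply: (le_trans (ler_normB _ _)); apply: lerD; exact: CM.
- exact: continuous_row.
Qed.

Lemma tuple_of_row n (u : 'I_n -> R) : exists v : 'rV[R]_n, v ord0 = u.
Proof. by exists (\row_i u i); apply/funext => i; rewrite mxE. Qed.

(** The Abel means involve C only through its Fourier transform, and they converge to C
    pointwise. *)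
Lemma fourier_inj n (C1 C2 : 'rV[R]_n -> R) (M : R) :
  (forall h, `|C1 h| <= M) -> (forall h, `|C2 h| <= M) ->
  continuous C1 -> continuous C2 ->
  (lebn n).-integrable setT (fun t => (C1 (row_of_tuple t))%:E) ->
  (lebn n).-integrable setT (fun t => (C2 (row_of_tuple t))%:E) ->
  (forall u, fourier C1 u = fourier C2 u) -> C1 = C2.
Proof.
move=> M1 M2 c1 c2 i1 i2 F; apply/funext => v.
have H1 := abel_mean_cvg_row i1 M1 (c1 v).
have H2 := abel_mean_cvg_row i2 M2 (c2 v).
have E : (fun m => \int[lebn n]_u abel_mean (m.+1%:R^-1) (C1 \o @row_of_tuple R n) (v ord0) u) =
    (fun m => \int[lebn n]_u abel_mean (m.+1%:R^-1) (C2 \o @row_of_tuple R n) (v ord0) u).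
  apply/funext => m; apply: eq_Rintegral => t _; rewrite /abel_mean.
  have [u uE] := tuple_of_row (tnth t).
  by have := F u; rewrite !fourierE uE => -[-> /oppr_inj ->].
by rewrite E in H1; exact: (cvg_unique _ H1 H2).
Qed.

(** Test the quadratic form on the points h and 0 with weights (1, 1) and (1, -1). *)
Lemma pos_semidef_bound n (C : 'rV[R]_n -> R) (h : 'rV[R]_n) :
  pos_semidef C -> C (- h) = C h -> `|C h| <= C 0.
Proof.
move=> pC CN.
pose x (i : 'I_2) : 'rV[R]_n := if i == ord0 then h else 0.
have := pC 2%N x (fun i => if i == ord0 then 1 else -1).
have := pC 2%N x (fun i => 1).
rewrite !big_ord_recl !big_ord0 /x /= !subrr !subr0 sub0r CN.
rewrite !mul1r !mulr1 !mulN1r ?opprK !addr0 ?mul1r => ? ?.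
rewrite ler_norml; apply/andP; split; lra.
Qed.

(* Abel means of the inversion integral of a nonnegative spectrum are positive
   semidefinite, and so is their pointwise limit. *)
Lemma pos_semidef_fourier n (C : 'rV[R]_n -> R) (M : R) :
  (lebn n).-integrable setT (fun t => (C (row_of_tuple t))%:E) ->
  (forall h, `|C h| <= M) -> continuous C ->
  (forall u, 0 <= tuple_cos (C \o @row_of_tuple R n) u) ->
  (forall u, tuple_sin (C \o @row_of_tuple R n) u = 0) ->
  pos_semidef C.
Proof.
move=> iC CM cC Cc Cs N x l.
pose D : n.-tuple mR -> R := C \o @row_of_tuple R n.
pose f (p : 'I_N * 'I_N) m t := l p.1 * l p.2 * abel_mean (m.+1%:R^-1) D ((x p.1 - x p.2) ord0) t.
have m0 m : 0 < m.+1%:R^-1 :> R by rewrite invr_gt0.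
have ia p m := (abel_mean_poisson ((x p.1 - x p.2) ord0) (m0 m) iC).1.
have ifp m (p : 'I_N * 'I_N) : (lebn n).-integrable setT (EFin \o f p m).
  exact: (@integrableZl _ _ _ (lebn n) setT measurableT (l p.1 * l p.2) _ (ia p m)).
rewrite pair_big /=.
have cS : (fun m => \sum_(p : 'I_N * 'I_N) \int[lebn n]_t f p m t) @ \oo -->
   \sum_(p : 'I_N * 'I_N) l p.1 * l p.2 * C (x p.1 - x p.2).
  apply: cvg_sum => p.
  rewrite (_ : (fun m => _) = (fun m => l p.1 * l p.2 * \int[lebn n]_t abel_mean (m.+1%:R^-1) D ((x p.1 - x p.2) ord0) t)).
    apply: cvgM; first exact: cvg_cst.
    exact: (abel_mean_cvg_row iC CM (cC _)).
  by apply/funext => m; rewrite -(RintegralZl _ measurableT (ia p m)).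
rewrite -(cvg_lim (@Rhausdorff R) cS).
apply: limr_ge; first by apply/cvg_ex; eexists; exact: cS.
apply: nearW => m; rewrite -(Rintegral_sum _ (ifp m)).2.
apply: Rintegral_ge0 => t _.
pose y i : R := 2 * pi * tuple_dot (x i ord0) t.
(* The formula for cos(y_i - y_j) separates the two indices, so the double sum becomes a sum of two
   squares. *)
rewrite (eq_bigr (fun p => tuple_abel m.+1%:R^-1 t * tuple_cos D (tnth t) *
   (l p.1 * cos (y p.1) * (l p.2 * cos (y p.2)) + l p.1 * sin (y p.1) * (l p.2 * sin (y p.2))))); last first.
  move=> p _; rewrite /f /abel_mean Cs mulr0 addr0.
  have -> : 2 * pi * tuple_dot ((x p.1 - x p.2) ord0) t = y p.1 - y p.2.
    rewrite /y -mulrBr /tuple_dot -sumrB; congr (_ * _); apply: eq_bigr => i _.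
    by rewrite !mxE mulrBl.
  rewrite cosB; ring.
rewrite -mulr_sumr; apply: mulr_ge0.
  by apply: mulr_ge0 => //; exact: ltW (tuple_abel_gt0 _ _).
have sq (c : 'I_N -> R) : \sum_(p : 'I_N * 'I_N) c p.1 * c p.2 = (\sum_i c i) ^+ 2.
  by rewrite -(pair_bigA _ (fun i j => c i * c j)) /= expr2 big_distrlr.
rewrite big_split /= (sq (fun i => l i * cos (y i))) (sq (fun i => l i * sin (y i))).
by rewrite addr_ge0 ?sqr_ge0.
Qed.

End row_vectors.

(** * The Gauss hypergeometric covariance *)

Section gamma_positivity.
Context {R : realType}.
Local Notation leb := (@lebesgue_measure R).
Implicit Types (x t : R).

(** For x < 1 the integrand is singular at 0. The primitive t^x / x is used on [1/(n+2), 1], where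
    the shift by 2 keeps the interval nondegenerate, followed by monotone convergence. *)
Lemma powR_integral01 x : 0 < x ->
  (\int[leb]_(t in `]0%R, 1%R]) (t `^ (x - 1)%R)%:E <= (x^-1)%R%:E)%E.
Proof.
move=> x0; pose F n : set R := `[n.+2%:R^-1, 1]%classic.
pose f t := t `^ (x - 1).
have mf (A : set R) : measurable_fun A (fun t => (f t)%:E).
  by apply/measurable_EFinP; apply: measurable_funTS; exact: measurable_powR.
have nd : {homo F : n m / (n <= m)%N >-> (n <= m)%O}.
  move=> n m nm; apply/subsetPset => t; rewrite /F /= !in_itv /= => /andP[nt ->]; rewrite andbT.
  by apply: le_trans nt; rewrite lef_pV2 ?posrE// ler_nat.
have C := @ge0_nondecreasing_set_cvg_integral _ (measurableTypeR R) _ F (fun t => (f t)%:E) leb nd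
   (fun n => measurable_itv _) (fun n => mf _) (fun n t _ => powR_ge0 t (x - 1)).
have UF : \bigcup_n F n = `]0, 1]%classic.
  apply/seteqP; split=> t.
    case=> n _; rewrite /F /= !in_itv /= => /andP[nt ->]; rewrite andbT.
    by apply: lt_le_trans nt; rewrite invr_gt0.
  rewrite /= in_itv /= => /andP[t0 t1].
  have [n nt] : exists n : nat, t^-1 <= n%:R by exists (Num.truncn t^-1).+1; rewrite ltW// truncnS_gt.
  exists n => //; rewrite /F /= in_itv /= t1 andbT.
  rewrite -[leRHS]invrK lef_pV2 ?posrE ?invr_gt0//.
  by apply: (le_trans nt); rewrite ler_nat ltnW.
rewrite UF in C.
rewrite -(cvg_lim (@ereal_hausdorff R) C).
apply: lime_le; first by apply/cvg_ex; eexists; exact: C.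
apply: nearW => n.
have n0 : 0 < n.+2%:R^-1 :> R by rewrite invr_gt0.
have n1 : n.+2%:R^-1 < 1 :> R by rewrite invf_lt1// ltr1n.
have dG t : 0 < t -> is_derive t 1 (x^-1 *: (fun t => t `^ x)) (f t).
  move=> t0; apply: is_derive_eq (is_deriveZ _ (is_derive1_powR x t0)) _.
  by rewrite /GRing.scale /= mulrA mulVf ?mul1r// gt_eqF.
have cf t : 0 < t -> {for t, continuous f}.
  move=> t0; apply: differentiable_continuous; apply/derivable1_diffP.
  by case: (is_derive1_powR (x - 1) t0).
have cG t : 0 < t -> {for t, continuous (x^-1 *: (fun t => t `^ x))}.
  move=> t0; apply: differentiable_continuous; apply/derivable1_diffP.
  by case: (dG t t0).
rewrite (@continuous_FTC2 R f (x^-1 *: (fun t => t `^ x)))//.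
- have -> : (x^-1 *: (fun t => t `^ x)) 1 = x^-1 by rewrite -[LHS]/(x^-1 * 1 `^ x) powR1 mulr1.
  have -> t : (x^-1 *: (fun t => t `^ x)) t = x^-1 * t `^ x by [].
  rewrite -EFinB lee_fin gerBl.
  by rewrite mulr_ge0 ?powR_ge0// invr_ge0 ltW.
- apply: continuous_in_subspaceT => t; rewrite inE /= in_itv /= => /andP[t0 _].
  by apply: cf; exact: lt_le_trans t0.
- split.
  + move=> t; rewrite in_itv /= => /andP[t0 _].
    by case: (dG t (lt_trans n0 t0)).
  + by apply: cvg_at_right_filter; exact: cG.
  + by apply: cvg_at_left_filter; exact: cG.
- move=> t; rewrite in_itv /= => /andP[t0 _].
  by rewrite derive1E; have := dG t (lt_trans n0 t0) => ?; exact: derive_val.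
Qed.

(** For an integer N >= x - 1, t^N <= (2N)^N exp(t/2), the N-th power of t/(2N) <= exp(t/(2N)). *)
Lemma powR_expR_bound x : exists2 K, 0 <= K &
  forall t, 1 <= t -> t `^ (x - 1) * expR (- t) <= K * abel (2^-1) t.
Proof.
pose N := (Num.truncn x).+1; have xN : x - 1 <= N%:R.
  by rewrite lerBlDr (le_trans (ltW (truncnS_gt x)))// lerDl.
have N0 : 0 < N%:R :> R by rewrite ltr0n.
exists ((2 * N%:R) ^+ N); first by rewrite exprn_ge0// mulr_ge0.
move=> t t1; have t0 : 0 < t by exact: lt_le_trans t1.
have -> : abel 2^-1 t = expR (t / 2) * expR (- t).
  by rewrite /abel gtr0_norm// -expRD; congr expR; lra.
rewrite mulrA ler_wpM2r ?expR_ge0//.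
apply: (le_trans (ler_powR t1 xN)); rewrite powR_mulrn ?(ltW t0)//.
have -> : t / 2 = N%:R * (t / (2 * N%:R)) by field; rewrite gt_eqF.
rewrite expRM_natl -exprMn lerXn2r ?nnegrE ?mulr_ge0 ?expR_ge0 ?(ltW t0)//.
rewrite -[leLHS](@divfK _ (2 * N%:R)) ?gt_eqF ?mulr_gt0// mulrC ler_wpM2l ?mulr_ge0//.
by apply: le_trans (expR_ge1Dx _); rewrite lerDr.
Qed.

(** A divergent integral would make [Gamma x] equal to 0 by convention, so the proof has to
    establish integrability before bounding below on [1, 2]. *)
Lemma Gamma_gt0 x : 0 < x -> 0 < Gamma x.
Proof.
move=> x0; pose f t := t `^ (x - 1) * expR (- t).
have mf (A : set R) : measurable_fun A f.
  apply: measurable_funTS; apply: measurable_funM; first exact: measurable_powR.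
  apply: continuous_measurable_fun => t.
  by apply: (@continuous_comp _ _ _ -%R expR); [exact: opp_continuous|exact: continuous_expR].
have mE (A : set (measurableTypeR R)) : measurable_fun A (fun t => (f t)%:E).
  by apply/measurable_EFinP; exact: mf.
have f0 t : 0 <= f t by rewrite mulr_ge0 ?powR_ge0 ?expR_ge0.
have [K K0 HK] := powR_expR_bound x.
have ifn : leb.-integrable `]0, +oo[ (fun t => (f t)%:E).
  apply/integrableP; split; first exact: mE.
  under eq_integral do rewrite gee0_abs ?lee_fin//.
  have -> : `]0, +oo[%classic = `]0, 1]%classic `|` `]1, +oo[%classic :> set R.
    apply/seteqP; split=> t; rewrite /= !in_itv /= ?andbT.
      by move=> t0; case: (leP t 1) => t1; [left; rewrite t0|right].
    by case=> [/andP[]//|]; apply: lt_trans.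
  rewrite ge0_integral_setU//=; last 2 first.
  - by move=> t _; rewrite lee_fin.
  - apply/disj_setPS => t /=; rewrite !in_itv /= andbT => -[/andP[_ t1] /lt_le_trans/(_ t1)].
    by rewrite ltxx.
  apply: lte_add_pinfty.
    apply: (@le_lt_trans _ _ (x^-1)%:E); last exact: ltry.
    apply: le_trans (powR_integral01 x0).
    apply: ge0_le_integral => //.
    - by move=> t _; rewrite lee_fin.
    - by apply/measurable_EFinP; apply: measurable_funTS; exact: measurable_powR.
    move=> t; rewrite /= in_itv /= => /andP[t0 _].
    by rewrite lee_fin ler_piMr ?powR_ge0// -expR0 ler_expR oppr_le0 ltW.
  have h0 : 0 < 2^-1 :> R by rewrite invr_gt0.
  have iK := integrableZl measurableT K (abel_integrable h0).
  have iK2 : leb.-integrable `]1, +oo[ (fun t => (K * abel 2^-1 t)%:E) by apply: integrableS iK.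
  have /integrableP[mK] := iK2.
  apply: le_lt_trans; apply: ge0_le_integral => //.
  - by move=> t _; rewrite lee_fin.
  - exact: measurableT_comp.
  move=> t; rewrite /= in_itv /= andbT => t1.
  rewrite lee_fin ger0_norm ?mulr_ge0 ?(ltW (abel_gt0 _ _))//.
  exact/HK/ltW.
have ifn2 : leb.-integrable `[1, 2] (fun t => (f t)%:E).
  apply: integrableS ifn => //.
  by move=> t; rewrite /= !in_itv /= andbT => /andP[/(lt_le_trans _) -> //].
(* On [1, 2] one has t^(x-1) >= 1/t >= 1/2, since x > 0, and exp(-t) >= exp(-2). *)
pose k : R := 2^-1 * expR (- 2).
have k0 : 0 < k by rewrite mulr_gt0 ?expR_gt0// invr_gt0.
apply: (@lt_le_trans _ _ (\int[leb]_(t in `[1, 2]) k)).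
  have L : leb `[1%R, 2%R]%classic = 1%:E.
    rewrite lebesgue_measure_itv /= lte_fin ltr1n /= -EFinB; congr EFin; lra.
  rewrite Rintegral_cst//= [X in fine X](_ : _ = 1%:E)//=.
  by rewrite mulr1.
apply: (@le_trans _ _ (\int[leb]_(t in `[1, 2]) f t)).
  apply: le_Rintegral => //.
    apply: continuous_compact_integrable; first exact: segment_compact.
    by apply: continuous_subspaceT => t; exact: cvg_cst.
  move=> t; rewrite /= in_itv /= => /andP[t1 t2].
  have t0 : 0 < t by exact: lt_le_trans t1.
  apply: ler_pM => //; rewrite ?invr_ge0 ?expR_ge0//; last by rewrite ler_expR lerN2.
  rewrite powRB; last by rewrite (gt_eqF t0) implybT.
  rewrite powRr1 ?(ltW t0)// -[leLHS]mul1r; apply: ler_pM => //.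
    by rewrite -(powRr0 t) ler_powR// ltW.
  by rewrite lef_pV2 ?posrE.
rewrite /Gamma /Rintegral; apply: fine_le.
- exact: integrable_fin_num ifn2.
- exact: integrable_fin_num ifn.
apply: ge0_subset_integral => //.
- by move=> t _; rewrite lee_fin.
- by move=> t; rewrite /= !in_itv /= andbT => /andP[/(lt_le_trans _) -> //].
Qed.

End gamma_positivity.

(** * Radial profiles as isotropic covariances *)

Section radial_profile.
Context {R : realType}.
Local Notation lebn n := (lebesgue_tuple R n).
Implicit Types (e : R^nat) (mu V K a : R).

Lemma dotp_ge0 n (h : 'rV[R]_n) : 0 <= dotp h h.
Proof. by apply: sumr_ge0 => i _; rewrite -expr2 sqr_ge0. Qed.

Lemma enorm_ge0 n (h : 'rV[R]_n) : 0 <= enorm h.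
Proof. exact: sqrtr_ge0. Qed.

Lemma sqr_enorm n (h : 'rV[R]_n) : enorm h ^+ 2 = dotp h h.
Proof. by rewrite sqr_sqrtr ?dotp_ge0. Qed.

Lemma sqr_enorm_sum n (h : 'rV[R]_n) : enorm h ^+ 2 = \sum_(i < n) h ord0 i ^+ 2.
Proof. by rewrite sqr_enorm; apply: eq_bigr => i _; rewrite expr2. Qed.

Lemma enormN n (h : 'rV[R]_n) : enorm (- h) = enorm h.
Proof. by congr Num.sqrt; apply: eq_bigr => i _; rewrite !mxE mulrNN. Qed.

Lemma sqr_enorm_row_of_tuple n (t : n.-tuple R) : enorm (row_of_tuple t) ^+ 2 = tuple_sqr t.
Proof. by rewrite sqr_enorm_sum; apply: eq_bigr => i _; rewrite mxE. Qed.

Lemma enorm_surj n (r : R) : (0 < n)%N -> 0 <= r -> exists u : 'rV[R]_n, enorm u = r.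
Proof.
case: n => // n _ r0; exists (\row_i if i == ord0 then r else 0).
apply/eqP; rewrite -(@eqrXn2 _ 2%N)// ?enorm_ge0//; apply/eqP.
rewrite sqr_enorm_sum big_ord_recl big1 ?addr0 => [|i _]; rewrite mxE ?eqxx//=.
by rewrite expr0n.
Qed.

Lemma continuous_sqr_enorm n : continuous (fun h : 'rV[R]_n => enorm h ^+ 2).
Proof.
have -> : (fun h : 'rV[R]_n => enorm h ^+ 2) = (fun h => \sum_(i < n) h ord0 i ^+ 2).
  by apply/funext => h; exact: sqr_enorm_sum.
move=> h; apply: (@cvg_sum R _ (nbhs h) (nbhs_filter h) _ _
  (fun i (h : 'rV[R]_n) => h ord0 i ^+ 2) (fun i => h ord0 i ^+ 2)) => i.
apply: (@continuous_comp _ _ _ (fun h : 'rV[R]_n => h ord0 i) (fun x => x ^+ 2)).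
  exact: coord_continuous.
exact: exprn_continuous.
Qed.

Definition profile_cov n K mu e V (h : 'rV[R]_n) : R := K * profile mu e (V - enorm h ^+ 2).

Section profile_cov_theory.
Context (n : nat) (K mu : R) (e : R^nat) (V : R).
Context (mu1 : 1 < mu) (V0 : 0 <= V) (se : profile_summable mu e V).
Let C : 'rV[R]_n -> R := profile_cov K mu e V.

Lemma profile_cov_integrable : (lebn n).-integrable setT (fun t => (C (row_of_tuple t))%:E).
Proof.
have := integrableZl measurableT K (profile_tuple_integrable n mu1 V0 se (lexx V)).
by apply: eq_integrable => // t _; rewrite /C /profile_cov sqr_enorm_row_of_tuple EFinM.
Qed.

Lemma profile_cov_continuous : continuous C.
Proof.
have -> : C = *%R K \o ((fun w => profile mu e (Num.min w V)) \o ((fun x => V - x) \o (fun h : 'rV[R]_n => enorm h ^+ 2))).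
  apply/funext => h; rewrite /C /profile_cov /=; congr (_ * profile _ _ _).
  by apply/esym/min_idPl; rewrite lerBlDr ler_wpDr// sqr_ge0.
move=> h; apply: continuous_comp; last exact: continuous_scale.
apply: continuous_comp; last exact: profile_continuous.
apply: continuous_comp; first exact: continuous_sqr_enorm.
by apply: cvgB; [exact: cvg_cst|exact: cvg_id].
Qed.

Lemma profile_cov_bounded : exists M, forall h, `|C h| <= M.
Proof.
exists (`|K| * (ppow (mu - 1) V * limn (series (fun m => `|e m| * V ^+ m / rising mu m)))) => h.
rewrite normrM ler_wpM2l//; apply: profile_bounded => //.
by rewrite lerBlDr ler_wpDr// sqr_ge0.
Qed.

Lemma profile_cov_cos (u : 'I_n -> R) : tuple_cos (C \o @row_of_tuple R n) u =
  K * ((\prod_(i < n) beta_mass (mu + i%:R / 2)) *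
       profile (mu + n%:R / 2) (expconv (pi ^+ 2 * \sum_(i < n) u i ^+ 2) e) V).
Proof.
have [_ /(_ _ (lexx V))[<- _]] := profile_fourier u mu1 V0 se.
have [ic _] := cos_sin_integrable u (profile_tuple_integrable n mu1 V0 se (lexx V)).
rewrite -(RintegralZl _ measurableT ic); apply: eq_Rintegral => t _.
by rewrite /= /C /profile_cov sqr_enorm_row_of_tuple mulrCA.
Qed.

Lemma profile_cov_sin (u : 'I_n -> R) : tuple_sin (C \o @row_of_tuple R n) u = 0.
Proof.
have [_ /(_ _ (lexx V))[_ H]] := profile_fourier u mu1 V0 se.
have [_ is_] := cos_sin_integrable u (profile_tuple_integrable n mu1 V0 se (lexx V)).
rewrite -[RHS](mulr0 K) -H -(RintegralZl _ measurableT is_); apply: eq_Rintegral => t _.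
by rewrite /= /C /profile_cov sqr_enorm_row_of_tuple mulrCA.
Qed.

Lemma isotropic_profile_cov : (forall u, 0 <= tuple_cos (C \o @row_of_tuple R n) u) ->
  isotropic_covariance C.
Proof.
move=> Cc; have [M CM] := profile_cov_bounded.
split.
- exact: (pos_semidef_fourier profile_cov_integrable CM profile_cov_continuous Cc profile_cov_sin).
- by exists (fun r => K * profile mu e (V - r ^+ 2)).
- exact: profile_cov_continuous.
- exact: profile_cov_integrable.
Qed.

End profile_cov_theory.

Lemma isotropic_bound n (C : 'rV[R]_n -> R) h : isotropic_covariance C -> `|C h| <= C 0.
Proof.
move=> [pC [c rC] _ _]; apply: pos_semidef_bound => //.
by rewrite !rC enormN.
Qed.

Lemma isotropic_fourier_inj n (C1 C2 : 'rV[R]_n -> R) :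
  isotropic_covariance C1 -> isotropic_covariance C2 ->
  (forall u, fourier C1 u = fourier C2 u) -> C1 = C2.
Proof.
move=> i1 i2; have b1 h := isotropic_bound h i1; have b2 h := isotropic_bound h i2.
have [_ _ c1 j1] := i1; have [_ _ c2 j2] := i2.
have p1 := le_trans (normr_ge0 _) (b1 0); have p2 := le_trans (normr_ge0 _) (b2 0).
apply: (fourier_inj (M := C1 0 + C2 0)) => // h.
  by apply: (le_trans (b1 h)); rewrite lerDl.
by apply: (le_trans (b2 h)); rewrite lerDr.
Qed.

End radial_profile.

(** * Spectral density of the Gauss hypergeometric covariance *)

Section gauss_covariance.
Context {R : realType}.
Local Notation lebn n := (lebesgue_tuple R n).
Implicit Types (a al be ga p q : R).

Definition gauss_coef p q a (m : nat) : R :=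
  rising p m * rising q m / m`!%:R / (a ^+ 2) ^+ m.

(** The product of be - al and ga - al is positive, so they have the same sign, and their sum is at
    least al + 1/2, so both are positive. *)
Lemma Pset_bounds n al be ga : (0 < n)%N -> Pset n al be ga ->
  [/\ 2^-1 < al, al < be, al < ga, al / 2 <= (be - al) * (ga - al) & 3 * al + 2^-1 <= be + ga].
Proof.
move=> n0 [[al0 _] [nal h1 h2]].
have n1 : 1 <= n%:R :> R by rewrite ler1n.
have pq : 0 < (be - al) * (ga - al) by nra.
have s : 0 < (be - al) + (ga - al) by lra.
have [p0 q0] : 0 < be - al /\ 0 < ga - al.
  case: (ltP 0 (be - al)) => [p0|p0]; first by split=> //; move: pq; rewrite pmulr_rgt0.
  by exfalso; nra.
by split; lra.
Qed.

(** be + ga - al >= 2 al + 1/2 > n + 1/2 gives the first bound; the second is al > n/2, the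
    convergence condition of the Gauss series at 1. *)
Lemma Pset_exponent n al be ga : (0 < n)%N -> Pset n al be ga ->
  1 < be - al + ga - n%:R / 2 /\ (be - al) + (ga - al) < be - al + ga - n%:R / 2.
Proof.
move=> n0 P; have [h1 h2 h3 _ h4] := Pset_bounds n0 P; case: P => _ [nal _ _].
split; lra.
Qed.

(** At the largest argument V = a^2, attained at the origin, the series is exactly the Gauss series
    at 1. *)
Lemma gauss_summable n a al be ga : (0 < n)%N -> 0 < a -> Pset n al be ga ->
  profile_summable (be - al + ga - n%:R / 2) (gauss_coef (be - al) (ga - al) a) (a ^+ 2).
Proof.
move=> n0 a0 P; have [_ h2 h3 _ _] := Pset_bounds n0 P; have [mu1 pq] := Pset_exponent n0 P.
have p0 : 0 < be - al by rewrite subr_gt0.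
have q0 : 0 < ga - al by rewrite subr_gt0.
rewrite /profile_summable.
suff -> : (fun m => `|gauss_coef (be - al) (ga - al) a m| * (a ^+ 2) ^+ m / rising (be - al + ga - n%:R / 2) m) =
  gauss_term (be - al) (ga - al) (be - al + ga - n%:R / 2) by exact: is_cvg_gauss_term.
apply/funext => m.
have e0 : 0 <= gauss_coef (be - al) (ga - al) a m.
  by rewrite !divr_ge0 ?mulr_ge0 ?rising_ge0 ?(ltW p0) ?(ltW q0)// exprn_ge0// sqr_ge0.
rewrite ger0_norm// /gauss_coef /gauss_term divfK; last by rewrite !expf_neq0// gt_eqF.
by rewrite invfM mulrA mulrAC.
Qed.

(** The power of a^2 accounts for the profile being written in a^2 - r^2 instead of 1 - r^2/a^2. *)
Definition gauss_amplitude (n : nat) a al be ga : R :=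
  let c := be - al + ga - n%:R / 2 in
  Gamma (be - n%:R / 2) * Gamma (ga - n%:R / 2) / (Gamma c * Gamma (al - n%:R / 2))
  / (a ^+ 2) `^ (c - 1).

Lemma gauss_amplitude_gt0 n a al be ga : (0 < n)%N -> 0 < a -> Pset n al be ga ->
  0 < gauss_amplitude n a al be ga.
Proof.
move=> n0 a0 P; have [h1 h2 h3 _ _] := Pset_bounds n0 P; have [mu1 _] := Pset_exponent n0 P.
have [_ [nal _ _]] := P.
have G x : 0 < x -> 0 < Gamma x by exact: Gamma_gt0.
rewrite /gauss_amplitude divr_gt0 ?powR_gt0 ?exprn_gt0//.
by rewrite divr_gt0// mulr_gt0// G; lra.
Qed.

Lemma gauss_covE n a al be ga : (0 < n)%N -> 0 < a -> Pset n al be ga ->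
  @gauss_cov R n a al be ga =
  profile_cov (gauss_amplitude n a al be ga) (be - al + ga - n%:R / 2)
    (gauss_coef (be - al) (ga - al) a) (a ^+ 2).
Proof.
move=> n0 a0 P; have [mu1 _] := Pset_exponent n0 P.
have a20 : 0 < a ^+ 2 by rewrite exprn_gt0.
apply/funext => h; rewrite /gauss_cov /profile_cov.
move: (enorm_ge0 h); move: (enorm h) => r r0; rewrite /gauss_radial /gauss_amplitude.
case: ltP => ra; last first.
  by rewrite profile_le0 ?mulr0// subr_le0 ler_sqr ?nnegrE// ltW.
have w0 : 0 < a ^+ 2 - r ^+ 2 by rewrite subr_gt0 ltr_sqr ?nnegrE// ltW.
have -> : 1 - r ^+ 2 / a ^+ 2 = (a ^+ 2 - r ^+ 2) / a ^+ 2.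
  by rewrite mulrBl divff// gt_eqF.
move: mu1 w0; move: (be - al + ga - n%:R / 2) (a ^+ 2 - r ^+ 2) => c w c1 w0.
rewrite /profile ppowE ?(ltW w0)//.
rewrite max_r ?(ltW w0)//.
have -> : (w / a ^+ 2) `^ (c - 1) = w `^ (c - 1) / (a ^+ 2) `^ (c - 1).
  by rewrite powRM ?invr_ge0 ?(ltW w0) ?(ltW a20)// -powR_inv1 ?(ltW a20)// -powRrM mulN1r powRN.
have -> : hyp2F1 (be - al) (ga - al) c (w / a ^+ 2) =
    limn (series (profile_series c (gauss_coef (be - al) (ga - al) a) w)).
  rewrite /hyp2F1; congr (limn (series _)); apply/funext => m.
  rewrite /profile_series /gauss_coef expr_div_n.
  move: (rising (be - al) m) (rising (ga - al) m) (rising c m)^-1 (w ^+ m) ((a ^+ 2) ^+ m)^-1 (m`!%:R^-1 : R).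
  by move=> x1 x2 x3 x4 x5 x6; ring.
rewrite !mulrA; congr (_ * _); rewrite -!mulrA; congr (_ * (_ * (_ * _))); exact: mulrC.
Qed.

Lemma spectral_termE a al be ga y : 0 < a ->
  profile_series (be + ga - al) (expconv y (gauss_coef (be - al) (ga - al) a)) (a ^+ 2) =
  spectral_term (be - al) (ga - al) (be + ga - al) (y * a ^+ 2).
Proof.
move=> a0; apply/funext => m; rewrite /profile_series /spectral_term; congr (_ / _).
rewrite /expconv mulr_suml (reindex_inj rev_ord_inj) /=.
apply: eq_bigr => -[i /= im] _; have {}im : (i <= m)%N by rewrite -ltnS.
rewrite subSS subKn// /gauss_coef.
have an0 k : (a ^+ 2) ^+ k != 0 by rewrite !expf_neq0// gt_eqF.
have -> : (a ^+ 2) ^+ m = (a ^+ 2) ^+ (m - i) * (a ^+ 2) ^+ i by rewrite -exprD subnK.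
have -> : (- (y * a ^+ 2)) ^+ i = (- y) ^+ i * (a ^+ 2) ^+ i by rewrite -mulNr exprMn.
move: (an0 (m - i)%N) (an0 i); move: ((a ^+ 2) ^+ (m - i)) ((a ^+ 2) ^+ i) => x1 x2 x10 x20.
move: (_ / (m - i)`!%:R) (i`!%:R^-1 : R) ((- y) ^+ i) => x3 x4 x5.
by field.
Qed.

(* Does not depend on the dimension: the shift -n/2 in the exponent of the radial
   part is compensated by the n half-integer shifts of the Fourier transform. *)
Definition gauss_spectrum a al be ga (r : R) : R :=
  (a ^+ 2) `^ (be + ga - al - 1) *
  limn (series (spectral_term (be - al) (ga - al) (be + ga - al) (pi ^+ 2 * r ^+ 2 * a ^+ 2))).

Definition gauss_mass n a al be ga : R :=
  gauss_amplitude n a al be ga * \prod_(i < n) beta_mass (be - al + ga - n%:R / 2 + i%:R / 2).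

Lemma gauss_mass_gt0 n a al be ga : (0 < n)%N -> 0 < a -> Pset n al be ga ->
  0 < gauss_mass n a al be ga.
Proof.
move=> n0 a0 P; have [mu1 _] := Pset_exponent n0 P.
rewrite mulr_gt0 ?gauss_amplitude_gt0//; apply: prodr_gt0 => i _.
by apply: beta_mass_gt0; rewrite ltr_wpDr// divr_ge0.
Qed.

Lemma gauss_spectrum_ge0 n a al be ga r : (0 < n)%N -> Pset n al be ga ->
  0 <= gauss_spectrum a al be ga r.
Proof.
move=> n0 P; have [h1 h2 h3 h4 h5] := Pset_bounds n0 P.
rewrite mulr_ge0 ?powR_ge0//; apply: spectral_series_ge0 => //.
by rewrite -!exprMn sqr_ge0.
Qed.

Lemma scaled_gauss_covE n s a al be ga : (0 < n)%N -> 0 < a -> Pset n al be ga ->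
  (fun h : 'rV[R]_n => s * gauss_cov a al be ga h) =
  profile_cov (s * gauss_amplitude n a al be ga) (be - al + ga - n%:R / 2)
    (gauss_coef (be - al) (ga - al) a) (a ^+ 2).
Proof.
by move=> n0 a0 P; apply/funext => h; rewrite gauss_covE// /profile_cov mulrA.
Qed.

Lemma gauss_cos n s a al be ga (u : 'rV[R]_n) : (0 < n)%N -> 0 < a -> Pset n al be ga ->
  tuple_cos ((fun h : 'rV[R]_n => s * gauss_cov a al be ga h) \o @row_of_tuple R n) (u ord0) =
  s * gauss_mass n a al be ga * gauss_spectrum a al be ga (enorm u).
Proof.
move=> n0 a0 P; have [mu1 _] := Pset_exponent n0 P.
rewrite scaled_gauss_covE// (profile_cov_cos _ mu1 (sqr_ge0 a) (gauss_summable n0 a0 P)).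
have -> : be - al + ga - n%:R / 2 + n%:R / 2 = be + ga - al by rewrite subrK addrAC.
rewrite -sqr_enorm_sum.
have -> : profile (be + ga - al) (expconv (pi ^+ 2 * enorm u ^+ 2) (gauss_coef (be - al) (ga - al) a)) (a ^+ 2)
    = gauss_spectrum a al be ga (enorm u).
  by rewrite /profile max_r ?sqr_ge0// ppowE ?sqr_ge0// spectral_termE.
rewrite /gauss_mass; move: (gauss_amplitude _ _ _ _ _) (\prod_(_ < n) _) (gauss_spectrum _ _ _ _ _) => x1 x2 x3.
by rewrite !mulrA.
Qed.

Lemma gauss_fourier n s a al be ga (u : 'rV[R]_n) : (0 < n)%N -> 0 < a -> Pset n al be ga ->
  fourier (fun h => s * gauss_cov a al be ga h) u =
  Complex (s * gauss_mass n a al be ga * gauss_spectrum a al be ga (enorm u)) 0.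
Proof.
move=> n0 a0 P; have [mu1 _] := Pset_exponent n0 P.
rewrite fourierE gauss_cos//; congr Complex.
rewrite scaled_gauss_covE// (profile_cov_sin _ mu1 (sqr_ge0 a) (gauss_summable n0 a0 P)).
exact: oppr0.
Qed.

Lemma gauss_isotropic n s a al be ga : (0 < n)%N -> 0 < a -> Pset n al be ga -> 0 <= s ->
  isotropic_covariance (fun h : 'rV[R]_n => s * gauss_cov a al be ga h).
Proof.
move=> n0 a0 P s0; have [mu1 _] := Pset_exponent n0 P.
have Cc u : 0 <= tuple_cos ((fun h : 'rV[R]_n => s * gauss_cov a al be ga h) \o @row_of_tuple R n) u.
  have [v <-] := tuple_of_row u; rewrite gauss_cos//.
  apply: mulr_ge0; last exact: gauss_spectrum_ge0 P.
  by apply: mulr_ge0 => //; apply: ltW; exact: gauss_mass_gt0.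
rewrite scaled_gauss_covE// in Cc *.
exact: (isotropic_profile_cov mu1 (sqr_ge0 a) (gauss_summable n0 a0 P)).
Qed.

End gauss_covariance.

Lemma gauss_radial_shift (R : realType) (d k : nat) (a al be ga r : R) :
  gauss_radial d a (al - k%:R / 2) (be - k%:R / 2) (ga - k%:R / 2) r =
  gauss_radial (d + k) a al be ga r.
Proof.
have E x : x - k%:R / 2 - d%:R / 2 = x - (d + k)%:R / 2.
  by rewrite natrD mulrDl opprD addrAC addrA.
have D x : x - k%:R / 2 - (al - k%:R / 2) = x - al by rewrite opprB addrA subrK.
have F : be - al + (ga - k%:R / 2) - d%:R / 2 = be - al + ga - (d + k)%:R / 2.
  by rewrite natrD; lra.
by rewrite /gauss_radial !E !D F.
Qed.

Theorem theorem10 (R : realType) (d : nat) (a al be ga : R) (k : nat)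
    (d_ge1 : (1 <= d)%N) (a_gt0 : 0 < a) (Pd : Pset d al be ga)
    (Pdk : Pset (d + k) (al - k%:R / 2) (be - k%:R / 2) (ga - k%:R / 2)) :
  exists C' : 'rV[R]_(d + k) -> R,
    unique (@descente R d k (@gauss_cov R d a al be ga)) C' /\
    @gauss_class R (d + k) C' /\
    (exists2 lam : R, lam != 0 &
       radial_part C' (fun r => lam * gauss_radial d a
         (al - k%:R / 2) (be - k%:R / 2) (ga - k%:R / 2) r)).
Proof.
have dk0 : (0 < d + k)%N by rewrite addn_gt0 d_ge1.
(* The lower bound on al comes from the shifted triplet, the other two inequalities from [Pd]. Both
   covariances can thus use the same al, be, ga, and hence literally the same [gauss_spectrum]. *)
have P : Pset (d + k) al be ga.
  case: Pd => H [_ h1 h2]; case: Pdk => _ [h3 _ _]; split=> //; split=> //.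
  by apply: lt_le_trans h3 _; rewrite gerBl divr_ge0.
pose m n := gauss_mass n a al be ga.
have md : 0 < m d by exact: gauss_mass_gt0.
have mdk : 0 < m (d + k)%N by exact: gauss_mass_gt0.
(* The only discrepancy between the two spectral densities is the mass in front; this ratio removes
   it. *)
pose lam := m d / m (d + k)%N.
have lam0 : 0 < lam by rewrite divr_gt0.
pose c r := Complex (m d * gauss_spectrum a al be ga r) 0.
pose C (h : 'rV[R]_d) := 1 * gauss_cov a al be ga h.
have CE : C = @gauss_cov R d a al be ga by apply/funext => h; rewrite /C mul1r.
have cC : radial_spectral_density (@gauss_cov R d a al be ga) c.
  by move=> u; rewrite -CE gauss_fourier// mul1r.
have iC : isotropic_covariance (@gauss_cov R d a al be ga) by rewrite -CE; exact: gauss_isotropic.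
pose C' (h : 'rV[R]_(d + k)) := lam * gauss_cov a al be ga h.
have cC' : radial_spectral_density C' c.
  by move=> u; rewrite gauss_fourier// /lam -/(m (d + k)%N) divfK ?gt_eqF.
have iC' : isotropic_covariance C' by apply: gauss_isotropic => //; exact: ltW.
exists C'; split; last split.
- split; first by split=> //; exists c.
  move=> C2 [_ iC2 [c2 [cC2 cC2']]].
  apply: isotropic_fourier_inj => // v.
  (* A competing radial density c2 is tied to the common one only at norms of vectors of R^d; as d
     >= 1 these exhaust [0, +oo[, hence include the norm of v. *)
  have [u uv] := enorm_surj d_ge1 (enorm_ge0 v).
  by rewrite cC' cC2' -uv -cC -cC2.
- exists (Num.sqrt lam), a, al, be, ga; split=> //; first by rewrite sqrtr_gt0.
  by apply/funext => h; rewrite sqr_sqrtr ?(ltW lam0).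
- exists lam; first by rewrite gt_eqF.
  by move=> h; rewrite gauss_radial_shift.
Qed.
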